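(* Let $2<p\leq 3$. Suppose that for each $i\in\mathcal{J}$ there exist $A_i\subset B_i\subset C_i\subset\mathcal{J}$ such that $X_i$ is independent of $X_{A_i^c}$, $X_{A_i}$ is independent of $X_{B_i^c}$, and $X_{B_i}$ is independent of $X_{C_i^c}$. Let $N(C_i)=\{j\in\mathcal{J}: C_i\cap B_j\neq\varnothing\}$ and assume that $\max(|N(C_i)|,\,|\{j\in\mathcal{J}: i\in C_j\}|)\leq\kappa$ for every $i\in\mathcal{J}$. Then $$\sup_{z\in\mathbb{R}} |F(z) - \Phi(z)| \leq 75\,\kappa^{p-1} \sum_{i \in \mathcal{J}} E|X_i|^p.$$
   Context: $\mathcal{J}$ is a finite index set and $\{X_i, i\in\mathcal{J}\}$ is a family of real random variables on a common probability space with zero means and finite variances. $W=\sum_{i\in\mathcal{J}}X_i$, and it is assumed that $\mathrm{Var}(W)=1$. $F$ is the distribution function of $W$ and $\Phi$ is the standard normal distribution function. For $A\subset\mathcal{J}$, $X_A=\{X_i, i\in A\}$, $A^c=\mathcal{J}\setminus A$, and $|A|$ is the cardinality of $A$. *)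

(* Defs.v *)
From HB Require Import structures.
From mathcomp Require Import all_boot all_order all_algebra.
From mathcomp Require Import all_classical all_reals all_analysis.

Set Implicit Arguments.
Unset Strict Implicit.
Unset Printing Implicit Defensive.

Import Order.TTheory GRing.Theory Num.Theory.
Import numFieldNormedType.Exports.

Local Open Scope classical_set_scope.
Local Open Scope ring_scope.

Definition independent_systems (d : measure_display) (T : measurableType d)
    (R : realType) (P : probability T R) (G H : set (set T)) : Prop :=
  forall E F : set T, G E -> H F -> P (E `&` F) = (P E * P F)%E.

(* The sigma-algebra sigma(X_i, i \in A); it is {set0, setT} when A is empty. *)
Definition sigma_family (d : measure_display) (T : measurableType d)
    (R : realType) (P : probability T R) (J : finType)
    (X : J -> {RV P >-> R}) (A : {set J}) : set (set T) :=
  <<s \bigcup_(i in [set` A]) g_sigma_algebra_preimage (X i) >>.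

(* X_i is independent of the family X_D. *)
Definition indep_rv_family (d : measure_display) (T : measurableType d)
    (R : realType) (P : probability T R) (J : finType)
    (X : J -> {RV P >-> R}) (i : J) (D : {set J}) : Prop :=
  independent_systems P (g_sigma_algebra_preimage (X i)) (sigma_family X D).

(* The families X_A and X_D are independent of each other; nothing is assumed
   about the dependence inside either family. *)
Definition indep_families (d : measure_display) (T : measurableType d)
    (R : realType) (P : probability T R) (J : finType)
    (X : J -> {RV P >-> R}) (A D : {set J}) : Prop :=
  independent_systems P (sigma_family X A) (sigma_family X D).

(* N(D) = {j : D meets B_j} *)
Definition neighbourhood (J : finType) (B : J -> {set J}) (D : {set J}) :
    {set J} :=
  [set j | D :&: B j != finset.set0]%SET.

Definition std_normal_cdf (R : realType) (z : R) : \bar R :=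
  normal_prob 0 1 `]-oo, z].

(* Main.v *)
From HB Require Import structures.
From mathcomp Require Import all_boot all_order all_algebra.
From mathcomp Require Import all_classical all_reals all_analysis.
From mathcomp Require Import measurable_realfun ring lra.
Require Import Defs.

Set Implicit Arguments.
Unset Strict Implicit.
Unset Printing Implicit Defensive.

Import Order.TTheory GRing.Theory Num.Theory.
Import numFieldNormedType.Exports.

Local Open Scope classical_set_scope.
Local Open Scope ring_scope.

(** The proof is Stein's method for a locally dependent sum; the discontinuity of
the test function 1(w <= z) is handled by a concentration inequality.

Write Y_i, V_i, Z_i for the sums of the X_j over A_i, B_i, C_i, put xi_i = X_i Y_i,
q = p - 2 and beta = kappa^(p-1) sum_i E|X_i|^p. Both distribution functions lie
in [0, 1], so 75 beta <= 1 may be assumed. Replace 1(w <= z) by a C^1 function h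
that decreases from 1 to 0 on an interval of length 2 al, and let f be the bounded
solution of f'(w) - w f(w) = h(w) - E h(N), with N standard normal ([stein]).
As X_i is independent of W - Y_i and centred,
E W f(W) = sum_i E X_i (f(W) - f(W - Y_i)). Moreover sum_i E xi_i = Var W = 1
([Ex_W2]) and xi_i is independent of W - V_i. Hence E h(W) - E h(N) is a sum over i
of three expected increments of f', each weighted by |xi_i| or by E|xi_i|
([stein_summand]).

By Stein's equation f'(w) = w f(w) + h(w) - E h(N). When w moves by v, the term w f(w)
moves by O(min(1, |v| (1 + |w|))); writing |W| <= |W - Z_i| + |Z_i|, where W - Z_i is
independent of the block B_i, turns this into |v|^q and |Z_i|^q
([mul_stein_increment], [weighted_increment]). The term h moves by at most the mass
that W puts near a window of width al, and the concentration inequality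
([concentration]) bounds this mass by a multiple of al even in the presence of a weight
that depends on the block B_i ([weighted_smooth_diff]). Everything is thus reduced
to sums of E |X_i| |S_i| |S'_i|^q with S_i, S'_i partial sums inside C_i, and Young's
inequality together with the two cardinality conditions bounds such a sum by beta
([sum_third], [sum_third_indep]). This gives |E h(W) - E h(N)| <= 35.1 beta
([smooth_bound]); the choice of al just above 10 beta costs at most 10 beta more
because the normal density is at most 1/2 ([kolmogorov_distance]).

The concentration inequality is itself proved in Stein's manner. Let F' be a tent
function of width al, let g >= 0 depend on the block B_i only, and let W_far be the sum
of the X_j with B_j disjoint from B_i. On the one hand |E g W_far F(W)| is
O(al E g), since F is bounded by al/2 and E g W_far^2 = E g E W_far^2
([window_kernel_mean_le]). On the other hand it equals the integral over t of
E g F'(W + t) K(t), up to small terms, where K(t) is a sum over far j of the X_j with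
a sign that records whether t lies between 0 and -Y_j. The mean of K(t) has total
mass almost 1 ([far_mean_ge]), and its fluctuations are small because each far
summand is correlated with at most kappa others ([far_sum_sqr]). Replacing
K(t) by its mean and F'(W + t) by F'(W) leaves a multiple of E g F'(W) plus an error
controlled by the supremum of the same quantity over all positions of the window,
and the resulting self-referential inequality can be solved
([window_mean_contraction], [concentration_bounded]).

Finally, an index i outside its own A_i has X_i independent of itself, hence
almost surely zero; deleting these variables ([essential]) makes every j of C_i that
still contributes an element of N(C_i), so that kappa bounds the number of terms
of a sum over C_i. *)

(** * Expectations of integrable functions, and products of independent factors *)

Section Expectation.
Context d (T : measurableType d) (R : realType) (P : probability T R).
Implicit Types (f g : T -> R) (c : R).

Definition L1 f := P.-integrable setT (EFin \o f).
Definition Ex f : R := \int[P]_w f w.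

Lemma L1_meas f : L1 f -> measurable_fun setT f.
Proof. by move=> /integrableP[/measurable_EFinP]. Qed.

Lemma ExE f : L1 f -> (Ex f)%:E = (\int[P]_w (f w)%:E)%E.
Proof. by move=> Lf; rewrite /Ex /Rintegral fineK//; exact: integrable_fin_num. Qed.

Lemma L1_le f g : measurable_fun setT f -> L1 g -> (forall w, `|f w| <= g w) -> L1 f.
Proof.
move=> mf Lg fg; apply: (le_integrable measurableT) Lg => //.
  exact/measurable_EFinP.
by move=> w _ /=; rewrite lee_fin (le_trans (fg w))// ler_norm.
Qed.

Lemma L1_cst c : L1 (fun=> c).
Proof. exact: finite_measure_integrable_cst. Qed.

Lemma L1_bnd f c : measurable_fun setT f -> (forall w, `|f w| <= c) -> L1 f.
Proof. by move=> mf fc; apply: L1_le mf (L1_cst c) fc. Qed.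

Lemma L1D f g : L1 f -> L1 g -> L1 (fun w => f w + g w).
Proof. by move=> Lf Lg; exact: (integrableD measurableT Lf Lg). Qed.

Lemma L1Zl c f : L1 f -> L1 (fun w => c * f w).
Proof. by move=> Lf; exact: (integrableZl measurableT c Lf). Qed.

Lemma L1Zr c f : L1 f -> L1 (fun w => f w * c).
Proof. by under [X in _ -> L1 X]eq_fun do rewrite mulrC; exact: L1Zl. Qed.

Lemma L1N f : L1 f -> L1 (fun w => - f w).
Proof. by under [X in _ -> L1 X]eq_fun do rewrite -mulN1r; exact: L1Zl. Qed.

Lemma L1B f g : L1 f -> L1 g -> L1 (fun w => f w - g w).
Proof. by move=> Lf Lg; apply: L1D => //; exact: L1N. Qed.

Lemma L1_abs f : L1 f -> L1 (fun w => `|f w|).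
Proof. by move=> Lf; have := integrable_abse Lf. Qed.

Lemma L1_sum (I : Type) (s : seq I) (Q : pred I) (F : I -> T -> R) :
  (forall i, Q i -> L1 (F i)) -> L1 (fun w => \sum_(i <- s | Q i) F i w).
Proof.
move=> LF; elim: s => [|i s IH].
  rewrite (_ : (fun w => _) = (fun=> 0)); first exact: L1_cst.
  by apply/funext => w; rewrite big_nil.
case Qi : (Q i).
  rewrite (_ : (fun w => _) = (fun w => F i w + \sum_(i <- s | Q i) F i w)).
    by apply: L1D => //; exact: LF.
  by apply/funext => w; rewrite big_cons Qi.
rewrite (_ : (fun w => _) = (fun w => \sum_(i <- s | Q i) F i w))//.
by apply/funext => w; rewrite big_cons Qi.
Qed.

Lemma ExD f g : L1 f -> L1 g -> Ex (fun w => f w + g w) = Ex f + Ex g.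
Proof. by move=> Lf Lg; exact: RintegralD. Qed.

Lemma ExB f g : L1 f -> L1 g -> Ex (fun w => f w - g w) = Ex f - Ex g.
Proof. by move=> Lf Lg; exact: RintegralB. Qed.

Lemma ExZl c f : L1 f -> Ex (fun w => c * f w) = c * Ex f.
Proof. by move=> Lf; exact: RintegralZl. Qed.

Lemma ExZr c f : L1 f -> Ex (fun w => f w * c) = Ex f * c.
Proof. by move=> Lf; exact: RintegralZr. Qed.

Lemma ExN f : L1 f -> Ex (fun w => - f w) = - Ex f.
Proof.
by move=> Lf; under [LHS]eq_Rintegral do rewrite -mulN1r; rewrite -/(Ex _) ExZl// mulN1r.
Qed.

Lemma Ex_cst c : Ex (fun=> c) = c.
Proof.
rewrite /Ex Rintegral_cst// -[RHS]mulr1; congr (_ * _).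
by rewrite -[RHS]/(fine 1%E); congr fine; exact: probability_setT.
Qed.

Lemma Ex_eq f g : f =1 g -> Ex f = Ex g.
Proof. by move=> fg; apply: eq_Rintegral => w _; exact: fg. Qed.

Lemma Ex_sum (I : Type) (s : seq I) (Q : pred I) (F : I -> T -> R) :
  (forall i, Q i -> L1 (F i)) ->
  Ex (fun w => \sum_(i <- s | Q i) F i w) = \sum_(i <- s | Q i) Ex (F i).
Proof.
move=> LF; elim: s => [|i s IH].
  by rewrite big_nil -[RHS](Ex_cst 0); apply: Ex_eq => w; rewrite big_nil.
rewrite big_cons -IH.
case: ifP => Qi; last by apply: Ex_eq => w; rewrite big_cons Qi.
rewrite -ExD; [|exact: LF|exact: L1_sum].
by apply: Ex_eq => w; rewrite big_cons Qi.
Qed.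

Lemma Ex_le f g : L1 f -> L1 g -> (forall w, f w <= g w) -> Ex f <= Ex g.
Proof. by move=> Lf Lg fg; apply: le_Rintegral. Qed.

Lemma Ex_ge0 f : (forall w, 0 <= f w) -> 0 <= Ex f.
Proof. by move=> f0; apply: Rintegral_ge0. Qed.

Lemma Ex_abs f : L1 f -> `|Ex f| <= Ex (fun w => `|f w|).
Proof. by move=> Lf; apply: le_normr_Rintegral. Qed.

Lemma Ex_abs_le f g : L1 f -> L1 g -> (forall w, `|f w| <= g w) -> `|Ex f| <= Ex g.
Proof.
move=> Lf Lg fg; apply: le_trans (Ex_abs Lf) _.
by apply: Ex_le => //; exact: L1_abs.
Qed.

Lemma L1_bndM f g c : measurable_fun setT f -> (forall w, `|f w| <= c) -> L1 g ->
  L1 (fun w => f w * g w).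
Proof.
move=> mf fc Lg; apply: (@L1_le _ (fun w => c * `|g w|)).
- by apply: measurable_funM => //; exact: L1_meas.
- exact/L1Zl/L1_abs.
- by move=> w; rewrite normrM ler_wpM2r.
Qed.

(** A product of square-integrable functions is dominated by the mean of the squares. *)
Lemma L1_sqM f g : measurable_fun setT f -> measurable_fun setT g ->
  L1 (fun w => f w ^+ 2) -> L1 (fun w => g w ^+ 2) -> L1 (fun w => f w * g w).
Proof.
move=> mf mg Lf Lg; apply: (@L1_le _ (fun w => f w ^+ 2 + g w ^+ 2)).
- exact: measurable_funM.
- exact: L1D.
- move=> w; have := sqr_ge0 (f w + g w); have := sqr_ge0 (f w - g w).
  have := sqr_ge0 (f w); have := sqr_ge0 (g w); rewrite !sqrrD sqrrN mulrN mulNrn.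
  by move=> *; rewrite ler_norml; apply/andP; split; lra.
Qed.

Lemma L1_sqD f g : measurable_fun setT f -> measurable_fun setT g ->
  L1 (fun w => f w ^+ 2) -> L1 (fun w => g w ^+ 2) -> L1 (fun w => (f w + g w) ^+ 2).
Proof.
move=> mf mg Lf Lg.
apply: (@L1_le _ (fun w => 2 * (f w ^+ 2 + g w ^+ 2))).
- by apply: measurable_funX; exact: measurable_funD.
- exact/L1Zl/L1D.
- move=> w; rewrite ger0_norm ?sqr_ge0//.
  have := sqr_ge0 (f w - g w); rewrite !sqrrD sqrrN mulrN mulNrn; lra.
Qed.

Lemma L1_sqrt f : measurable_fun setT f -> L1 (fun w => f w ^+ 2) -> L1 f.
Proof.
move=> mf Lf; apply: (@L1_le _ (fun w => 1 + f w ^+ 2)) => //.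
  by apply: L1D => //; exact: L1_cst.
move=> w; have := sqr_ge0 (f w + 1); have := sqr_ge0 (f w - 1).
rewrite !sqrrD sqrrN mulrN mulNrn expr1n mulr1.
by have := sqr_ge0 (f w); rewrite ler_norml => *; apply/andP; split; lra.
Qed.

Lemma L1_sq_sum (I : Type) (s : seq I) (Q : pred I) (F : I -> T -> R) :
  (forall i, measurable_fun setT (F i)) -> (forall i, L1 (fun w => F i w ^+ 2)) ->
  L1 (fun w => (\sum_(i <- s | Q i) F i w) ^+ 2).
Proof.
move=> mF LF; elim: s => [|i s IH].
  rewrite (_ : (fun w => _) = fun=> 0); first exact: L1_cst.
  by apply/funext => w; rewrite big_nil expr0n.
case Qi : (Q i); last first.
  by move: IH; congr L1; apply/funext => w; rewrite big_cons Qi.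
rewrite (_ : (fun w => _) = fun w => (F i w + \sum_(i <- s | Q i) F i w) ^+ 2); last first.
  by apply/funext => w; rewrite big_cons Qi.
apply: L1_sqD => //.
under eq_fun do rewrite big_mkcond.
by apply: measurable_sum => j; case: (Q j).
Qed.

End Expectation.

Section Independence.
Context d (T : measurableType d) (R : realType) (P : probability T R).
Variables G H : set (set T).
Hypothesis mG : G `<=` measurable.
Hypothesis mH : H `<=` measurable.
Let TG : measurableType _ := g_sigma_algebraType G.
Let TH : measurableType _ := g_sigma_algebraType H.

Lemma gen_measurable : <<s G >> `<=` measurable.
Proof. by apply: smallest_sub => //; exact: sigma_algebra_measurable. Qed.

Lemma measurable_fun_gen d' (T' : measurableType d') (f : T -> T') :
  measurable_fun (setT : set TG) f -> measurable_fun (setT : set T) f.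
Proof.
move=> mf _ Y mY; have := mf measurableT Y mY.
exact: gen_measurable.
Qed.

End Independence.

Section IndependenceProduct.
Context d (T : measurableType d) (R : realType) (P : probability T R).
Variables G H : set (set T).
Hypothesis mG : G `<=` measurable.
Hypothesis mH : H `<=` measurable.
Hypothesis ind : independent_systems P <<s G >> <<s H >>.
Let TG : measurableType _ := g_sigma_algebraType G.
Let TH : measurableType _ := g_sigma_algebraType H.

Let iG (w : T) : TG := w.
Let iH (w : T) : TH := w.
Let iGH (w : T) : TG * TH := (w, w).

Let miG : measurable_fun setT iG.
Proof. by move=> _ Y mY; rewrite setTI; exact: (gen_measurable mG). Qed.
Let miH : measurable_fun setT iH.
Proof. by move=> _ Y mY; rewrite setTI; exact: (gen_measurable mH). Qed.
Let miGH : measurable_fun setT iGH.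
Proof. exact: measurable_fun_pair miG miH. Qed.

HB.instance Definition _ := isMeasurableFun.Build _ _ _ _ iG miG.
HB.instance Definition _ := isMeasurableFun.Build _ _ _ _ iH miH.
HB.instance Definition _ := isMeasurableFun.Build _ _ _ _ iGH miGH.

Let mu1 := distribution P iG.
Let mu2 := distribution P iH.
Let mu12 := distribution P iGH.

Let mu12E X : measurable X -> (mu1 \x mu2)%E X = mu12 X.
Proof.
apply: product_measure_unique => A B mA mB.
rewrite /mu12 /mu1 /mu2 /distribution /pushforward -ind//.
Qed.

Variables U V : T -> R.
Hypothesis mU : measurable_fun (setT : set TG) U.
Hypothesis mV : measurable_fun (setT : set TH) V.
Hypothesis LU : L1 P U.
Hypothesis LV : L1 P V.

Let UV (z : TG * TH) : R := U z.1 * V z.2.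
Let mUV : measurable_fun setT UV.
Proof.
apply: measurable_funM.
  exact: (measurableT_comp mU measurable_fst).
exact: (measurableT_comp mV measurable_snd).
Qed.

Let LU1 : mu1.-integrable setT (EFin \o U).
Proof. by apply: integrable_pushforward => //; exact/measurable_EFinP. Qed.
Let LV2 : mu2.-integrable setT (EFin \o V).
Proof. by apply: integrable_pushforward => //; exact/measurable_EFinP. Qed.

Let intUV : (mu1 \x mu2)%E.-integrable setT (EFin \o UV).
Proof.
apply/integrable12ltyP; first exact/measurable_EFinP.
rewrite (eq_integral (fun x : TG => (\int[mu2]_y `|V y|%:E) * `|U x|%:E)%E); last first.
  move=> x _; rewrite muleC -ge0_integralZl//; last first.
  - exact/measurable_EFinP/measurableT_comp.
  - by apply: eq_integral => y _ /=; rewrite normrM EFinM.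
have /integrableP[_ V2] := LV2; have /integrableP[_ U1] := LU1.
rewrite ge0_integralZl//=; last first.
- by apply: integral_ge0 => *; rewrite lee_fin.
- exact/measurable_EFinP/measurableT_comp.
have V0 : (0 <= \int[mu2]_y `|V y|%:E)%E.
  by apply: integral_ge0 => *; rewrite lee_fin.
by apply: lte_mul_pinfty => //; rewrite ge0_fin_numE.
Qed.

Lemma indep_L1M : L1 P (fun w => U w * V w).
Proof.
apply/integrableP; split.
  apply/measurable_EFinP; exact: measurable_funM (L1_meas LU) (L1_meas LV).
have /integrableP[_] := intUV.
rewrite (eq_measure_integral mu12); last by move=> A mA _; exact: mu12E.
rewrite /mu12 ge0_integral_pushforward//.
by apply/measurable_EFinP; exact: measurableT_comp.
Qed.

(** Independence says that the law of w |-> (w, w), on the product of the two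
sub-sigma-algebras, is the product of its marginals; the formula is then Fubini's
theorem for U(w1) V(w2). *)
Lemma indep_ExM : Ex P (fun w => U w * V w) = Ex P U * Ex P V.
Proof.
apply: EFin_inj; rewrite (ExE indep_L1M).
transitivity (\int[mu12]_z (UV z)%:E)%E.
  rewrite /mu12 integral_pushforward//; first exact/measurable_EFinP.
  exact: indep_L1M.
rewrite (eq_measure_integral (mu1 \x mu2)%E); last first.
  by move=> A mA _; exact/esym/mu12E.
rewrite -(integral12_prod_meas1 intUV) /fubini_F/=.
have E1 : Ex P U = Ex mu1 U.
  by congr fine; rewrite integral_pushforward//; exact/measurable_EFinP.
have E2 : Ex P V = Ex mu2 V.
  by congr fine; rewrite integral_pushforward//; exact/measurable_EFinP.
rewrite EFinM E1 E2 (ExE LU1) muleC -integralZl//; last first.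
apply: eq_integral => x _; rewrite muleC.
by rewrite (ExE LV2) -integralZl//; apply: eq_integral => y _; rewrite /UV EFinM.
Qed.

End IndependenceProduct.

(** * Exchange of expectations, and the uniform law on [-1, 1] *)

Section Swap.
Context d1 d2 (T1 : measurableType d1) (T2 : measurableType d2) (R : realType).
Variables (P : probability T1 R) (Q : probability T2 R).
Variables (Phi : T1 -> T2 -> R) (G : T1 -> R).
Hypothesis mPhi : measurable_fun setT (fun z : T1 * T2 => Phi z.1 z.2).
Hypothesis LG : L1 P G.
Hypothesis PhiG : forall w t, `|Phi w t| <= G w.

Let intPhi : (P \x Q)%E.-integrable setT (fun z : T1 * T2 => (Phi z.1 z.2)%:E).
Proof.
apply/integrable12ltyP; first exact/measurable_EFinP.
have G0 w : 0 <= G w.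
  exact: le_trans (PhiG w point).
have /integrableP[mG] := LG; apply: le_lt_trans.
apply: ge0_le_integral => //.
- by move=> w _; apply: integral_ge0.
- apply: (measurable_fun_fubini_tonelli_F (fun z : T1 * T2 => `|Phi z.1 z.2|%:E)).
    by apply/measurable_EFinP; exact: measurableT_comp.
  by move=> z; rewrite lee_fin.
- exact: measurableT_comp.
- move=> w _ /=; rewrite ger0_norm//.
  apply: (@le_trans _ _ (\int[Q]_y (cst (G w)%:E) y)%E).
    apply: ge0_le_integral => //.
    + apply/measurable_EFinP; apply: measurableT_comp => //.
      exact: (measurable_fun_pair2 w mPhi).
    + by move=> t _; rewrite lee_fin.
  by rewrite integral_cst//= [X in (_ * X)%E](@probability_setT _ _ _ Q) mule1.
Qed.

Lemma L1_Phi2 w : L1 Q (Phi w).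
Proof.
apply: (@L1_bnd _ _ _ _ _ (G w)); last exact: PhiG.
exact: (measurable_fun_pair2 w mPhi).
Qed.

Lemma L1_Phi1 t : L1 P (Phi^~ t).
Proof.
apply: L1_le LG _; last by move=> w; exact: PhiG.
exact: (measurable_fun_pair1 t mPhi).
Qed.

Lemma L1_Ex2 : L1 P (fun w => Ex Q (Phi w)).
Proof.
apply: eq_integrable (integrable_fubini_F intPhi) => //= w _.
by rewrite /fubini_F /= (ExE (L1_Phi2 w)).
Qed.

Lemma L1_Ex1 : L1 Q (fun t => Ex P (Phi^~ t)).
Proof.
apply: (@L1_bnd _ _ _ _ _ (Ex P G)) => [|t]; last first.
  by apply: Ex_abs_le (L1_Phi1 t) LG _ => w; exact: PhiG.
apply/measurable_EFinP; have := measurable_fubini_G intPhi.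
apply: eq_measurable_fun => t _.
by rewrite /fubini_G /= -(ExE (L1_Phi1 t)).
Qed.

Lemma Ex_swap : Ex P (fun w => Ex Q (Phi w)) = Ex Q (fun t => Ex P (Phi^~ t)).
Proof.
apply: EFin_inj; rewrite (ExE L1_Ex2) (ExE L1_Ex1).
transitivity (\int[P]_w \int[Q]_t (Phi w t)%:E)%E.
  by apply: eq_integral => w _; rewrite (ExE (L1_Phi2 w)).
rewrite (Fubini intPhi).
by apply: eq_integral => t _; rewrite (ExE (L1_Phi1 t)).
Qed.

End Swap.

Section Uniform.
Context (R : realType).

Lemma ltN11 : (-1 : R) < 1. Proof. lra. Qed.
(** Every integral over the shift variable t is written as an expectation under this law,
so that one Fubini lemma serves for all of them; the density 1/2 explains the factors 2
that appear below. *)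
Definition Q11 : probability _ R := uniform_prob ltN11.

Lemma measurable_b2r d (T : measurableType d) (b : T -> bool) :
  measurable_fun setT b -> measurable_fun setT (fun w => (b w)%:R : R).
Proof.
move=> mb; rewrite (_ : (fun w => _) = (fun w => if b w then 1 else 0)); last first.
  by apply/funext => w; case: (b w).
by apply: measurable_fun_if => //; exact: measurable_funTS.
Qed.

Lemma Ex_Q11 (f F : R -> R) (a b : R) : -1 <= a -> a <= b -> b <= 1 ->
    continuous f -> (forall x, is_derive x (1 : R) F (f x)) ->
    (forall x, a <= x <= b -> 0 <= f x) ->
  Ex Q11 (fun t : R => f t * (a <= t < b)%R%:R) = (F b - F a) / 2.
Proof.
move=> a1 ab b1 cf dF f0.
have mf : measurable_fun setT f by exact: continuous_measurable_fun.
rewrite /Ex /Rintegral integral_uniform; last 2 first.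
- apply/measurable_EFinP/measurable_funM => //.
  apply: measurable_b2r; apply: measurable_and.
    exact: measurable_fun_ler.
  exact: measurable_fun_ltr.
- move=> x; rewrite lee_fin; case: (boolP (a <= x < b)) => [/andP[ax xb]|_].
    by rewrite mulr1 f0// ax ltW.
  by rewrite mulr0.
rewrite [X in (_ * X)%E](_ : _ = (F b - F a)%:E); last first.
  rewrite integral_mkcond [LHS](_ : _ = \int[lebesgue_measure]_x
      ((fun x => (f x)%:E) \_ `[a, b[) x)%E; last first.
    apply: eq_integral => x _; rewrite /patch !mem_setE !in_itv/=.
    case: (boolP (a <= x < b)) => [/andP[ax xb]|]; last by rewrite mulr0 if_same.
    by rewrite mulr1 (le_trans a1 ax) (ltW (lt_le_trans xb b1)).
  rewrite -integral_mkcond.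
  move: ab; rewrite le_eqVlt => /orP[/eqP <-|ab].
    by rewrite set_itvco0 integral_set0 subrr.
  rewrite integral_itv_bndo_bndc; last exact/measurable_EFinP/measurable_funTS.
  rewrite (@continuous_FTC2 _ f F a b)//.
  - exact: continuous_subspaceT.
  - have cF : continuous F.
      move=> x; apply: differentiable_continuous.
      by apply/derivable1_diffP; have [] := dF x.
    split => //.
    + exact/cvg_at_right_filter/cF.
    + exact/cvg_at_left_filter/cF.
  - by move=> x _; rewrite derive1E; have [_ ->] := dF x.
by rewrite -EFinM /= opprK mulrC.
Qed.

Lemma Ex_Q11_full (f F : R -> R) : continuous f ->
    (forall x, is_derive x (1 : R) F (f x)) -> (forall x, 0 <= f x) ->
  Ex Q11 f = (F 1 - F (- 1)) / 2.
Proof.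
move=> cf dF f0.
have mf : measurable_fun setT f by exact: continuous_measurable_fun.
rewrite /Ex /Rintegral integral_uniform; last 2 first.
- exact/measurable_EFinP.
- by move=> x; rewrite lee_fin.
rewrite (@continuous_FTC2 _ f F)//; last 3 first.
- exact: continuous_subspaceT.
- have cF : continuous F.
    move=> x; apply: differentiable_continuous.
    by apply/derivable1_diffP; have [] := dF x.
  split => //.
  + exact/cvg_at_right_filter/cF.
  + exact/cvg_at_left_filter/cF.
- by move=> x _; rewrite derive1E; have [_ ->] := dF x.
by rewrite -EFinD -EFinM /= opprK mulrC.
Qed.

End Uniform.

(** * Tent functions and the kernel of an increment *)

Section Tent.
Context (R : realType).
Implicit Types (u w x y t : R).

(** A two-sided quadratic error term gives the derivative without case analysis on the
sign of the increment; all piecewise quadratic functions below are handled this way. *)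
Lemma is_derive_quadratic (g : R -> R) x c K :
  (forall h, `|g (h + x) - g x - c * h| <= K * h ^+ 2) -> is_derive x (1 : R) g c.
Proof.
move=> gK.
have cv : h^-1 *: ((g \o shift x) (h *: (1 : R)) - g x) @[h --> 0^'] --> c.
  apply/cvgrPdist_le => e e0.
  near=> h; have h0 : h != 0 by near: h; exact: nbhs_dnbhs_neq.
  have hh : `|h| * (`|K| + 1) <= e.
    rewrite -ler_pdivlMr ?ltr_wpDl//.
    near: h; apply: dnbhs0_le; rewrite divr_gt0// ltr_wpDl.
  rewrite /= [h *: 1]mulr1 -[_ *: _]/(_ * _).
  have -> : c - h^-1 * (g (h + x) - g x) = - (h^-1 * (g (h + x) - g x - c * h)).
    by field.
  rewrite normrN normrM normfV ler_pdivrMl ?normr_gt0//.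
  apply: le_trans (gK h) _; rewrite -real_normK ?num_real// expr2 mulrCA.
  rewrite ler_wpM2l//; apply: le_trans hh; rewrite mulrC ler_wpM2l//.
  by rewrite (le_trans (ler_norm K)) ?lerDl.
by apply: DeriveDef; [apply/cvg_ex; exists c|exact: cvg_lim cv].
Unshelve. all: by end_near. Qed.

Definition ramp u : R := Num.max u 0.

Lemma rampP u : (u <= 0 /\ ramp u = 0) \/ (0 <= u /\ ramp u = u).
Proof. by rewrite /ramp; case: (leP u 0) => [|/ltW]; [left|right]. Qed.

Lemma is_derive_ramp2 x : is_derive x (1 : R) (fun u => ramp u ^+ 2) (2 * ramp x).
Proof.
apply: (@is_derive_quadratic _ _ _ 1) => h.
case: (rampP x) => -[x0 ->]; case: (rampP (h + x)) => -[hx0 ->];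
  rewrite ler_norml; apply/andP; split; nra.
Qed.

Lemma continuous_ramp : continuous ramp.
Proof. by move=> u; apply: continuous_max; [exact: cvg_id|exact: cvg_cst]. Qed.

Definition tent u : R := ramp (u + 1) - 2 * ramp u + ramp (u - 1).
(** The antiderivative of [tent] that rises from 0 to 1 on [-1, 1]. *)
Definition step u : R := (ramp (u + 1) ^+ 2 - 2 * ramp u ^+ 2 + ramp (u - 1) ^+ 2) / 2.

Ltac ramps := repeat match goal with |- context [ramp ?a] =>
  let e := fresh "e" in let r := fresh "r" in
  move: (rampP a); set r := ramp a; case=> -[? e]; rewrite ?e; clear e end.

Lemma tent_ge0 u : 0 <= tent u.
Proof. rewrite /tent; ramps; lra. Qed.

Lemma tent_le1 u : tent u <= 1.
Proof. rewrite /tent; ramps; lra. Qed.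

Lemma step_ge0 u : 0 <= step u.
Proof. rewrite /step; ramps; nra. Qed.

Lemma step_le1 u : step u <= 1.
Proof. rewrite /step; ramps; nra. Qed.

Lemma step_leN1 u : u <= -1 -> step u = 0.
Proof. move=> u1; rewrite /step; ramps; nra. Qed.

Lemma step_ge1 u : 1 <= u -> step u = 1.
Proof. move=> u1; rewrite /step; ramps; nra. Qed.

Lemma continuous_tent : continuous tent.
Proof.
have cs c : continuous (fun u : R => ramp (u + c)).
  move=> u; apply: (@continuous_comp _ _ _ (fun u => u + c) ramp).
    by apply: cvgD; [exact: cvg_id|exact: cvg_cst].
  exact: continuous_ramp.
move=> u; apply: cvgD; last exact: cs.
apply: cvgB; first exact: cs.
by apply: cvgM; [exact: cvg_cst|exact: continuous_ramp].
Qed.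

Lemma is_derive_step x : is_derive x (1 : R) step (tent x).
Proof.
have ds c y : is_derive y (1 : R) (fun u => ramp (u + c) ^+ 2) (2 * ramp (y + c)).
  rewrite -[X in is_derive _ _ _ X]mulr1.
  apply: (@is_derive1_comp _ (fun u => ramp u ^+ 2) (fun u => u + c)).
    exact: is_derive_ramp2.
  by apply: is_derive_eq; rewrite addr0.
have := ds 1 x; have := ds (-1) x; have := is_derive_ramp2 x => d0 dm dp.
rewrite /step; apply: is_derive_eq; rewrite /tent.
by rewrite /GRing.scale /= ?addr0 ?mulr0; lra.
Qed.

Lemma tentP u : [\/ u <= -1 /\ tent u = 0, -1 <= u <= 0 /\ tent u = 1 + u,
  0 <= u <= 1 /\ tent u = 1 - u | 1 <= u /\ tent u = 0].
Proof.
have rp v : 0 <= v -> ramp v = v by move=> v0; rewrite /ramp max_l.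
have rn v : v <= 0 -> ramp v = 0 by move=> v0; rewrite /ramp max_r.
rewrite /tent; have [u0|/ltW u0] := leP u 0; have [u1|/ltW u1] := leP `|u| 1.
- rewrite ler0_norm// in u1; rewrite (rn u)// (rn (u - 1)) ?(rp (u + 1)); try lra.
  by apply: Or42; split; lra.
- rewrite ler0_norm// in u1; rewrite (rn u)// (rn (u - 1)) ?(rn (u + 1)); try lra.
  by apply: Or41; split; lra.
- rewrite ger0_norm// in u1; rewrite (rp u)// (rn (u - 1)) ?(rp (u + 1)); try lra.
  by apply: Or43; split; lra.
- rewrite ger0_norm// in u1; rewrite (rp u)// (rp (u - 1)) ?(rp (u + 1)); try lra.
  by apply: Or44; split; lra.
Qed.

Lemma tent_lipschitz u v : `|tent u - tent v| <= `|u - v|.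
Proof.
rewrite (ler_norml (tent u - tent v)).
have [uv|uv] := leP 0 (u - v); [rewrite (ger0_norm uv)|rewrite (ltr0_norm uv)];
case: (tentP u) => -[? ->]; case: (tentP v) => -[? ->]; apply/andP; split; lra.
Qed.

(** Five adjacent tents add up to 1 on [-2, 2]. The increment of a tent is thus controlled by
tents in shifted positions, quantities of the same kind as those to be bounded. *)
Definition tents u := tent (u - 2) + tent (u - 1) + tent u + tent (u + 1) + tent (u + 2).

Lemma tents1 u : -2 <= u <= 2 -> tents u = 1.
Proof.
move=> u2; rewrite /tents /tent.
have rp v : 0 <= v -> ramp v = v by move=> v0; rewrite /ramp max_l.
have rn v : v <= 0 -> ramp v = 0 by move=> v0; rewrite /ramp max_r.
rewrite (_ : u - 2 + 1 = u - 1); last lra.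
rewrite (_ : u - 2 - 1 = u - 3); last lra.
rewrite (_ : u - 1 + 1 = u); last lra.
rewrite (_ : u - 1 - 1 = u - 2); last lra.
rewrite (_ : u + 1 + 1 = u + 2); last lra.
rewrite (_ : u + 1 - 1 = u); last lra.
rewrite (_ : u + 2 + 1 = u + 3); last lra.
rewrite (_ : u + 2 - 1 = u + 1); last lra.
rewrite (rp (u + 3)) 1?(rp (u + 2)) 1?(rn (u - 2)) 1?(rn (u - 3)); lra.
Qed.

Lemma tent_shift u t : `|t| <= 1 -> `|tent (u + t) - tent u| <= `|t| * tents u.
Proof.
move=> t1; have := t1; rewrite ler_norml => t1'.
case: (boolP (-2 <= u <= 2)) => [u2|u2].
  rewrite tents1// mulr1; apply: le_trans (tent_lipschitz _ _) _.
  by rewrite (_ : u + t - u = t)//; lra.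
have : u < -2 \/ 2 < u.
  by move: u2; rewrite negb_and -!ltNge => /orP[]; [left|right].
move=> {}u2; have S0 : 0 <= tents u.
    have ? := tent_ge0 (u - 2); have ? := tent_ge0 (u - 1); have ? := tent_ge0 u.
    have ? := tent_ge0 (u + 1); have ? := tent_ge0 (u + 2); rewrite /tents.
    lra.
have -> : tent (u + t) = 0 by case: (tentP (u + t)) => -[? ->] //; lra.
have -> : tent u = 0 by case: (tentP u) => -[? ->] //; lra.
by rewrite subrr normr0 mulr_ge0.
Qed.

End Tent.

Section Kernel.
Context (R : realType).
Implicit Types (x y t : R).

(** The signed indicator of the interval between 0 and -y: the integral of F' against it is
F(0) - F(-y), so that increments F(W) - F(W - y) become integrals over t of F'(W + t). *)
Definition ker y t : R := (- y <= t < 0)%R%:R - (0 <= t < - y)%R%:R.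

Lemma ker_cases y t : [\/ ker y t = 0, ker y t = 1 | ker y t = -1].
Proof.
by rewrite /ker; case: (_ <= t < _); case: (_ <= t < _);
  rewrite ?(subrr, subr0, sub0r); [apply: Or31|apply: Or32|apply: Or33|apply: Or31].
Qed.

Lemma ker_le1 y t : `|ker y t| <= 1.
Proof. by case: (ker_cases y t) => ->; rewrite ?normrN ?normr0 ?normr1. Qed.

Lemma ker_sqr y t : ker y t ^+ 2 = `|ker y t|.
Proof.
by case: (ker_cases y t) => ->; rewrite ?normrN ?normr0 ?normr1 ?sqrrN ?expr0n ?expr1n.
Qed.

Lemma measurable_ker d (T : measurableType d) (Y Z : T -> R) :
  measurable_fun setT Y -> measurable_fun setT Z ->
  measurable_fun setT (fun w => ker (Y w) (Z w)).
Proof.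
move=> mY mZ; have mNY : measurable_fun setT (fun w => - Y w) by exact: measurableT_comp.
apply: measurable_funB; apply: measurable_b2r; apply: measurable_and.
- exact: measurable_fun_ler.
- exact: measurable_fun_ltr.
- exact: measurable_fun_ler.
- exact: measurable_fun_ltr.
Qed.

Variables f F : R -> R.
Hypothesis cf : continuous f.
Hypothesis dF : forall x, is_derive x (1 : R) F (f x).
Hypothesis f0 : forall x, 0 <= f x.

Lemma ker_pos y t : 0 <= y -> ker y t = (- y <= t < 0)%R%:R.
Proof.
move=> y0; rewrite /ker (_ : (0 <= t < - y) = false) ?subr0//.
by apply/negP => /andP[]; lra.
Qed.

Lemma ker_neg y t : y <= 0 -> ker y t = - (0 <= t < - y)%R%:R.
Proof.
move=> y0; rewrite /ker (_ : (- y <= t < 0) = false) ?sub0r//.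
by apply/negP => /andP[]; lra.
Qed.

Lemma Ex_ker y : `|y| <= 1 -> Ex (Q11 R) (fun t => f t * ker y t) = (F 0 - F (- y)) / 2.
Proof.
rewrite ler_norml => /andP[y1 y2].
have [y0|/ltW y0] := leP 0 y.
  rewrite -(@Ex_Q11 _ f F)//; try lra.
  by apply: Ex_eq => t; rewrite ker_pos.
rewrite -opprB mulNr -(@Ex_Q11 _ f F)//; try lra.
rewrite /Ex /Rintegral -fineN -integral_ge0N; last first.
  move=> t _; rewrite lee_fin; case: (_ <= t < _); rewrite ?mulr0// mulr1; exact: f0.
congr fine; apply: eq_integral => t _; rewrite ker_neg//.
by rewrite mulrN.
Qed.

Lemma Ex_abs_ker y : `|y| <= 1 ->
  Ex (Q11 R) (fun t => f t * `|ker y t|) = `|F 0 - F (- y)| / 2.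
Proof.
move=> y1; have I0 : 0 <= Ex (Q11 R) (fun t => f t * `|ker y t|).
  by apply: Ex_ge0 => t; rewrite mulr_ge0.
suff : `|Ex (Q11 R) (fun t => f t * `|ker y t|)| = `|(F 0 - F (- y)) / 2|.
  by rewrite (ger0_norm I0) => ->; rewrite normrM [X in _ * X]ger0_norm.
move: y1; rewrite ler_norml => /andP[y1 y2].
have [y0|/ltW y0] := leP 0 y.
  rewrite -(@Ex_Q11 _ f F)//; try lra.
  congr `|_|; apply: Ex_eq => t; rewrite ker_pos//.
  by case: (_ <= t < _); rewrite ?normr1 ?normr0.
rewrite -[in RHS]opprB mulNr normrN -(@Ex_Q11 _ f F)//; try lra.
congr `|_|; apply: Ex_eq => t; rewrite ker_neg// normrN.
by case: (_ <= t < _); rewrite ?normr1 ?normr0.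
Qed.

End Kernel.

Section TentKernel.
Context (R : realType).
Implicit Types (x y t al : R).

Lemma is_derive_signed_sqr x : is_derive x (1 : R) (fun t => t * `|t| / 2) `|x|.
Proof.
apply: (@is_derive_quadratic _ _ _ _ 1) => h.
have [x0|x0] := leP 0 x; have [hx0|hx0] := leP 0 (h + x);
  [rewrite (ger0_norm x0) (ger0_norm hx0)|rewrite (ger0_norm x0) (ltr0_norm hx0)
  |rewrite (ltr0_norm x0) (ger0_norm hx0)|rewrite (ltr0_norm x0) (ltr0_norm hx0)];
  rewrite ler_norml; apply/andP; split; nra.
Qed.

Lemma is_derive_scaled_step al x t : 0 < al ->
  is_derive t (1 : R) (fun t => al * step ((x + t) / al)) (tent ((x + t) / al)).
Proof.
move=> al0.
have d : is_derive t (1 : R) (fun t => step ((x + t) / al)) (tent ((x + t) / al) * al^-1).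
  apply: (@is_derive1_comp _ (@step R) (fun t => (x + t) / al)).
    exact: is_derive_step.
  apply: (@is_derive_quadratic _ _ _ _ 0) => h.
  by rewrite mul0r (_ : _ - _ = 0) ?normr0//; ring.
rewrite (_ : tent _ = al * (tent ((x + t) / al) * al^-1)); last first.
  by field; rewrite gt_eqF.
apply: (@is_derive1_comp _ (fun u => al * u) (fun t => step ((x + t) / al))) => //.
apply: (@is_derive_quadratic _ _ _ _ 0) => h.
by rewrite mul0r (_ : _ - _ = 0) ?normr0//; ring.
Qed.

Lemma continuous_scaled_tent al x : continuous (fun t : R => tent ((x + t) / al)).
Proof.
move=> t; apply: (@continuous_comp _ _ _ (fun t => (x + t) / al) (@tent R)).
  apply: cvgM; last exact: cvg_cst.
  by apply: cvgD; [exact: cvg_cst|exact: cvg_id].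
exact: continuous_tent.
Qed.

(** The increment of the smooth step over y as an integral of the tent; the factor 1/2 is
the density of the uniform law. *)
Lemma Ex_ker_tent al x y : 0 < al -> `|y| <= 1 ->
  Ex (Q11 R) (fun t => tent ((x + t) / al) * ker y t) =
  al * (step (x / al) - step ((x - y) / al)) / 2.
Proof.
move=> al0 y1; rewrite (Ex_ker (@continuous_scaled_tent al x)
  (fun t => is_derive_scaled_step x t al0) (fun t => tent_ge0 _) y1).
by rewrite addr0 mulrBr.
Qed.

Lemma Ex_tent al x : 0 < al -> Ex (Q11 R) (fun t => tent ((x + t) / al)) <= al / 2.
Proof.
move=> al0; rewrite (Ex_Q11_full (@continuous_scaled_tent al x)
  (fun t => is_derive_scaled_step x t al0) (fun t => tent_ge0 _)).
rewrite ler_wpM2r// -mulrBr -[leRHS]mulr1 ler_wpM2l ?(ltW al0)//.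
by have := step_ge0 ((x - 1) / al); have := step_le1 ((x + 1) / al); lra.
Qed.

Let cst1 : continuous (fun _ : R => 1 : R). Proof. by move=> t; exact: cvg_cst. Qed.

Lemma Ex_ker1 y : `|y| <= 1 -> Ex (Q11 R) (ker y) = y / 2.
Proof.
move=> y1.
have := Ex_ker cst1 (fun x => is_derive_id x (1 : R)) (fun _ => ler01) y1.
by rewrite sub0r opprK => <-; apply: Ex_eq => t; rewrite mul1r.
Qed.

Lemma Ex_abs_ker1 y : `|y| <= 1 -> Ex (Q11 R) (fun t => `|ker y t|) = `|y| / 2.
Proof.
move=> y1.
have := Ex_abs_ker cst1 (fun x => is_derive_id x (1 : R)) (fun _ => ler01) y1.
by rewrite sub0r opprK => <-; apply: Ex_eq => t; rewrite mul1r.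
Qed.

Lemma Ex_abs_ker_abs y : `|y| <= 1 ->
  Ex (Q11 R) (fun t => `|t| * `|ker y t|) = y ^+ 2 / 4.
Proof.
move=> y1; rewrite (Ex_abs_ker (@norm_continuous _ _) is_derive_signed_sqr
  (fun t => normr_ge0 t) y1).
rewrite mul0r mul0r sub0r normrN normrM normrM !normrN normr_id [`|2^-1|]ger0_norm//.
by rewrite -[y ^+ 2]real_normK ?num_real//; field.
Qed.

End TentKernel.

(** * Inequalities between powers *)

Section Powers.
Context (R : realType) (p : R).
Hypothesis p2 : 2 < p.
Hypothesis p3 : p <= 3.
Implicit Types (a b c v th : R).
Local Notation q := (p - 2).

(** Young's inequality with exponents p/2 and p/q. *)
Lemma young2 a c : 0 <= a -> 0 <= c ->
  a ^+ 2 * c `^ q <= (2 * a `^ p + q * c `^ p) / p.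
Proof.
move=> a0 c0; have q0 : 0 < q by rewrite subr_gt0.
have pp : 0 < p by have := p2; lra.
have := @conjugate_powR R (a ^+ 2) (c `^ q) (p / 2) (p / q) _ _ _ _ _.
rewrite -powRrM (_ : q * (p / q) = p); last by field; rewrite gt_eqF.
rewrite -powR_mulrn// -powRrM (_ : 2 * (p / 2) = p); last by field.
have -> : a `^ p / (p / 2) + c `^ p / (p / q) = (2 * a `^ p + q * c `^ p) / p.
  by field; rewrite !gt_eqF.
apply; rewrite ?powR_ge0 ?divr_gt0//.
by rewrite !invf_div -mulrDl addrC subrK divff// gt_eqF.
Qed.

(** From a b <= (a^2 + b^2) / 2 and the case of two factors. *)
Lemma young3 a b c : 0 <= a -> 0 <= b -> 0 <= c ->
  a * b * c `^ q <= (a `^ p + b `^ p + q * c `^ p) / p.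
Proof.
move=> a0 b0 c0.
have := young2 a0 c0; have := young2 b0 c0; have := powR_ge0 c q.
set u := c `^ q; set A := a `^ p; set B := b `^ p; set C := c `^ p => u0 hb ha.
have : a * b * u <= (a ^+ 2 * u + b ^+ 2 * u) / 2.
  by have := mulr_ge0 (sqr_ge0 (a - b)) u0; nra.
by move=> /le_trans; apply; lra.
Qed.

(** Above the threshold th the square is dominated by the p-th power. The threshold is
chosen later so that both terms are small. *)
Lemma sqr_le_pow th a : 0 < th -> 0 <= a ->
  a ^+ 2 <= th ^+ 2 + th `^ (2 - p) * a `^ p.
Proof.
move=> th0 a0; have [ath|/ltW tha] := leP a th.
  by rewrite (@le_trans _ _ (th ^+ 2)) ?lerXn2r ?nnegrE ?(ltW th0)// lerDl mulr_ge0 ?powR_ge0.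
rewrite (@le_trans _ _ (th `^ (2 - p) * a `^ p)) ?lerDr ?sqr_ge0//.
have -> : a `^ p = a ^+ 2 * a `^ q.
  rewrite -powR_mulrn// -powRD; first by congr (_ `^ _); ring.
  by rewrite (gt_eqF (lt_le_trans th0 tha)) implybT.
rewrite mulrCA ler_peMr ?sqr_ge0//.
apply: (@le_trans _ _ (th `^ (2 - p) * th `^ q)); last first.
  by rewrite ler_wpM2l ?powR_ge0// ge0_ler_powR ?nnegrE ?(ltW th0)// subr_ge0 ltW.
rewrite -powRD; first by rewrite (_ : 2 - p + _ = 0) ?powRr0//; ring.
by rewrite (gt_eqF th0) implybT.
Qed.

Lemma powq_ge1 v : 1 <= v -> 1 <= v `^ q.
Proof.
move=> v1; have : 1 `^ q <= v `^ q.
  by rewrite ge0_ler_powR ?nnegrE ?(le_trans ler01 v1)// subr_ge0 ltW.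
by rewrite powR1.
Qed.

(** The exponent p - 2 is at most 1, which is where p <= 3 enters. *)
Lemma powq_gev v : 0 <= v <= 1 -> v <= v `^ q.
Proof.
move=> /andP[]; rewrite le_eqVlt => /predU1P[<- _|v0 v1]; first exact: powR_ge0.
have q1 : p - 2 <= 1 by have := p3; lra.
by apply: ger1_powR => //; rewrite v0.
Qed.

(** The tangent line inequality of the convex function a^p at the point c. *)
Lemma power_tangent a c : 0 <= a -> 0 <= c ->
  p * c `^ (p - 1) * a <= a `^ p + (p - 1) * c `^ p.
Proof.
move=> a0 c0; have pp : 0 < p by have := p2; lra.
have p1 : 0 < p - 1 by have := p2; lra.
have := @conjugate_powR R a (c `^ (p - 1)) p (p / (p - 1)) a0 (powR_ge0 _ _) pp.
rewrite divr_gt0// invf_div -powRrM => /(_ isT).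
rewrite (_ : (p - 1) * (p / (p - 1)) = p); last by field; rewrite gt_eqF.
rewrite (_ : p^-1 + (p - 1) / p = 1); last by field; rewrite gt_eqF.
move=> /(_ erefl) H; rewrite -mulrA [_ * a]mulrC; have := ler_wpM2l (ltW pp) H.
move=> /le_trans; apply; rewrite mulrDr le_eqVlt; apply/orP; left; apply/eqP.
by field; rewrite !gt_eqF.
Qed.

Lemma powR_pred c : 0 < c -> c `^ p = c `^ (p - 1) * c.
Proof.
move=> c0; rewrite -[X in _ = _ * X](powRr1 (ltW c0)) -powRD ?subrK//.
by rewrite (gt_eqF c0) implybT.
Qed.

(** The power mean inequality, from the tangent at the mean value of the f i. *)
Lemma power_mean (I : finType) (D : {set I}) (f : I -> R) (k : R) :
  (forall i, 0 <= f i) -> #|D|%:R <= k ->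
  (\sum_(i in D) f i) `^ p <= k `^ (p - 1) * \sum_(i in D) f i `^ p.
Proof.
move=> f0 Dk; have p1 : 0 < p - 1 by have := p2; lra.
have pp : 0 < p by have := p2; lra.
have [->|/set0Pn[i0 i0D]] := eqVneq D finset.set0.
  by rewrite !big_set0 powR0 ?gt_eqF// mulr0.
have n0 : 0 < #|D|%:R :> R by rewrite ltr0n card_gt0; apply/set0Pn; exists i0.
set n : R := #|D|%:R; set s := \sum_(i in D) f i.
have s0 : 0 <= s by rewrite sumr_ge0.
have sum_ge : n * (s / n) `^ p <= \sum_(i in D) f i `^ p.
  have : \sum_(i in D) (p * (s / n) `^ (p - 1) * f i - (p - 1) * (s / n) `^ p) <=
      \sum_(i in D) f i `^ p.
    by apply: ler_sum => i _; rewrite lerBlDr power_tangent// divr_ge0// ltW.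
  rewrite big_split /= -mulr_sumr -/s sumr_const -[_ *+ _]mulr_natl -/n.
  apply: le_trans; rewrite le_eqVlt; apply/orP; left; apply/eqP.
  have [->|sn0] := eqVneq s 0; first by rewrite mul0r !powR0 ?gt_eqF//; ring.
  have -> : (s / n) `^ p = (s / n) `^ (p - 1) * (s / n).
    by rewrite powR_pred// divr_gt0// lt_neqAle eq_sym sn0.
  by field; rewrite gt_eqF.
have k0 : 0 <= k by rewrite (le_trans _ Dk)// ltW.
apply: (@le_trans _ _ (n `^ (p - 1) * \sum_(i in D) f i `^ p)); last first.
  apply: ler_wpM2r; first by apply: sumr_ge0 => i _; exact: powR_ge0.
  by apply: ge0_ler_powR => //; rewrite ?nnegrE// ltW.
apply: le_trans (ler_wpM2l (powR_ge0 _ _) sum_ge).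
rewrite mulrA -(powR_pred n0) -powRM ?divr_ge0 ?(ltW n0)//.
by rewrite mulrCA divff ?gt_eqF// mulr1.
Qed.

End Powers.

Lemma measurable_abs_powR d (T : measurableType d) (R : realType) (f : T -> R) (q : R) :
  measurable_fun setT f -> measurable_fun setT (fun w => `|f w| `^ q).
Proof.
move=> mf; have m1 : measurable_fun setT (fun w => `|f w|) by exact: measurableT_comp.
exact: (measurableT_comp (measurable_powR q) m1).
Qed.

(** * Functions measurable with respect to a subfamily *)

Section SigmaFamily.
Context d (T : measurableType d) (R : realType) (P : probability T R).
Context (J : finType) (X : J -> {RV P >-> R}).
Implicit Types (D E : {set J}) (f g : T -> R).

Definition family_generator D : set (set T) :=
  \bigcup_(i in [set` D]) g_sigma_algebra_preimage (X i).

(** Measurability for the sigma-algebra generated by the X_i with i in D. Independence of two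
subfamilies will only be used through such functions. *)
Definition family_meas D f :=
  measurable_fun (setT : set (g_sigma_algebraType (family_generator D))) f.

Lemma family_generator_measurable D : family_generator D `<=` measurable.
Proof.
move=> F [i _ [Y mY <-]]; rewrite setTI -[X in measurable X]setTI.
exact: (measurable_funPT (X i)).
Qed.

Lemma family_meas_meas D f : family_meas D f -> measurable_fun setT f.
Proof. exact: (measurable_fun_gen (family_generator_measurable (D := D))). Qed.

Lemma family_generatorS D E : D \subset E -> family_generator D `<=` family_generator E.
Proof.
move=> /fintype.subsetP DE F [i iD Fi]; exists i => //=; exact: DE.
Qed.

Lemma family_measS D E f : D \subset E -> family_meas D f -> family_meas E f.
Proof.
move=> DE mf _ Y mY; have := mf measurableT Y mY.
by apply: sub_sigma_algebra2; exact: family_generatorS.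
Qed.

Lemma family_meas_X j : family_meas [set j]%SET (X j).
Proof.
move=> _ Y mY; apply: sub_sigma_algebra; exists j; first by rewrite /= inE.
by exists Y.
Qed.

Lemma indep_familiesM D E f g : indep_families X D E ->
  family_meas D f -> family_meas E g -> L1 P f -> L1 P g ->
  L1 P (fun w => f w * g w) /\ Ex P (fun w => f w * g w) = Ex P f * Ex P g.
Proof.
move=> DE mf mg Lf Lg.
have mD := family_generator_measurable (D := D).
have mE := family_generator_measurable (D := E).
by split; [apply: (indep_L1M mD mE DE)|apply: (indep_ExM mD mE DE)].
Qed.

Lemma indep_rv_familyE i D : indep_rv_family X i D -> indep_families X [set i]%SET D.
Proof.
move=> ind E F sE sF; apply: ind => //.
move: E sE; apply: smallest_sub.
  have H := @sigma_algebra_measurable _ (g_sigma_algebra_preimageType (X i)).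
  exact: H.
by move=> F' [j /=]; rewrite inE => /eqP ->.
Qed.

End SigmaFamily.

(** * Locally dependent families and their partial sums *)

Section LocalDependence.
Context d (T : measurableType d) (R : realType) (P : probability T R).
Context (J : finType) (X : J -> {RV P >-> R}).

(** The situation after removal of the degenerate variables. The functions x j are tied to
the given random variables X only through measurability, so that some of them may be
set to zero without touching the independence assumptions. [ld_zero] is what makes
the number of nonzero terms over C i at most k. *)
Record local_dependence (x : J -> T -> R) (A B C : J -> {set J}) (p k : R) : Prop := {
  ld_p2 : 2 < p;
  ld_p3 : p <= 3;
  ld_meas : forall j, family_meas X [set j]%SET (x j);
  ld_zero : forall j, j \notin A j -> forall w, x j w = 0;
  ld_mom : forall j, L1 P (fun w => `|x j w| `^ p);
  ld_mean : forall j, Ex P (x j) = 0;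
  ld_AB : forall i, A i \subset B i;
  ld_BC : forall i, B i \subset C i;
  ld_indA : forall i, indep_families X [set i]%SET (~: A i)%SET;
  ld_indB : forall i, indep_families X (A i) (~: B i)%SET;
  ld_indC : forall i, indep_families X (B i) (~: C i)%SET;
  ld_k1 : 1 <= k;
  ld_row : forall i, #|neighbourhood B (C i)|%:R <= k;
  ld_col : forall i, #|[set j | i \in C j]%SET|%:R <= k;
  ld_var : Ex P (fun w => (\sum_j x j w) ^+ 2) = 1 }.

End LocalDependence.

Arguments ld_meas {d T R P J X x A B C p k} _ j.
Arguments ld_zero {d T R P J X x A B C p k} _ [j].
Arguments ld_indA {d T R P J X x A B C p k} _ i.
Arguments ld_indB {d T R P J X x A B C p k} _ i.
Arguments ld_indC {d T R P J X x A B C p k} _ i.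

Section PartialSums.
Context d (T : measurableType d) (R : realType) (P : probability T R).
Context (J : finType) (X : J -> {RV P >-> R}).
Context (x : J -> T -> R) (A B C : J -> {set J}) (p k : R).
Hypothesis H : local_dependence X x A B C p k.
Implicit Types (D E : {set J}) (i j : J).

Definition psum D w : R := \sum_(j in D) x j w.
Definition moment_bound : R := k `^ (p - 1) * \sum_j Ex P (fun w => `|x j w| `^ p).

Lemma measurable_x j : measurable_fun setT (x j).
Proof. exact: family_meas_meas (ld_meas H j). Qed.

Lemma family_meas_x D j : j \in D -> family_meas X D (x j).
Proof. by move=> jD; apply: family_measS (ld_meas H j); rewrite finset.sub1set. Qed.

Lemma family_meas_psum D E : D \subset E -> family_meas X E (psum D).
Proof.
move=> DE; rewrite (_ : psum D = fun w => \sum_j if j \in D then x j w else 0).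
  apply: measurable_sum => j; case jD : (j \in D).
    by apply: family_meas_x; exact: (fintype.subsetP DE).
  exact: measurable_cst.
by apply/funext => w; exact: big_mkcond.
Qed.

Lemma measurable_psum D : measurable_fun setT (psum D).
Proof. exact: family_meas_meas (family_meas_psum (subxx D)). Qed.

Lemma powR_p_gt0 : 0 < p. Proof. by have := ld_p2 H; lra. Qed.
Lemma k_gt0 : 0 < k. Proof. by have := ld_k1 H; lra. Qed.

Lemma kpow_p : k `^ p = k `^ (p - 1) * k.
Proof. exact: powR_pred k_gt0. Qed.

Lemma moment_bound_ge0 : 0 <= moment_bound.
Proof.
apply: mulr_ge0; first exact: powR_ge0.
by apply: sumr_ge0 => j _; apply: Ex_ge0 => w; exact: powR_ge0.
Qed.

(** A nonzero term has j in A j, hence in B j, so j in C i makes C i meet B j. *)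
Lemma sum_row i D w (f : J -> R) : D \subset C i -> (forall j, x j w = 0 -> f j = 0) ->
  \sum_(j in D) f j = \sum_(j in (D :&: neighbourhood B (C i))%SET) f j.
Proof.
move=> DC f0; rewrite [LHS](big_setID (neighbourhood B (C i))) /=.
rewrite [X in _ + X]big1 ?addr0// => j; rewrite !inE => /andP[jN jD].
apply/f0/(ld_zero H); apply: contra jN => jA.
apply/finset.set0Pn; exists j; rewrite inE (fintype.subsetP DC)//=.
exact: (fintype.subsetP (ld_AB H j)).
Qed.

Lemma card_row i D : #|(D :&: neighbourhood B (C i))%SET|%:R <= k.
Proof.
apply: le_trans (ld_row H i); rewrite ler_nat; apply: subset_leq_card; exact: finset.subsetIr.
Qed.

(** The power mean inequality over the at most k nonzero terms of the sum. *)
Lemma psum_pow i D w : D \subset C i ->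
  `|psum D w| `^ p <= k `^ (p - 1) * \sum_(j in D) `|x j w| `^ p.
Proof.
move=> DC; have p0 := powR_p_gt0.
rewrite /psum (@sum_row i D w (fun j => x j w))// (@sum_row i D w (fun j => `|x j w| `^ p))//.
  apply: le_trans (power_mean (ld_p2 H) (fun j => normr_ge0 (x j w)) (card_row i D)).
  by apply: ge0_ler_powR; rewrite ?nnegrE ?sumr_ge0 ?(ltW p0)//; exact: ler_norm_sum.
by move=> j ->; rewrite normr0 powR0 ?gt_eqF.
Qed.

Lemma L1_psum_pow i D : D \subset C i -> L1 P (fun w => `|psum D w| `^ p).
Proof.
move=> DC; apply: (@L1_le _ _ _ _ _ (fun w => k `^ (p - 1) * \sum_(j in D) `|x j w| `^ p)).
- exact/measurable_abs_powR/measurable_psum.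
- apply: L1Zl; apply: L1_sum => j _; exact: ld_mom H j.
- by move=> w; rewrite ger0_norm ?powR_ge0//; exact: psum_pow DC.
Qed.

(** Each x j is counted at most k times, since an index i with j in D i has j in C i. *)
Lemma sum_psum_pow (D : J -> {set J}) : (forall i, D i \subset C i) ->
  \sum_i Ex P (fun w => `|psum (D i) w| `^ p) <= k * moment_bound.
Proof.
move=> DC; set m := fun j => Ex P (fun w => `|x j w| `^ p).
have m0 j : 0 <= m j by apply: Ex_ge0 => w; exact: powR_ge0.
have step1 i : Ex P (fun w => `|psum (D i) w| `^ p) <= k `^ (p - 1) * \sum_(j in D i) m j.
  rewrite -Ex_sum; last by move=> j _; exact: ld_mom H j.
  rewrite -ExZl; last by apply: L1_sum => j _; exact: ld_mom H j.
  apply: Ex_le; first exact: L1_psum_pow (DC i).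
    by apply: L1Zl; apply: L1_sum => j _; exact: ld_mom H j.
  by move=> w; exact: psum_pow (DC i).
apply: (@le_trans _ _ (\sum_i k `^ (p - 1) * \sum_(j in D i) m j)).
  by apply: ler_sum => i _; exact: step1.
rewrite -mulr_sumr /moment_bound mulrCA ler_wpM2l ?powR_ge0//.
rewrite (exchange_big_dep predT)//= mulr_sumr; apply: ler_sum => j _.
rewrite sumr_const -[leLHS]mulr_natl ler_wpM2r//; apply: le_trans (ld_col H j).
rewrite ler_nat; apply: subset_leq_card; apply/fintype.subsetP => i.
by rewrite !inE; exact: (fintype.subsetP (DC i)).
Qed.

End PartialSums.

(** * Moments of partial sums *)

Section Moments.
Context d (T : measurableType d) (R : realType) (P : probability T R).
Context (J : finType) (X : J -> {RV P >-> R}).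
Context (x : J -> T -> R) (A B C : J -> {set J}) (p k : R).
Hypothesis H : local_dependence X x A B C p k.
Implicit Types (D E N : {set J}) (i j : J).
Local Notation S := (psum x).
Local Notation beta := (moment_bound P x p k).
Local Notation q := (p - 2).

(** Young's inequality for k a, b and c: the weights are balanced so that after summation
over i every term on the right contributes the same bound, the p-th moments of partial
sums being k times larger than k^(p-1) times those of the single variables. *)
Lemma scaled_young3 (a b c : R) : 0 <= a -> 0 <= b -> 0 <= c ->
  a * b * c `^ q <= (k `^ (p - 1) * a `^ p + k^-1 * b `^ p + q * (k^-1 * c `^ p)) / p.
Proof.
move=> a0 b0 c0; have k0 := k_gt0 H.
have := young3 (ld_p2 H) (mulr_ge0 (ltW k0) a0) b0 c0.
rewrite powRM ?(ltW k0)// (kpow_p H) -[k * a * b]mulrA -[k * _ * c `^ q]mulrA.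
rewrite -ler_pdivlMl// => /le_trans; apply; rewrite le_eqVlt; apply/orP; left; apply/eqP.
by field; rewrite !gt_eqF// (powR_p_gt0 H).
Qed.

Lemma scaled_young2 (a c : R) : 0 <= a -> 0 <= c ->
  k * (a ^+ 2 * c `^ q) <= (2 * (k `^ (p - 1) * a `^ p) + q * (k^-1 * c `^ p)) / p.
Proof.
move=> a0 c0; have k0 := k_gt0 H.
have := young2 (ld_p2 H) (mulr_ge0 (ltW k0) a0) c0.
rewrite powRM ?(ltW k0)// (kpow_p H) exprMn.
rewrite (_ : k ^+ 2 * a ^+ 2 * c `^ q = k * (k * (a ^+ 2 * c `^ q))); last by ring.
rewrite -ler_pdivlMl// => /le_trans; apply; rewrite le_eqVlt; apply/orP; left; apply/eqP.
by field; rewrite !gt_eqF// (powR_p_gt0 H).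
Qed.

Lemma L1_x2 j : L1 P (fun w => x j w ^+ 2).
Proof.
apply: (@L1_le _ _ _ _ _ (fun w => 1 ^+ 2 + 1 `^ (2 - p) * `|x j w| `^ p)).
- exact/measurable_funX/(measurable_x H).
- apply: L1D; first exact: L1_cst.
  by apply: L1Zl; exact: ld_mom H j.
- move=> w; rewrite ger0_norm ?sqr_ge0// -real_normK ?num_real//.
  exact: (sqr_le_pow (ld_p2 H)).
Qed.

Lemma L1_x j : L1 P (x j).
Proof. exact: L1_sqrt (measurable_x H j) (L1_x2 j). Qed.

Lemma L1_S2 D : L1 P (fun w => S D w ^+ 2).
Proof.
apply: L1_sq_sum => j; [exact: measurable_x H j|exact: L1_x2 j].
Qed.

Lemma L1_S D : L1 P (S D).
Proof. exact: L1_sqrt (measurable_psum H D) (L1_S2 D). Qed.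

Lemma L1_xS j D : L1 P (fun w => x j w * S D w).
Proof. exact: L1_sqM (measurable_x H j) (measurable_psum H D) (L1_x2 j) (L1_S2 D). Qed.

Lemma L1_abs_xS j D : L1 P (fun w => `|x j w| * `|S D w|).
Proof.
rewrite (_ : (fun w => _) = fun w => `|x j w * S D w|); first exact: L1_abs (L1_xS j D).
by apply/funext => w; rewrite normrM.
Qed.

Lemma L1_third i D E : D \subset C i -> E \subset C i ->
  L1 P (fun w => `|x i w| * `|S D w| * `|S E w| `^ q).
Proof.
move=> DC EC; apply: (@L1_le _ _ _ _ _ (fun w => (k `^ (p - 1) * `|x i w| `^ p +
  k^-1 * `|S D w| `^ p + q * (k^-1 * `|S E w| `^ p)) / p)).
- apply: measurable_funM; last exact/measurable_abs_powR/(measurable_psum H).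
  exact: L1_meas (L1_abs_xS i D).
- apply/L1Zr/L1D; first apply: L1D.
  + exact/L1Zl/(ld_mom H).
  + exact/L1Zl/(L1_psum_pow H DC).
  + exact/L1Zl/L1Zl/(L1_psum_pow H EC).
- move=> w; rewrite ger0_norm ?mulr_ge0 ?powR_ge0//; exact: scaled_young3.
Qed.

Lemma combination_le (a b c v : R) : b <= k * v -> c <= k * v -> a <= v ->
  (a + k^-1 * b + q * (k^-1 * c)) / p <= v.
Proof.
move=> hb hc ha; have k0 := k_gt0 H; have p2 := ld_p2 H; have p0 := powR_p_gt0 H.
rewrite ler_pdivrMr//.
have h1 : k^-1 * b <= v by rewrite ler_pdivrMl.
have h2 : k^-1 * c <= v by rewrite ler_pdivrMl.
have : q * (k^-1 * c) <= q * v by rewrite ler_wpM2l// subr_ge0 ltW.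
lra.
Qed.

Lemma sum_combination (D E : J -> {set J}) :
  (forall i, D i \subset C i) -> (forall i, E i \subset C i) ->
  \sum_i (k `^ (p - 1) * Ex P (fun w => `|x i w| `^ p) +
    k^-1 * Ex P (fun w => `|S (D i) w| `^ p) +
    q * (k^-1 * Ex P (fun w => `|S (E i) w| `^ p))) / p <= beta.
Proof.
move=> DC EC.
suff comb (m mD mE : J -> R) : \sum_i mD i <= k * beta -> \sum_i mE i <= k * beta ->
    k `^ (p - 1) * \sum_i m i <= beta ->
    \sum_i (k `^ (p - 1) * m i + k^-1 * mD i + q * (k^-1 * mE i)) / p <= beta.
  exact: comb (sum_psum_pow H DC) (sum_psum_pow H EC) (lexx _).
move=> hD hE hm; rewrite -mulr_suml !big_split /= -!mulr_sumr.
exact: combination_le.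
Qed.

(** The basic bound of the proof: third-order products, with the last factor to the power
p - 2, sum up to the moment bound. *)
Lemma sum_third (D E : J -> {set J}) :
  (forall i, D i \subset C i) -> (forall i, E i \subset C i) ->
  \sum_i Ex P (fun w => `|x i w| * `|S (D i) w| * `|S (E i) w| `^ q) <= beta.
Proof.
move=> DC EC; apply: le_trans (sum_combination DC EC); apply: ler_sum => i _.
have Lx := ld_mom H i; have LD := L1_psum_pow H (DC i); have LE := L1_psum_pow H (EC i).
apply: le_trans (Ex_le (L1_third (DC i) (EC i)) _ (fun w => scaled_young3 (normr_ge0 (x i w))
  (normr_ge0 (S (D i) w)) (normr_ge0 (S (E i) w)))) _.
  by do ?[apply: L1D|apply: L1Zr|apply: L1Zl].
rewrite le_eqVlt; apply/orP; left; apply/eqP.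
rewrite ExZr; last by do ?[apply: L1D|apply: L1Zl].
rewrite ExD; [|by apply: L1D; apply: L1Zl|by do 2 apply: L1Zl].
rewrite ExD; [|exact: L1Zl|exact: L1Zl].
by rewrite (ExZl _ Lx) (ExZl _ LD) (ExZl _ (L1Zl _ LE)) (ExZl _ LE).
Qed.

Lemma powq_le1D v : 0 <= v -> v `^ q <= 1 + v `^ p.
Proof.
move=> v0; have p2 := ld_p2 H.
have [v1|/ltW v1] := leP v 1; last first.
  by rewrite -[leLHS]add0r lerD// ler_powR//; lra.
rewrite (@le_trans _ _ 1) ?lerDl ?powR_ge0//.
have : v `^ q <= 1 `^ q by rewrite ge0_ler_powR ?nnegrE// subr_ge0 ltW.
by rewrite powR1.
Qed.

Lemma L1_Sq i D : D \subset C i -> L1 P (fun w => `|S D w| `^ q).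
Proof.
move=> DC; apply: (@L1_le _ _ _ _ _ (fun w => 1 + `|S D w| `^ p)).
- exact/measurable_abs_powR/(measurable_psum H).
- apply: L1D; [exact: L1_cst|exact: (L1_psum_pow H DC)].
- by move=> w; rewrite ger0_norm ?powR_ge0// powq_le1D.
Qed.

(** The same bound when the last factor is decoupled from the first two, by applying
Young's inequality at two sample points that are integrated separately. *)
Lemma sum_third_indep (D E : J -> {set J}) :
  (forall i, D i \subset C i) -> (forall i, E i \subset C i) ->
  \sum_i Ex P (fun w => `|x i w| * `|S (D i) w|) * Ex P (fun w => `|S (E i) w| `^ q) <= beta.
Proof.
move=> DC EC; apply: le_trans (sum_combination DC EC); apply: ler_sum => i _.
have Lx := ld_mom H i; have LD := L1_psum_pow H (DC i); have LE := L1_psum_pow H (EC i).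
have LxS := L1_abs_xS i (D i); have LEq := L1_Sq (EC i).
set a := Ex P (fun w => `|x i w| `^ p); set b := Ex P (fun w => `|S (D i) w| `^ p).
set m := Ex P (fun w => `|x i w| * _).
have step w' : m * `|S (E i) w'| `^ q <=
    (k `^ (p - 1) * a + k^-1 * b + q * (k^-1 * `|S (E i) w'| `^ p)) / p.
  rewrite /m -(ExZr _ LxS).
  apply: le_trans (Ex_le _ _ (fun w => scaled_young3 (normr_ge0 (x i w))
    (normr_ge0 (S (D i) w)) (normr_ge0 (S (E i) w')))) _.
  - exact: L1Zr.
  - by do ?[exact: L1_cst|apply: L1D|apply: L1Zr|apply: L1Zl].
  rewrite le_eqVlt; apply/orP; left; apply/eqP.
  rewrite ExZr; last by do ?[exact: L1_cst|apply: L1D|apply: L1Zl].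
  rewrite ExD; [|by apply: L1D; apply: L1Zl|exact: L1_cst].
  rewrite ExD; [|exact: L1Zl|exact: L1Zl].
  by rewrite (ExZl _ Lx) (ExZl _ LD) Ex_cst.
rewrite -(ExZl _ LEq); apply: le_trans (Ex_le _ _ step) _.
- exact: L1Zl.
- by do ?[exact: L1_cst|apply: L1D|apply: L1Zr|apply: L1Zl].
rewrite le_eqVlt; apply/orP; left; apply/eqP.
rewrite ExZr; last by do ?[exact: L1_cst|apply: L1D|apply: L1Zl].
rewrite ExD; [|exact: L1_cst|by do 2 apply: L1Zl].
by rewrite Ex_cst (ExZl _ (L1Zl _ LE)) (ExZl _ LE).
Qed.

Lemma L1_quad i D : D \subset C i -> L1 P (fun w => x i w ^+ 2 * `|S D w| `^ q).
Proof.
move=> DC; have k0 := k_gt0 H.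
have Lx := ld_mom H i; have LE := L1_psum_pow H DC.
have Lr : L1 P (fun w => k^-1 * ((2 * (k `^ (p - 1) * `|x i w| `^ p) +
      q * (k^-1 * `|S D w| `^ p)) / p)).
  by do ?[apply: L1D|apply: L1Zr|apply: L1Zl].
apply: (L1_le _ Lr) => [|w].
  apply: measurable_funM; last exact/measurable_abs_powR/(measurable_psum H).
  exact/measurable_funX/(measurable_x H).
rewrite ger0_norm; last by apply: mulr_ge0; [exact: sqr_ge0|exact: powR_ge0].
rewrite ler_pdivlMl//.
by rewrite -(real_normK (num_real (x i w))); exact: scaled_young2.
Qed.

Lemma sum_quad (E : J -> {set J}) : (forall i, E i \subset C i) ->
  k * \sum_i Ex P (fun w => x i w ^+ 2 * `|S (E i) w| `^ q) <= beta.
Proof.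
move=> EC; have k0 := k_gt0 H.
suff comb (m mE : J -> R) : \sum_i mE i <= k * beta -> k `^ (p - 1) * \sum_i m i <= beta ->
    \sum_i (2 * (k `^ (p - 1) * m i) + q * (k^-1 * mE i)) / p <= beta.
  apply: le_trans (comb _ _ (sum_psum_pow H EC) (lexx _)).
  rewrite mulr_sumr; apply: ler_sum => i _.
  have Lx := ld_mom H i; have LE := L1_psum_pow H (EC i).
  have Lr : L1 P (fun w => (2 * (k `^ (p - 1) * `|x i w| `^ p) +
      q * (k^-1 * `|S (E i) w| `^ p)) / p).
    by do ?[apply: L1D|apply: L1Zr|apply: L1Zl].
  have dom w : k * (x i w ^+ 2 * `|S (E i) w| `^ q) <= (2 * (k `^ (p - 1) * `|x i w| `^ p) +
      q * (k^-1 * `|S (E i) w| `^ p)) / p.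
    by rewrite -(real_normK (num_real (x i w))); exact: scaled_young2.
  have L0 := L1_quad (EC i); have Ll := L1Zl k L0.
  rewrite -(ExZl _ L0); apply: le_trans (Ex_le Ll Lr dom) _.
  rewrite le_eqVlt; apply/orP; left; apply/eqP.
  rewrite ExZr; last by do ?[apply: L1D|apply: L1Zl].
  rewrite ExD; [|by do 2 apply: L1Zl|by do 2 apply: L1Zl].
  by rewrite (ExZl _ (L1Zl _ Lx)) (ExZl _ Lx) (ExZl _ (L1Zl _ LE)) (ExZl _ LE).
move=> hE hm; rewrite -mulr_suml big_split /= -!mulr_sumr.
have h0 : 0 <= k * beta by rewrite mulr_ge0 ?(ltW k0)// moment_bound_ge0.
have := combination_le (lexx (k * beta)) hE hm; rewrite mulKf ?gt_eqF//.
move=> h; apply: le_trans h; rewrite ler_wpM2r ?invr_ge0 ?(ltW (powR_p_gt0 H))//.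
by rewrite lerD2r; move: hm; set u := _ * \sum_i m i; lra.
Qed.

Lemma sum_sqr_card (D : {set J}) (f : J -> R) : #|D|%:R <= k ->
  (\sum_(i in D) f i) ^+ 2 <= k * \sum_(i in D) f i ^+ 2.
Proof.
move=> Dk; apply: (@le_trans _ _ (#|D|%:R * \sum_(i in D) f i ^+ 2)); last first.
  by rewrite ler_wpM2r// sumr_ge0// => i _; exact: sqr_ge0.
rewrite expr2 big_distrlr /=.
apply: (@le_trans _ _ (\sum_(i in D) \sum_(j in D) (f i ^+ 2 / 2 + f j ^+ 2 / 2))).
  apply: ler_sum => i _; apply: ler_sum => j _.
  by have := sqr_ge0 (f i - f j); rewrite sqrrB mulr2n; lra.
have inner i : \sum_(j in D) (f i ^+ 2 / 2 + f j ^+ 2 / 2) =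
    #|D|%:R * (f i ^+ 2 / 2) + \sum_(j in D) f j ^+ 2 / 2.
  by rewrite big_split /= sumr_const mulr_natl.
rewrite (eq_bigr _ (fun i _ => inner i)).
rewrite big_split /= -mulr_sumr sumr_const -[X in _ + X]mulr_natl -!mulr_suml; lra.
Qed.

Lemma inv_powR (a r : R) : 0 < a -> a^-1 `^ (- r) = a `^ r.
Proof. by move=> a0; rewrite -powR_inv1 ?(ltW a0)// -powRrM mulrNN mul1r. Qed.

Lemma four_powq : 4 `^ q <= 4 :> R.
Proof.
have p3 := ld_p3 H; have q1 : q <= 1 by lra.
by rewrite -[leRHS]powRr1// ler_powR//; lra.
Qed.

(** The threshold 1 / (4 k) makes the constant terms add up to 1/16 over at most k indices.
As 75 beta <= 1 in the application, the second moments over a neighbourhood are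
small compared with the total variance 1. *)
Lemma small_x2 D : #|D|%:R <= k -> k * \sum_(j in D) Ex P (fun w => x j w ^+ 2) <= 16^-1 + 4 * beta.
Proof.
move=> Dk; have k0 := k_gt0 H.
have k4 : 0 < 4 * k by rewrite mulr_gt0.
pose c := (4 * k)^-1 `^ (2 - p).
have cE : k * c <= 4 * k `^ (p - 1).
  rewrite /c -opprB inv_powR// powRM ?(ltW k0)//.
  rewrite (_ : k `^ (p - 1) = k * k `^ q); last first.
    rewrite -[X in X * _](powRr1 (ltW k0)) -powRD ?(gt_eqF k0) ?implybT//.
    by congr (_ `^ _); ring.
  by rewrite mulrCA ler_wpM2r ?four_powq// mulr_ge0 ?powR_ge0// ltW.
have h j : Ex P (fun w => x j w ^+ 2) <= (4 * k)^-1 ^+ 2 + c * Ex P (fun w => `|x j w| `^ p).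
  have Lx := ld_mom H j.
  rewrite -(ExZl _ Lx) -[X in X + _](Ex_cst P) -ExD; [|exact: L1_cst|exact: L1Zl].
  apply: Ex_le; [exact: L1_x2|by apply: L1D; [exact: L1_cst|exact: L1Zl]|].
  move=> w; rewrite -(real_normK (num_real (x j w))).
  by apply: (sqr_le_pow (ld_p2 H)); rewrite ?invr_gt0.
apply: (@le_trans _ _ (k * \sum_(j in D) ((4 * k)^-1 ^+ 2 + c * Ex P (fun w => `|x j w| `^ p)))).
  by rewrite ler_pM2l//; apply: ler_sum.
rewrite big_split /= sumr_const -[_ *+ #|D|]mulr_natl -mulr_sumr mulrDr lerD//.
  rewrite mulrCA (@le_trans _ _ (k * (k * (4 * k)^-1 ^+ 2)))//.
    by rewrite ler_wpM2r// mulr_ge0 ?(ltW k0)// sqr_ge0.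
  by rewrite le_eqVlt; apply/orP; left; apply/eqP; field; rewrite gt_eqF.
have m0 : 0 <= \sum_(j in D) Ex P (fun w => `|x j w| `^ p).
  by apply: sumr_ge0 => j _; apply: Ex_ge0 => w; exact: powR_ge0.
rewrite mulrA; apply: le_trans (ler_wpM2r m0 cE) _.
rewrite -mulrA ler_wpM2l// /moment_bound ler_wpM2l ?powR_ge0//.
rewrite [leRHS](bigID (mem D)) /= lerDl.
by apply: sumr_ge0 => j _; apply: Ex_ge0 => w; exact: powR_ge0.
Qed.

(** Same idea as for single variables, with threshold 1/4 for the partial sums. *)
Lemma small_S2 D (E : J -> {set J}) : #|D|%:R <= k -> (forall i, E i \subset C i) ->
  k^-1 * \sum_(j in D) Ex P (fun w => S (E j) w ^+ 2) <= 16^-1 + 4 * beta.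
Proof.
move=> Dk EC; have k0 := k_gt0 H.
have h j : Ex P (fun w => S (E j) w ^+ 2) <= 4^-1 ^+ 2 + 4 * Ex P (fun w => `|S (E j) w| `^ p).
  have Lx := L1_psum_pow H (EC j).
  rewrite -(ExZl _ Lx) -[X in X + _](Ex_cst P) -ExD; [|exact: L1_cst|exact: L1Zl].
  apply: Ex_le; [exact: L1_S2|by apply: L1D; [exact: L1_cst|exact: L1Zl]|].
  move=> w; rewrite -(real_normK (num_real (S (E j) w))).
  have := @sqr_le_pow _ _ (ld_p2 H) 4^-1 `|S (E j) w| _ _.
  move=> /(_ ltac:(lra) ltac:(exact: normr_ge0)) /le_trans; apply; rewrite lerD2l.
  by rewrite -opprB inv_powR// ler_wpM2r ?powR_ge0// four_powq.
apply: (@le_trans _ _ (k^-1 * \sum_(j in D) (4^-1 ^+ 2 + 4 * Ex P (fun w => `|S (E j) w| `^ p)))).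
  by rewrite ler_pM2l ?invr_gt0//; apply: ler_sum.
rewrite big_split /= sumr_const -[_ *+ #|D|]mulr_natl -mulr_sumr mulrDr lerD//.
  rewrite ler_pdivrMl// (@le_trans _ _ (k * 4^-1 ^+ 2))// ?ler_wpM2r ?sqr_ge0//.
  by rewrite ler_pM2l//; lra.
rewrite mulrCA ler_wpM2l// ler_pdivrMl//; apply: le_trans (sum_psum_pow H EC).
rewrite [leRHS](bigID (mem D)) /= lerDl.
by apply: sumr_ge0 => j _; apply: Ex_ge0 => w; exact: powR_ge0.
Qed.

Lemma small_psum D : #|D|%:R <= k -> Ex P (fun w => S D w ^+ 2) <= 16^-1 + 4 * beta.
Proof.
move=> Dk; apply: le_trans (small_x2 Dk).
rewrite -Ex_sum; last by move=> j _; exact: L1_x2.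
rewrite -ExZl; last by apply: L1_sum => j _; exact: L1_x2.
apply: Ex_le; [exact: L1_S2|by apply: L1Zl; apply: L1_sum => j _; exact: L1_x2|].
by move=> w; exact: sum_sqr_card.
Qed.

Lemma small_psumC i D : D \subset C i -> Ex P (fun w => S D w ^+ 2) <= 16^-1 + 4 * beta.
Proof.
move=> DC; apply: le_trans (small_psum (card_row H i D)).
rewrite le_eqVlt; apply/orP; left; apply/eqP; apply: Ex_eq => w; congr (_ ^+ 2).
exact: (@sum_row _ _ _ _ _ _ _ _ _ _ _ _ H i D w (fun j => x j w)).
Qed.

End Moments.

(** * Decoupling a block from the variables far from it *)

Section Decoupling.
Context d (T : measurableType d) (R : realType) (P : probability T R).
Context (J : finType) (X : J -> {RV P >-> R}).
Context (x : J -> T -> R) (A B C : J -> {set J}) (p k : R).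
Hypothesis H : local_dependence X x A B C p k.
Implicit Types (D E N : {set J}) (i j l : J).
Local Notation S := (psum x).
Local Notation beta := (moment_bound P x p k).
Local Notation q := (p - 2).

Lemma family_meas_own j : family_meas X (A j) (x j).
Proof.
have [jA|jA] := boolP (j \in A j); first exact: (family_meas_x H jA).
rewrite (_ : x j = fun=> 0); first exact: measurable_cst.
by apply/funext => w; exact: (ld_zero H jA).
Qed.

(** x_j is centred and independent of everything outside A j. *)
Lemma Ex_mean0 j f : family_meas X (~: A j)%SET f -> L1 P f ->
  Ex P (fun w => x j w * f w) = 0.
Proof.
move=> mf Lf.
have [_ ->] := indep_familiesM (ld_indA H j) (ld_meas H j) mf (L1_x H j) Lf.
by rewrite (ld_mean H) mul0r.
Qed.

Lemma psumC D w : \sum_j x j w - S D w = S (~: D)%SET w.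
Proof.
rewrite /psum (bigID (mem D) predT) /= addrAC subrr add0r.
by apply: eq_bigl => j; rewrite inE.
Qed.

Context (D : {set J}) (g : T -> R) (G : R).
Hypothesis mg : family_meas X D g.
Hypothesis g0 : forall w, 0 <= g w.
Hypothesis gG : forall w, g w <= G.
Let N := neighbourhood B D.

Let mgT : measurable_fun setT g. Proof. exact: family_meas_meas mg. Qed.

Lemma L1_gM f : L1 P f -> L1 P (fun w => g w * f w).
Proof. by move=> Lf; apply: L1_bndM => // w; rewrite ger0_norm. Qed.

Lemma L1_g : L1 P g.
Proof. by apply: (@L1_bnd _ _ _ _ _ G) => // w; rewrite ger0_norm. Qed.

Lemma far_sub j : j \notin N -> D \subset (~: B j)%SET.
Proof.
rewrite inE negbK => /eqP DB; apply/fintype.subsetP => i iD; rewrite inE.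
by apply/negP => iB; have := finset.in_set0 i; rewrite -DB inE iD iB.
Qed.

Lemma far_subA j : j \notin N -> D \subset (~: A j)%SET.
Proof.
move=> /far_sub /fintype.subset_trans; apply.
by rewrite finset.setCS; exact: ld_AB H j.
Qed.

Lemma far_indep j U : j \notin N -> family_meas X (A j) U -> L1 P U ->
  Ex P (fun w => g w * U w) = Ex P g * Ex P U.
Proof.
move=> jN mU LU; have mg' := family_measS (far_sub jN) mg.
have [_] := indep_familiesM (ld_indB H j) mU mg' LU L1_g.
by rewrite mulrC => <-; apply: Ex_eq => w; rewrite mulrC.
Qed.

(** Pairs of indices whose local functions may be correlated even when both are far from D;
there are at most k of them per index. *)
Definition near j l := ((A l :&: B j != finset.set0) && (A j :&: B l != finset.set0))%SET.

Lemma near_sym j l : near j l = near l j.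
Proof. by rewrite /near andbC. Qed.

Lemma card_near j : #|[set l | near j l]%SET|%:R <= k.
Proof.
apply: le_trans (ld_row H j); rewrite ler_nat; apply: subset_leq_card.
apply/fintype.subsetP => l; rewrite !inE => /andP[_] /finset.set0Pn[i].
rewrite inE => /andP[iA iB]; apply/finset.set0Pn; exists i; rewrite inE iB andbT.
exact: (fintype.subsetP (ld_BC H j)) (fintype.subsetP (ld_AB H j) _ iA).
Qed.

Section FarSum.
Context (K : J -> T -> R).
Hypothesis mK : forall j, family_meas X (A j) (K j).
Hypothesis LK : forall j, L1 P (fun w => K j w ^+ 2).
Hypothesis EK : forall j, Ex P (K j) = 0.
Arguments mK : clear implicits.

Let mKT j : measurable_fun setT (K j). Proof. exact: family_meas_meas (mK j). Qed.
Let LKK j l : L1 P (fun w => K j w * K l w). Proof. exact: L1_sqM. Qed.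

(** If A l avoids B j and j is far from D, then K_j is independent of the pair (g, K_l). *)
Lemma far_cov0 j l : j \notin N -> (A l :&: B j)%SET = finset.set0 ->
  Ex P (fun w => g w * (K j w * K l w)) = 0.
Proof.
move=> jN AB; have Alj : A l \subset (~: B j)%SET.
  apply/fintype.subsetP => i iA; rewrite inE; apply/negP => iB.
  by have := finset.in_set0 i; rewrite -AB inE iA iB.
have mgK : family_meas X (~: B j)%SET (fun w => g w * K l w).
  apply: measurable_funM; first exact: family_measS (far_sub jN) mg.
  exact: family_measS Alj (mK l).
have LgK : L1 P (fun w => g w * K l w) by apply: L1_gM; exact: L1_sqrt.
have [_] := indep_familiesM (ld_indB H j) (mK j) mgK (L1_sqrt (mKT j) (LK j)) LgK.
by rewrite EK mul0r => <-; apply: Ex_eq => w; rewrite mulrCA.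
Qed.

(** Only near pairs contribute to the expanded square, and each index lies in at most k of
them; the diagonal bound K_j K_l <= (K_j^2 + K_l^2) / 2 then separates the weight g. *)
Lemma far_sum_sqr :
  Ex P (fun w => g w * (\sum_(j in ~: N) K j w) ^+ 2) <=
  Ex P g * (k * \sum_(j in ~: N) Ex P (fun w => K j w ^+ 2)).
Proof.
have cov j l : j \in (~: N)%SET -> l \in (~: N)%SET ->
    Ex P (fun w => g w * (K j w * K l w)) <=
    (near j l)%:R * (Ex P g * (Ex P (fun w => K j w ^+ 2) + Ex P (fun w => K l w ^+ 2)) / 2).
  rewrite !finset.in_setC => jN lN; rewrite /near.
  have [AB|_] := eqVneq (A l :&: B j)%SET finset.set0; first by rewrite far_cov0//= mul0r.
  have [AB|_] := eqVneq (A j :&: B l)%SET finset.set0; rewrite /= ?(mul0r, mul1r).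
    by under Ex_eq do rewrite [K j _ * _]mulrC; rewrite far_cov0.
  have mK2 i : family_meas X (A i) (fun w => K i w ^+ 2) by rewrite /family_meas; apply: measurable_funX; exact: mK.
  rewrite mulrDr -(far_indep jN (mK2 j))// -(far_indep lN (mK2 l))//.
  rewrite -ExD -?ExZr; do ?[apply: L1_gM|apply: L1D] => //.
  apply: Ex_le; first exact: L1_gM.
    by apply: L1Zr; apply: L1D; exact: L1_gM.
  move=> w; rewrite -mulrDr -mulrA ler_wpM2l//.
  by have := sqr_ge0 (K j w - K l w); rewrite sqrrB mulr2n; lra.
have LgKK j l : L1 P (fun w => g w * (K j w * K l w)) by exact: L1_gM.
rewrite (_ : Ex P _ = \sum_(j in ~: N) \sum_(l in ~: N) Ex P (fun w => g w * (K j w * K l w))); last first.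
  under [RHS]eq_bigr do rewrite -Ex_sum//.
  rewrite -Ex_sum; last by move=> j _; exact: L1_sum.
  apply: Ex_eq => w; rewrite expr2 big_distrlr /= mulr_sumr.
  by apply: eq_bigr => j _; rewrite mulr_sumr.
apply: (@le_trans _ _ (\sum_(j in ~: N) \sum_(l in ~: N) (near j l)%:R *
    (Ex P g * (Ex P (fun w => K j w ^+ 2) + Ex P (fun w => K l w ^+ 2)) / 2))).
  by apply: ler_sum => j jN; apply: ler_sum => l lN; exact: cov.
pose m j := Ex P (fun w => K j w ^+ 2).
have m0 j : 0 <= m j by apply: Ex_ge0 => w; exact: sqr_ge0.
have Eg0 : 0 <= Ex P g by exact: Ex_ge0.
have deg : \sum_(j in ~: N) \sum_(l in ~: N) (near j l)%:R * m j <= k * \sum_(j in ~: N) m j.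
  rewrite mulr_sumr; apply: ler_sum => j _; rewrite -mulr_suml ler_wpM2r//.
  apply: le_trans (card_near j); rewrite -natr_sum ler_nat -sum1_card.
  rewrite [leqRHS](eq_bigl (near j)); last by move=> l; rewrite inE.
  rewrite big_mkcond [leqRHS]big_mkcond; apply: leq_sum => l _.
  by case: (l \in _); case: (near j l).
rewrite (_ : \sum_(j in _) _ = Ex P g / 2 *
   (\sum_(j in ~: N) \sum_(l in ~: N) (near j l)%:R * m j +
    \sum_(j in ~: N) \sum_(l in ~: N) (near j l)%:R * m j)).
  have := ler_wpM2l Eg0 deg; lra.
rewrite [X in _ = _ * (X + _)]exchange_big /= -big_split mulr_sumr /=.
apply: eq_bigr => j _; rewrite -big_split mulr_sumr /=; apply: eq_bigr => l _.
by rewrite (near_sym l j) /m; lra.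
Qed.

End FarSum.

(** Expanding the square, a pair with l in A j gives a function of the block A j, which is
independent of g, and for the other pairs both sides vanish. *)
Lemma far_psum_sqr :
  Ex P (fun w => g w * S (~: N)%SET w ^+ 2) = Ex P g * Ex P (fun w => S (~: N)%SET w ^+ 2).
Proof.
have Lpair j l : L1 P (fun w => x j w * x l w).
  by apply: L1_sqM; [exact: measurable_x H j|exact: measurable_x H l|exact: L1_x2 H j|exact: L1_x2 H l].
have Lgpair j l : L1 P (fun w => g w * (x j w * x l w)) by exact: L1_gM.
have sq w : S (~: N)%SET w ^+ 2 = \sum_(j in ~: N) \sum_(l in ~: N) x j w * x l w.
  by rewrite expr2 big_distrlr.
have -> : Ex P (fun w => S (~: N)%SET w ^+ 2) =
    \sum_(j in ~: N) \sum_(l in ~: N) Ex P (fun w => x j w * x l w).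
  under [RHS]eq_bigr do rewrite -Ex_sum//.
  by rewrite -Ex_sum; [apply: Ex_eq => w; exact: sq|move=> j _; exact: L1_sum].
have -> : Ex P (fun w => g w * S (~: N)%SET w ^+ 2) =
    \sum_(j in ~: N) \sum_(l in ~: N) Ex P (fun w => g w * (x j w * x l w)).
  under [RHS]eq_bigr do rewrite -Ex_sum//.
  rewrite -Ex_sum; last by move=> j _; exact: L1_sum.
  apply: Ex_eq => w; rewrite sq mulr_sumr; apply: eq_bigr => j _.
  by rewrite mulr_sumr.
rewrite mulr_sumr; apply: eq_bigr => j; rewrite finset.in_setC => jN.
rewrite mulr_sumr; apply: eq_bigr => l _.
have [lA|lA] := boolP (l \in A j).
  apply: (far_indep jN) => //; apply: measurable_funM; first exact: family_meas_own.
  exact: (family_meas_x H lA).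
have lA' : l \in (~: A j)%SET by rewrite inE.
have mxl := family_meas_x H lA'.
rewrite (Ex_mean0 mxl (L1_x H l)) mulr0.
have mgx : family_meas X (~: A j)%SET (fun w => g w * x l w).
  by apply: measurable_funM => //; exact: family_measS (far_subA jN) mg.
rewrite -[RHS](Ex_mean0 mgx (L1_gM (L1_x H l))).
by apply: Ex_eq => w; rewrite mulrCA.
Qed.

End Decoupling.

(** * Concentration: the window and the random kernel *)

Section Concentration.
Context d (T : measurableType d) (R : realType) (P : probability T R).
Context (J : finType) (X : J -> {RV P >-> R}).
Context (x : J -> T -> R) (A B C : J -> {set J}) (p k : R).
Hypothesis H : local_dependence X x A B C p k.
Implicit Types (D E : {set J}) (i j l : J).
Local Notation S := (psum x).
Local Notation beta := (moment_bound P x p k).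
Local Notation q := (p - 2).
Local Notation W := (fun w => \sum_j x j w).

Context (i0 : J) (g u : T -> R) (G al : R).
Local Notation D := (B i0).
Local Notation N := (neighbourhood B D).
Hypothesis mg : family_meas X D g.
Hypothesis mu : family_meas X D u.
Hypothesis g0 : forall w, 0 <= g w.
Hypothesis gG : forall w, g w <= G.
Hypothesis al0 : 0 < al.

Local Notation phi := (fun w => W w - u w).
Local Notation Y j := (S (A j)).

(** Increments larger than 1 are discarded so that t stays in [-1, 1]; they are paid for
with |y|^(p-2) >= 1. *)
Definition trunc (y : R) : R := if `|y| <= 1 then y else 0.

Lemma trunc_le1 y : `|trunc y| <= 1.
Proof. by rewrite /trunc; case: ifP; rewrite ?normr0. Qed.

Lemma measurable_trunc d' (T' : measurableType d') (f : T' -> R) :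
  measurable_fun setT f -> measurable_fun setT (fun w => trunc (f w)).
Proof.
move=> mf; apply: measurable_fun_if => //.
- by apply: measurable_fun_ler => //; exact: measurableT_comp.
- exact: measurable_funTS.
Qed.

Let mgT : measurable_fun setT g. Proof. exact: family_meas_meas mg. Qed.
Let muT : measurable_fun setT u. Proof. exact: family_meas_meas mu. Qed.
Let mphi : measurable_fun setT phi.
Proof.
apply: measurable_funB => //; apply: measurable_sum => j; exact: measurable_x H j.
Qed.

Let measurable_tent d' (T' : measurableType d') (f : T' -> R) :
  measurable_fun setT f -> measurable_fun setT (fun w => tent (f w)).
Proof.
by apply: measurableT_comp; exact: continuous_measurable_fun (@continuous_tent R).
Qed.

(** The random kernel through which x_j contributes to the expansion of
E g W F(W) as an integral of F'(W + t). *)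
Definition kern j t w := x j w * ker (trunc (Y j w)) t.
Definition window t w := tent ((phi w + t) / al).
Definition window_mean t := Ex P (fun w => g w * window t w).

Lemma measurable_window t : measurable_fun setT (window t).
Proof. by apply: measurable_tent; apply: measurable_funM => //; exact: measurable_funD. Qed.

Lemma L1_gM' f : L1 P f -> L1 P (fun w => g w * f w).
Proof. by move=> Lf; exact: (L1_gM mg g0 gG Lf). Qed.

Lemma L1_window t : L1 P (fun w => g w * window t w).
Proof.
apply: L1_gM'; apply: (@L1_bnd _ _ _ _ _ 1) (measurable_window t) _ => w.
by rewrite ger0_norm ?tent_ge0 ?tent_le1.
Qed.

Lemma family_meas_kern j t : family_meas X (A j) (kern j t).
Proof.
apply: measurable_funM; first exact: family_meas_own H j.
apply: measurable_ker => //; apply: measurable_trunc; exact: family_meas_psum H _ _ (subxx _).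
Qed.

Lemma kern_expr2 j t w : kern j t w ^+ 2 = x j w ^+ 2 * `|ker (trunc (Y j w)) t|.
Proof. by rewrite exprMn ker_sqr. Qed.

Lemma L1_kern2 j t : L1 P (fun w => kern j t w ^+ 2).
Proof.
apply: L1_le (L1_x2 H j) _.
  by apply: measurable_funX; exact: family_meas_meas (@family_meas_kern j t).
by move=> w; rewrite ger0_norm ?sqr_ge0// kern_expr2 ler_piMr ?sqr_ge0// ker_le1.
Qed.

Lemma L1_kern j t : L1 P (kern j t).
Proof. by apply: L1_sqrt (L1_kern2 j t); exact: family_meas_meas (@family_meas_kern j t). Qed.

Variable L : R.
Hypothesis window_meanL : forall t, window_mean t <= L.

Lemma window_mean_ge0 t : 0 <= window_mean t.
Proof. by apply: Ex_ge0 => w; rewrite mulr_ge0 ?tent_ge0. Qed.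

(** For |t| <= al the increment of the tent is at most |t|/al times five shifted tents, and
each of them has weighted mean at most L. For larger t the trivial bound is enough. *)
Lemma window_mean_shift t : `|window_mean t - window_mean 0| <= 5 * L / al * `|t|.
Proof.
have aln0 : al != 0 by rewrite gt_eqF.
have L0 : 0 <= L := le_trans (window_mean_ge0 0) (window_meanL 0).
have [tal|alt] := leP `|t| al; last first.
  apply: (@le_trans _ _ L).
    have := window_mean_ge0 t; have := window_mean_ge0 0; have := window_meanL 0; have := window_meanL t.
    by rewrite ler_norml => *; apply/andP; split; lra.
  have : 1 <= `|t| / al by rewrite ler_pdivlMr// mul1r ltW.
  rewrite -mulrA [al^-1 * _]mulrC => h.
  have := ler_wpM2l L0 h; lra.
have tal' : `|t / al| <= 1 by rewrite normrM normfV (gtr0_norm al0) ler_pdivrMr// mul1r.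
have Lt s := L1_window s.
have E : window_mean t - window_mean 0 = Ex P (fun w => g w * window t w - g w * window 0 w) by rewrite ExB.
pose ub w := `|t| / al * (g w * window (- 2 * al) w + g w * window (- al) w + g w * window 0 w +
   g w * window al w + g w * window (2 * al) w).
have Lub : L1 P ub by do ?[apply: L1Zl|apply: L1D].
rewrite E; apply: (@le_trans _ _ (Ex P ub)).
  apply: Ex_abs_le => //; first exact: L1B.
  move=> w; rewrite -mulrBr normrM (ger0_norm (g0 w)) /ub -!mulrDr mulrCA ler_wpM2l//.
  have tE s : window s w = tent (phi w / al + s / al) by rewrite /window mulrDl.
  have tE0 : window 0 w = tent (phi w / al) by rewrite tE mul0r addr0.
  rewrite tE0 !tE !mulNr !mulfK// divff//.
  have -> : `|t| / al = `|t / al| by rewrite normrM normfV (gtr0_norm al0).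
  exact: (tent_shift _ tal').
rewrite /ub ExZl; last by do ?[apply: L1D].
rewrite !ExD; do ?[apply: L1D] => //.
have -> : 5 * L / al * `|t| = `|t| / al * (L + L + L + L + L) by ring.
rewrite ler_wpM2l ?divr_ge0 ?(ltW al0)//.
have := window_meanL (- 2 * al); have := window_meanL (- al); have := window_meanL 0.
have := window_meanL al; have := window_meanL (2 * al); rewrite /window_mean; lra.
Qed.

Definition kern_mean t := \sum_(j in ~: N) Ex P (kern j t).

(** The centred kernels are functions of the blocks A j, so far pairs decorrelate. *)
Lemma kernel_fluctuation t : Ex P (fun w => g w * (\sum_(j in ~: N) kern j t w - kern_mean t) ^+ 2) <=
  Ex P g * (k * \sum_(j in ~: N) Ex P (fun w => kern j t w ^+ 2)).
Proof.
pose K j w := kern j t w - Ex P (kern j t).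
have mK j : family_meas X (A j) (K j).
  by apply: measurable_funB; [exact: family_meas_kern|exact: measurable_cst].
have LK j : L1 P (fun w => K j w ^+ 2).
  have := @L1_sqD _ _ _ P (kern j t) (fun=> - Ex P (kern j t)).
  apply; [exact: L1_meas (L1_kern j t)|exact: measurable_cst|exact: L1_kern2|exact: L1_cst].
have EK j : Ex P (K j) = 0.
  by rewrite ExB; [rewrite Ex_cst subrr|exact: L1_kern|exact: L1_cst].
have := far_sum_sqr H mg g0 gG mK LK EK.
under Ex_eq do rewrite sumrB.
move=> /le_trans; apply.
have Eg0 : 0 <= Ex P g by exact: Ex_ge0.
rewrite ler_wpM2l// ler_wpM2l ?(ltW (k_gt0 H))//; apply: ler_sum => j _.
have -> : Ex P (fun w => K j w ^+ 2) = Ex P (fun w => kern j t w ^+ 2) - Ex P (kern j t) ^+ 2.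
  rewrite (_ : Ex P _ = Ex P (fun w => kern j t w ^+ 2 - 2 * Ex P (kern j t) * kern j t w + Ex P (kern j t) ^+ 2)).
    have ? := L1_kern2 j t; have ? := L1_kern j t.
    rewrite ExD; [|by apply: L1B => //; exact: L1Zl|exact: L1_cst].
    by rewrite ExB//; [rewrite ExZl// Ex_cst; ring|apply: L1Zl].
  by apply: Ex_eq => w; rewrite /K; ring.
by rewrite lerBlDr lerDl sqr_ge0.
Qed.

Definition kern_abs t := \sum_(j in ~: N) Ex P (fun w => `|x j w| * (`|t| * `|ker (trunc (Y j w)) t|)).
Definition kern_sqr t := \sum_(j in ~: N) Ex P (fun w => x j w ^+ 2 * `|ker (trunc (Y j w)) t|).

Lemma window_ge0 t w : 0 <= window t w. Proof. exact: tent_ge0. Qed.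
Lemma window_le1 t w : window t w <= 1. Proof. exact: tent_le1. Qed.

Lemma L1_windowM t f : L1 P f -> L1 P (fun w => window t w * f w).
Proof.
move=> Lf; apply: (L1_bndM (c := 1) (measurable_window t) _ Lf) => w.
by rewrite ger0_norm ?window_ge0 ?window_le1.
Qed.

(** The kernel is replaced by its mean, at the price of the Cauchy-Schwarz inequality with
weight lam, and the shifted window by the window at 0. *)
Lemma window_kernel_ge t lam : 0 < lam ->
  window_mean 0 * kern_mean t - 5 * L / al * kern_abs t - lam / 2 * window_mean t - Ex P g * (k * kern_sqr t) / (2 * lam)
  <= Ex P (fun w => g w * (window t w * \sum_(j in ~: N) kern j t w)).
Proof.
move=> lam0; pose Z w := \sum_(j in ~: N) kern j t w - kern_mean t.
have mkern j : measurable_fun setT (kern j t) by exact: family_meas_meas (@family_meas_kern j t).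
have LZ2 : L1 P (fun w => Z w ^+ 2).
  apply: L1_sqD; [|exact: measurable_cst| |exact: L1_cst].
    by under eq_fun do rewrite big_mkcond; apply: measurable_sum => j; case: (_ \in _).
  by apply: L1_sq_sum => // j; exact: L1_kern2.
have LZ : L1 P Z by apply: L1B; [apply: L1_sum => j _; exact: L1_kern|exact: L1_cst].
have E : Ex P (fun w => g w * (window t w * \sum_(j in ~: N) kern j t w)) =
    Ex P (fun w => g w * (window t w * Z w)) + kern_mean t * window_mean t.
  rewrite -(ExZl _ (L1_window t)) -ExD; [|exact/L1_gM'/L1_windowM|exact/L1Zl/L1_window].
  by apply: Ex_eq => w; rewrite /Z; ring.
have h1 : - (lam / 2 * window_mean t + (2 * lam)^-1 * Ex P (fun w => g w * Z w ^+ 2)) <=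
    Ex P (fun w => g w * (window t w * Z w)).
  have ? := L1_window t; have ? := L1_gM' LZ2.
  rewrite -(ExZl _ (L1_window t)) -(ExZl _ (L1_gM' LZ2)) -ExD; do ?[apply: L1Zl] => //.
  rewrite -ExN; last by apply: L1D; apply: L1Zl.
  apply: Ex_le; [by apply: L1N; apply: L1D; apply: L1Zl|exact/L1_gM'/L1_windowM|].
  move=> w; rewrite (_ : - _ = g w * - (lam / 2 * window t w + (2 * lam)^-1 * Z w ^+ 2)); last by ring.
  rewrite ler_wpM2l//; have t0 := window_ge0 t w; have t1 := window_le1 t w.
  have : 0 <= (lam * window t w + Z w) ^+ 2 / (2 * lam) by rewrite divr_ge0 ?sqr_ge0// mulr_ge0 ?ltW.
  rewrite (_ : _ / (2 * lam) = lam / 2 * window t w ^+ 2 + window t w * Z w + (2 * lam)^-1 * Z w ^+ 2).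
    have : lam / 2 * window t w ^+ 2 <= lam / 2 * window t w.
      by rewrite ler_wpM2l ?divr_ge0 ?(ltW lam0)// expr2 ler_piMr.
    lra.
  by field; rewrite gt_eqF.
have h2 : Ex P (fun w => g w * Z w ^+ 2) <= Ex P g * (k * kern_sqr t).
  apply: le_trans (kernel_fluctuation t) _; rewrite le_eqVlt; apply/orP; left; apply/eqP.
  congr (_ * (_ * _)); apply: eq_bigr => j _; apply: Ex_eq => w; exact: kern_expr2.
have h3 : window_mean 0 * kern_mean t - 5 * L / al * kern_abs t <= kern_mean t * window_mean t.
  have hs := window_mean_shift t.
  have hM : `|kern_mean t| * `|t| <= kern_abs t.
    rewrite /kern_mean; apply: le_trans (ler_wpM2r (normr_ge0 t) (ler_norm_sum _ _ _)) _.
    rewrite mulr_suml; apply: ler_sum => j _.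
    apply: le_trans (ler_wpM2r (normr_ge0 t) (Ex_abs (L1_kern j t))) _.
    rewrite -ExZr; last exact/L1_abs/L1_kern.
    by rewrite le_eqVlt; apply/orP; left; apply/eqP; apply: Ex_eq => w; rewrite normrM; ring.
  have L0 : 0 <= L := le_trans (window_mean_ge0 0) (window_meanL 0).
  have : `|kern_mean t * (window_mean t - window_mean 0)| <= 5 * L / al * kern_abs t.
    rewrite normrM; apply: le_trans (ler_wpM2l (normr_ge0 _) hs) _.
    rewrite mulrCA ler_wpM2l// divr_ge0 ?(ltW al0)// mulr_ge0//.
  by rewrite ler_norml => /andP[]; lra.
have h4 : (2 * lam)^-1 * Ex P (fun w => g w * Z w ^+ 2) <= Ex P g * (k * kern_sqr t) / (2 * lam).
  by rewrite mulrC ler_wpM2r// invr_ge0 mulr_ge0// ltW.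
rewrite E; lra.
Qed.

End Concentration.

(** * Concentration: integration over the shift *)

Section SwapM.
Context d (T : measurableType d) (R : realType) (P : probability T R).
Context (f : T -> R) (h : T -> R -> R).
Hypothesis Lf : L1 P f.
Hypothesis mh : measurable_fun setT (fun z : T * R => h z.1 z.2).
Hypothesis h1 : forall w t, `|h w t| <= 1.

Let mPhi : measurable_fun setT (fun z : T * R => f z.1 * h z.1 z.2).
Proof.
apply: measurable_funM => //; exact: (measurableT_comp (L1_meas Lf) measurable_fst).
Qed.

Let PhiG w t : `|f w * h w t| <= `|f w|.
Proof. by rewrite normrM ler_piMr. Qed.

Lemma L1_swapM : L1 (Q11 R) (fun t => Ex P (fun w => f w * h w t)).
Proof. exact (L1_Ex1 (Q11 R) mPhi (L1_abs Lf) PhiG). Qed.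

(** Fubini's theorem for a bounded kernel in the shift variable. *)
Lemma Ex_swapM : Ex (Q11 R) (fun t => Ex P (fun w => f w * h w t)) =
  Ex P (fun w => f w * Ex (Q11 R) (h w)).
Proof.
rewrite -(Ex_swap (Q11 R) mPhi (L1_abs Lf) PhiG); apply: Ex_eq => w.
rewrite ExZl//; apply: (@L1_bnd _ _ _ _ _ 1) => //.
exact: (measurable_fun_pair2 w mh).
Qed.

Lemma L1_swapM2 : L1 P (fun w => f w * Ex (Q11 R) (h w)).
Proof.
have := L1_Ex2 (Q11 R) mPhi (L1_abs Lf) PhiG; congr L1; apply/funext => w.
rewrite ExZl//; apply: (@L1_bnd _ _ _ _ _ 1) => //.
exact: (measurable_fun_pair2 w mh).
Qed.

End SwapM.

Section ConcentrationBound.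
Context d (T : measurableType d) (R : realType) (P : probability T R).
Context (J : finType) (X : J -> {RV P >-> R}).
Context (x : J -> T -> R) (A B C : J -> {set J}) (p k : R).
Hypothesis H : local_dependence X x A B C p k.
Implicit Types (D E : {set J}) (i j l : J).
Local Notation S := (psum x).
Local Notation beta := (moment_bound P x p k).
Local Notation q := (p - 2).
Local Notation W := (fun w => \sum_j x j w).

Context (i0 : J) (g u : T -> R) (G al : R).
Local Notation D := (B i0).
Local Notation N := (neighbourhood B D).
Hypothesis mg : family_meas X D g.
Hypothesis mu : family_meas X D u.
Hypothesis g0 : forall w, 0 <= g w.
Hypothesis gG : forall w, g w <= G.
Hypothesis al0 : 0 < al.

Local Notation phi := (fun w => W w - u w).
Local Notation Y j := (S (A j)).
Local Notation Q := (Q11 R).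
Local Notation Kr := (kern x A).
Local Notation tau := (window x u al).
Local Notation gtau := (window_mean P x g u al).

Let mY j : measurable_fun setT (fun w => trunc (Y j w)).
Proof. apply: measurable_trunc; exact: measurable_psum H (A j). Qed.

Let mker j : measurable_fun setT (fun z : T * R => ker (trunc (Y j z.1)) z.2).
Proof.
apply: measurable_ker; last exact: measurable_snd.
exact: (measurableT_comp (mY j) measurable_fst).
Qed.

Let mphi : measurable_fun setT phi.
Proof.
apply: measurable_funB; last exact: family_meas_meas mu.
apply: measurable_sum => j; exact: measurable_x H j.
Qed.

Let mtau : measurable_fun setT (fun z : T * R => tau z.2 z.1).
Proof.
have m1 : measurable_fun setT (fun z : T * R => (phi z.1 + z.2) / al).
  apply: measurable_funM => //; apply: measurable_funD; last exact: measurable_snd.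
  exact: (measurableT_comp mphi measurable_fst).
exact: (measurableT_comp (continuous_measurable_fun (@continuous_tent R)) m1).
Qed.

Let swap_sum (K : {set J}) (f : J -> T -> R) (h : J -> T -> R -> R) (v : J -> T -> R) :
  (forall j, L1 P (f j)) ->
  (forall j, measurable_fun setT (fun z : T * R => h j z.1 z.2)) ->
  (forall j w t, `|h j w t| <= 1) -> (forall j w, Ex Q (h j w) = v j w) ->
  [/\ L1 Q (fun t => \sum_(j in K) Ex P (fun w => f j w * h j w t)),
      forall j, L1 P (fun w => f j w * v j w) &
  Ex Q (fun t => \sum_(j in K) Ex P (fun w => f j w * h j w t)) =
  \sum_(j in K) Ex P (fun w => f j w * v j w)].
Proof.
move=> Lf mh h1 hv.
have Lj j := L1_swapM (Lf j) (mh j) (h1 j).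
split; first by apply: L1_sum => j _; exact: Lj.
  move=> j; have := L1_swapM2 (Lf j) (mh j) (h1 j).
  by congr L1; apply/funext => w; rewrite hv.
rewrite Ex_sum; last by move=> j _; exact: Lj.
apply: eq_bigr => j _; rewrite (Ex_swapM (Lf j) (mh j) (h1 j)).
by apply: Ex_eq => w; rewrite hv.
Qed.

Lemma Ex_kern_mean : L1 Q (kern_mean P x A B i0) /\
  Ex Q (kern_mean P x A B i0) = \sum_(j in ~: N) Ex P (fun w => x j w * (trunc (Y j w) / 2)).
Proof.
have [] := @swap_sum (~: N)%SET x (fun j w t => ker (trunc (Y j w)) t)
    (fun j w => trunc (Y j w) / 2) => //.
- exact: L1_x H.
- by move=> j w t; exact: ker_le1.
- by move=> j w; rewrite Ex_ker1// trunc_le1.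
Qed.

Lemma abs_ker_le1 (y t : R) : `|y| <= 1 -> `| `|t| * `|ker y t| | <= 1.
Proof.
move=> y1; rewrite normrM !normr_id /ker.
have [t1|t1] := leP `|t| 1; first by rewrite mulr_ile1 ?ker_le1.
have e1 : (- y <= t < 0) = false.
  apply/negP => /andP[ty t0]; move: t1 y1; rewrite (ltr0_norm t0) ler_norml => ? /andP[]; lra.
have e2 : (0 <= t < - y) = false.
  apply/negP => /andP[t0 ty]; move: t1 y1; rewrite (ger0_norm t0) ler_norml => ? /andP[]; lra.
by rewrite e1 e2 subrr normr0 mulr0.
Qed.

Lemma Ex_kern_abs : L1 Q (kern_abs P x A B i0) /\
  Ex Q (kern_abs P x A B i0) = \sum_(j in ~: N) Ex P (fun w => `|x j w| * (trunc (Y j w) ^+ 2 / 4)).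
Proof.
have [] := @swap_sum (~: N)%SET (fun j w => `|x j w|) (fun j w t => `|t| * `|ker (trunc (Y j w)) t|)
    (fun j w => trunc (Y j w) ^+ 2 / 4) => //.
- by move=> j; exact: L1_abs (L1_x H j).
- move=> j; have m1 : measurable_fun setT (fun z : T * R => `|z.2|).
    exact: (measurableT_comp (@normr_measurable R setT) measurable_snd).
  apply: measurable_funM m1 _; exact: (measurableT_comp (@normr_measurable R setT) (mker j)).
- by move=> j w t; apply: abs_ker_le1; exact: trunc_le1.
- by move=> j w; rewrite Ex_abs_ker_abs// trunc_le1.
Qed.

Lemma Ex_kern_sqr : L1 Q (kern_sqr P x A B i0) /\
  Ex Q (kern_sqr P x A B i0) = \sum_(j in ~: N) Ex P (fun w => x j w ^+ 2 * (`|trunc (Y j w)| / 2)).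
Proof.
have [] := @swap_sum (~: N)%SET (fun j w => x j w ^+ 2) (fun j w t => `|ker (trunc (Y j w)) t|)
    (fun j w => `|trunc (Y j w)| / 2) => //.
- exact: L1_x2 H.
- by move=> j; exact: (measurableT_comp (@normr_measurable R setT) (mker j)).
- by move=> j w t; rewrite normr_id; exact: ker_le1.
- by move=> j w; rewrite Ex_abs_ker1// trunc_le1.
Qed.

Let tau1 w t : `|tau t w| <= 1.
Proof. by rewrite ger0_norm ?window_ge0 ?window_le1. Qed.

Lemma Ex_window_mean : L1 Q gtau /\ Ex Q gtau <= al / 2 * Ex P g.
Proof.
have Lg := L1_g mg g0 gG.
split; first exact: (L1_swapM Lg mtau tau1).
rewrite [leLHS](Ex_swapM Lg mtau tau1) mulrC -(ExZr _ Lg).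
apply: Ex_le; last by move=> w; rewrite ler_wpM2l//; exact: Ex_tent.
- exact: (L1_swapM2 Lg mtau tau1).
- exact: L1Zr.
Qed.

(** Half the increment of F(v) = al * step (v / al) over y. *)
Definition stepdiff (y v : R) := al * (step (v / al) - step ((v - y) / al)) / 2.

(** Integration over t turns the kernel expansion back into increments of the step function. *)
Lemma Ex_window_kernel : L1 Q (fun t => Ex P (fun w => g w * (tau t w * \sum_(j in ~: N) Kr j t w))) /\
  Ex Q (fun t => Ex P (fun w => g w * (tau t w * \sum_(j in ~: N) Kr j t w))) =
  Ex P (fun w => g w * \sum_(j in ~: N) x j w * stepdiff (trunc (Y j w)) (phi w)).
Proof.
have Lgx j : L1 P (fun w => g w * x j w) by apply: (L1_gM mg g0 gG); exact: L1_x H j.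
have htk j w t : `|tau t w * ker (trunc (Y j w)) t| <= 1.
  by rewrite normrM mulr_ile1// ker_le1.
have mtk j : measurable_fun setT (fun z : T * R => tau z.2 z.1 * ker (trunc (Y j z.1)) z.2).
  exact: measurable_funM.
have Ltk j t : L1 P (fun w => g w * x j w * (tau t w * ker (trunc (Y j w)) t)).
  have := L1_bndM (measurable_fun_pair1 t (mtk j)) (fun w => htk j w t) (Lgx j).
  by congr L1; apply/funext => w /=; rewrite mulrC.
have E t : Ex P (fun w => g w * (tau t w * \sum_(j in ~: N) Kr j t w)) =
    \sum_(j in ~: N) Ex P (fun w => g w * x j w * (tau t w * ker (trunc (Y j w)) t)).
  rewrite -Ex_sum//; apply: Ex_eq => w; rewrite !mulr_sumr; apply: eq_bigr => j _.
  by rewrite /kern; ring.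
have [L1s L1v Es] := @swap_sum (~: N)%SET (fun j w => g w * x j w)
  (fun j w t => tau t w * ker (trunc (Y j w)) t)
  (fun j w => stepdiff (trunc (Y j w)) (phi w)) Lgx mtk htk
  (fun j w => Ex_ker_tent _ al0 (trunc_le1 _)).
split.
  by move: L1s; congr L1; apply/funext => t; rewrite E.
apply: etrans (Ex_eq Q E) _; apply: etrans Es _; rewrite -Ex_sum; last by move=> j _; exact: L1v.
by apply: Ex_eq => w; rewrite mulr_sumr; apply: eq_bigr => j _; rewrite mulrA.
Qed.

End ConcentrationBound.

(** * Concentration: total mass of the kernel and the upper bound *)

Section ConcentrationInequality.
Context d (T : measurableType d) (R : realType) (P : probability T R).
Context (J : finType) (X : J -> {RV P >-> R}).
Context (x : J -> T -> R) (A B C : J -> {set J}) (p k : R).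
Hypothesis H : local_dependence X x A B C p k.
Implicit Types (D E : {set J}) (i j l : J).
Local Notation S := (psum x).
Local Notation beta := (moment_bound P x p k).
Local Notation q := (p - 2).
Local Notation W := (fun w => \sum_j x j w).
Local Notation Y j := (S (A j)).

(** Both regimes |y| <= 1 and |y| > 1 are absorbed by the power p - 2, because
|y| <= |y|^(p-2) in the first and 1 <= |y|^(p-2) in the second. *)
Lemma trunc_facts y : [/\ trunc y ^+ 2 <= `|y| * `|y| `^ q, `|trunc y| <= `|y| `^ q &
  `|y - trunc y| <= `|y| * `|y| `^ q].
Proof.
have y0 := normr_ge0 y.
rewrite /trunc; have [y1|/ltW y1] := leP `|y| 1.
  have h := powq_gev (ld_p3 H) (introT andP (conj y0 y1)).
  split; [by rewrite -real_normK ?num_real// expr2 ler_wpM2l|exact: h|].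
  by rewrite subrr normr0 mulr_ge0 ?powR_ge0.
have h := powq_ge1 (ld_p2 H) y1.
split; [by rewrite expr0n mulr_ge0 ?powR_ge0|by rewrite normr0 powR_ge0|].
by rewrite subr0 ler_peMr.
Qed.

Lemma sub_AC j : A j \subset C j.
Proof. exact: fintype.subset_trans (ld_AB H j) (ld_BC H j). Qed.

(** E W^2 = 1 and x_j is uncorrelated with the x_l outside A j. *)
Lemma Ex_W2 : \sum_j Ex P (fun w => x j w * Y j w) = 1.
Proof.
rewrite -(ld_var H) -Ex_sum; last by move=> j _; exact: L1_xS H j (A j).
have LxC j : L1 P (fun w => x j w * S (~: A j)%SET w) by exact: L1_xS H j _.
have E0 j : Ex P (fun w => x j w * S (~: A j)%SET w) = 0.
  exact: (Ex_mean0 H (family_meas_psum H (subxx _)) (L1_S H _)).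
have Z : \sum_j Ex P (fun w => x j w * S (~: A j)%SET w) = 0.
  by apply: big1 => j _; exact: E0.
rewrite -[LHS]addr0 -[X in _ + X]Z.
rewrite -Ex_sum// -ExD; last 2 first.
- by apply: L1_sum => j _; exact: L1_xS H j (A j).
- by apply: L1_sum => j _; exact: LxC.
apply: Ex_eq => w; rewrite -big_split expr2 mulr_suml; apply: eq_bigr => j _ /=.
by rewrite -mulrDr -psumC addrC subrK.
Qed.

Section Block.
Variable i0 : J.
Local Notation D := (B i0).
Local Notation N := (neighbourhood B D).

Lemma card_neighbourhood : #|N|%:R <= k.
Proof.
apply: le_trans (ld_row H i0); rewrite ler_nat; apply: subset_leq_card.
apply/fintype.subsetP => j; rewrite !inE => /finset.set0Pn[l]; rewrite inE => /andP[lB lj].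
apply/finset.set0Pn; exists l; rewrite inE lj andbT; exact: (fintype.subsetP (ld_BC H i0)).
Qed.

(** 2 x_j Y_j <= k x_j^2 + Y_j^2 / k, and the sums of both terms over a neighbourhood are small. *)
Lemma near_mean_le : \sum_(j in N) Ex P (fun w => x j w * Y j w) <= 16^-1 + 4 * beta.
Proof.
have k0 := k_gt0 H.
have hx := small_x2 H card_neighbourhood; have hS := small_S2 H card_neighbourhood sub_AC.
apply: (@le_trans _ _ (\sum_(j in N) (k * Ex P (fun w => x j w ^+ 2) + k^-1 * Ex P (fun w => Y j w ^+ 2)) / 2)).
  apply: ler_sum => j _.
  rewrite -(ExZl _ (L1_x2 H j)) -(ExZl _ (L1_S2 H (A j))) -ExD; last 2 first.
  - exact: L1Zl (L1_x2 H j).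
  - exact: L1Zl (L1_S2 H (A j)).
  rewrite -ExZr; last by apply: L1D; [exact: L1Zl (L1_x2 H j)|exact: L1Zl (L1_S2 H (A j))].
  apply: Ex_le; first exact: L1_xS H j (A j).
    by apply/L1Zr/L1D; [exact: L1Zl (L1_x2 H j)|exact: L1Zl (L1_S2 H (A j))].
  move=> w; have : 0 <= k^-1 * (k * x j w - Y j w) ^+ 2 by rewrite mulr_ge0 ?sqr_ge0// invr_ge0 ltW.
  rewrite (_ : k^-1 * _ = k * x j w ^+ 2 - 2 * (x j w * Y j w) + k^-1 * Y j w ^+ 2); first lra.
  by field; rewrite gt_eqF.
rewrite -mulr_suml big_split /= -!mulr_sumr.
by move: hx hS; set a := k * _; set b := k^-1 * _; set c := 16^-1 + _; lra.
Qed.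

Let xY_third j : L1 P (fun w => `|x j w| * `|Y j w| * `|Y j w| `^ q).
Proof. exact: L1_third H _ _ _ (sub_AC j) (sub_AC j). Qed.

Lemma L1_xtrunc j : L1 P (fun w => x j w * trunc (Y j w)).
Proof.
apply: L1_le (L1_abs (L1_x H j)) _; last by move=> w; rewrite normrM ler_piMr// trunc_le1.
apply: measurable_funM; first exact: measurable_x H j.
by apply: measurable_trunc; exact: measurable_psum H (A j).
Qed.

(** The total is 1, the indices near the block contribute little, and truncation loses at
most beta. *)
Lemma far_mean_ge : 1 - (16^-1 + 5 * beta) <= \sum_(j in ~: N) Ex P (fun w => x j w * trunc (Y j w)).
Proof.
have := Ex_W2; rewrite (bigID (mem N)) /=; have hN := near_mean_le.
have hf : \sum_(j in ~: N) Ex P (fun w => x j w * Y j w) <=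
    \sum_(j in ~: N) Ex P (fun w => x j w * trunc (Y j w)) +
    \sum_(j in ~: N) Ex P (fun w => `|x j w| * `|Y j w| * `|Y j w| `^ q).
  rewrite -big_split; apply: ler_sum => j _ /=.
  rewrite -ExD; [|exact: L1_xtrunc|exact: xY_third].
  apply: Ex_le; [exact: L1_xS H j (A j)|by apply: L1D; [exact: L1_xtrunc|exact: xY_third]|].
  move=> w; rewrite -lerBlDl -mulrBr; apply: le_trans (ler_norm _) _.
  by rewrite normrM -mulrA ler_wpM2l//; have [] := trunc_facts (Y j w).
have ht : \sum_(j in ~: N) Ex P (fun w => `|x j w| * `|Y j w| * `|Y j w| `^ q) <= beta.
  apply: le_trans (sum_third H sub_AC sub_AC); rewrite [leRHS](bigID (mem (~: N)%SET)) /= lerDl.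
  by apply: sumr_ge0 => j _; apply: Ex_ge0 => w; rewrite !mulr_ge0 ?powR_ge0.
rewrite [X in _ + X](eq_bigl (mem (~: N)%SET)); last by move=> j; rewrite !inE.
by move: hf ht hN; rewrite /=; set a := \sum_(j in _) _; set b := \sum_(j in _) _; set c := \sum_(j in _) _; set e := \sum_(j in _) _; lra.
Qed.

Lemma continuous_step : continuous (@step R).
Proof.
move=> v; apply: differentiable_continuous; apply/derivable1_diffP.
by have [] := is_derive_step v.
Qed.

Variable al : R.
Hypothesis al0 : 0 < al.

(** The antiderivative of the tent, centred so that its absolute value is at most al / 2. *)
Definition centered_step (v : R) : R := al * (step (v / al) - 2^-1).

Lemma centered_step_le v : `|centered_step v| <= al / 2.
Proof.
rewrite /centered_step normrM (gtr0_norm al0) ler_pM2l//.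
by have := step_ge0 (v / al); have := step_le1 (v / al); rewrite ler_norml => *; apply/andP; split; lra.
Qed.

Lemma measurable_centered_step d' (T' : measurableType d') (f : T' -> R) :
  measurable_fun setT f -> measurable_fun setT (fun w => centered_step (f w)).
Proof.
move=> mf; apply: measurable_funM => //; apply: measurable_funB => //.
have m1 : measurable_fun setT (fun w => f w / al) by exact: measurable_funM.
exact: (measurableT_comp (continuous_measurable_fun continuous_step) m1).
Qed.

(** Equality holds unless |y| > 1; then the truncated increment vanishes, and the
right-hand side is nonnegative because |y| |y|^(p-2) >= 1. *)
Lemma stepdiff_le (a y v : R) : 2 * (a * stepdiff al (trunc y) v) <=
  a * centered_step v - a * centered_step (v - y) + al * (`|a| * `|y| * `|y| `^ q).
Proof.
rewrite /stepdiff /trunc; have [y1|/ltW y1] := leP `|y| 1.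
  rewrite (_ : 2 * _ = a * centered_step v - a * centered_step (v - y)); last by rewrite /centered_step; field.
  by rewrite lerDl !mulr_ge0 ?powR_ge0// ltW.
rewrite subr0 subrr mulr0 mul0r mulr0 mulr0.
have h : 1 <= `|y| * `|y| `^ q 
  by apply: le_trans (powq_ge1 (ld_p2 H) y1) _; rewrite ler_peMl ?powR_ge0.
have : `|a * (centered_step v - centered_step (v - y))| <= `|a| * al.
  rewrite normrM ler_wpM2l//; apply: le_trans (ler_normB _ _) _.
  by have := centered_step_le v; have := centered_step_le (v - y); lra.
rewrite ler_norml => /andP[]; have : `|a| * al <= al * (`|a| * `|y| * `|y| `^ q).
  by rewrite mulrC ler_pM2l// -mulrA ler_peMr.
by rewrite mulrBr; lra.
Qed.

Section Weight.
Variables (g u : T -> R) (G : R).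
Hypothesis mg : family_meas X D g.
Hypothesis mu : family_meas X D u.
Hypothesis g0 : forall w, 0 <= g w.
Hypothesis gG : forall w, g w <= G.
Local Notation phi := (fun w => W w - u w).

Let mphi : measurable_fun setT phi.
Proof.
apply: measurable_funB; last exact: family_meas_meas mu.
apply: measurable_sum => j; exact: measurable_x H j.
Qed.

Let L1_centered_step f v : L1 P f -> measurable_fun setT v -> L1 P (fun w => f w * (g w * centered_step (v w))).
Proof.
move=> Lf mv; rewrite (_ : (fun w => _) = (fun w => (g w * centered_step (v w)) * f w)).
  apply: (@L1_bndM _ _ _ _ _ _ (G * (al / 2))) => //.
  - apply: measurable_funM; first exact: family_meas_meas mg.
    exact: measurable_centered_step.
  - by move=> w; rewrite normrM ger0_norm// ler_pM// centered_step_le.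
by apply/funext => w; rewrite mulrC.
Qed.

(** For j far from the block, g, u and W - Y_j are all functions of the variables outside
A j, of which x_j is independent. *)
Lemma far_centered_step0 j : j \notin N -> Ex P (fun w => x j w * (g w * centered_step (phi w - Y j w))) = 0.
Proof.
move=> jN.
have DA : D \subset (~: A j)%SET by exact: (far_subA H jN).
have E w : phi w - Y j w = S (~: A j)%SET w - u w by rewrite -psumC addrAC.
rewrite (_ : (fun w => _) = (fun w => x j w * (g w * centered_step (S (~: A j)%SET w - u w)))); last first.
  by apply/funext => w; rewrite E.
apply: (Ex_mean0 H).
- apply: measurable_funM; first exact: (family_measS DA mg).
  apply: measurable_centered_step; apply: measurable_funB; last exact: (family_measS DA mu).
  exact: (family_meas_psum H (subxx _)).
- have := L1_centered_step (L1_cst P 1) (measurable_funB mphi (measurable_psum H (A j))).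
  by congr L1; apply/funext => w; rewrite mul1r -E.
Qed.

(** Summing the increments gives E g W_far F(W - u), because the terms with W - Y_j vanish.
Here |F| <= al / 2, |W_far| <= (1 + W_far^2) / 2 and E g W_far^2 = E g E W_far^2, where
E W_far^2 is at most 2 + 1/8 plus a multiple of beta. *)
Lemma window_kernel_mean_le :
  2 * Ex P (fun w => g w * \sum_(j in ~: N) x j w * stepdiff al (trunc (Y j w)) (phi w)) <=
  al / 4 * (Ex P g * (1 + (2 + 2 * (16^-1 + 4 * beta)))) + al * (Ex P g * beta).
Proof.
have L1w := @L1_gM _ _ _ P _ X D g G mg g0 gG.
have LgSN : L1 P (fun w => S (~: N)%SET w * (g w * centered_step (phi w))).
  exact: L1_centered_step (L1_S H _) mphi.
have Lx2 j : L1 P (fun w => x j w * (g w * centered_step (phi w - Y j w))).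
  exact: L1_centered_step (L1_x H j) (measurable_funB mphi (measurable_psum H (A j))).
have LgT j : L1 P (fun w => g w * (`|x j w| * `|Y j w| * `|Y j w| `^ q)) by exact: L1w.
have Lsd j : L1 P (fun w => x j w * stepdiff al (trunc (Y j w)) (phi w)).
  apply: (@L1_le _ _ _ _ _ (fun w => al * `|x j w|)).
  - apply: measurable_funM; first exact: measurable_x H j.
    have ms (f : T -> R) : measurable_fun setT f -> measurable_fun setT (fun w => step (f w / al)).
      move=> mf; have m1 : measurable_fun setT (fun w => f w / al) by exact: measurable_funM.
      exact: (measurableT_comp (continuous_measurable_fun continuous_step) m1).
    apply: measurable_funM => //; apply: measurable_funM => //.
    apply: measurable_funB; apply: ms => //; apply: measurable_funB => //.
    by apply: measurable_trunc; exact: measurable_psum H (A j).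
  - exact: L1Zl (L1_abs (L1_x H j)).
  - move=> w; rewrite normrM mulrC ler_wpM2r// /stepdiff -mulrA normrM (gtr0_norm al0) ler_piMr ?(ltW al0)//.
    have := step_ge0 (phi w / al); have := step_le1 (phi w / al).
    have := step_ge0 ((phi w - trunc (Y j w)) / al); have := step_le1 ((phi w - trunc (Y j w)) / al).
    by rewrite ler_norml => *; apply/andP; split; lra.
have LgS : L1 P (fun w => g w * \sum_(j in ~: N) x j w * stepdiff al (trunc (Y j w)) (phi w)).
  by apply: L1w; apply: L1_sum => j _; exact: Lsd.
have step1 : 2 * Ex P (fun w => g w * \sum_(j in ~: N) x j w * stepdiff al (trunc (Y j w)) (phi w)) <=
    Ex P (fun w => S (~: N)%SET w * (g w * centered_step (phi w))) +
    al * \sum_(j in ~: N) Ex P (fun w => g w * (`|x j w| * `|Y j w| * `|Y j w| `^ q)).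
  have Z : \sum_(j in ~: N) Ex P (fun w => x j w * (g w * centered_step (phi w - Y j w))) = 0.
    by apply: big1 => j; rewrite finset.in_setC => jN; exact: far_centered_step0.
  rewrite -[X in X + _]subr0 -[X in _ - X + _]Z -!Ex_sum//.
  rewrite -ExB//; last exact: L1_sum.
  rewrite -(ExZl 2 LgS) -ExZl; last exact: L1_sum.
  rewrite -ExD; [|by apply: L1B => //; exact: L1_sum|by apply: L1Zl; exact: L1_sum].
  apply: Ex_le; first exact: L1Zl.
    by apply: L1D; [apply: L1B => //; exact: L1_sum|by apply: L1Zl; exact: L1_sum].
  move=> w; rewrite [S (~: N)%SET w * _]mulr_suml -sumrB !mulr_sumr -big_split /=.
  apply: ler_sum => j _.
  have := ler_wpM2l (g0 w) (stepdiff_le (x j w) (Y j w) (phi w)); lra.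
apply: le_trans step1 _; apply: lerD.
  have LS2 := L1_S2 H (~: N)%SET.
  apply: (@le_trans _ _ (al / 4 * Ex P (fun w => g w * (1 + S (~: N)%SET w ^+ 2)))).
    have Lr : L1 P (fun w => g w * (1 + S (~: N)%SET w ^+ 2)).
      by apply: L1w; apply: L1D => //; exact: L1_cst.
    rewrite -ExZl//; apply: Ex_le => //; first exact: L1Zl.
    move=> w; rewrite [leLHS]mulrCA [leRHS]mulrCA ler_wpM2l//.
    have h := centered_step_le (phi w).
    apply: le_trans (ler_norm _) _; rewrite normrM.
    apply: le_trans (ler_wpM2l (normr_ge0 _) h) _.
    have := ler_wpM2l (ltW al0) (sqr_ge0 (`|S (~: N)%SET w| - 1)).
    rewrite mulr0 -[S _ w ^+ 2]real_normK ?num_real// sqrrB1 mulr2n; lra.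
  rewrite ler_pM2l ?divr_gt0//.
  rewrite (_ : Ex P _ = Ex P (fun w => g w + g w * S (~: N)%SET w ^+ 2)); last first.
    by apply: Ex_eq => w; rewrite mulrDr mulr1.
  rewrite ExD; [|exact: L1_g mg g0 gG|exact: L1w].
  rewrite (far_psum_sqr H mg g0 gG) mulrDr mulr1 lerD2l ler_wpM2l ?Ex_ge0//.
  have hN := small_psum H card_neighbourhood.
  have LW2 : L1 P (fun w => S [set: J]%SET w ^+ 2) by exact: L1_S2 H _.
  have eW : Ex P (fun w => S [set: J]%SET w ^+ 2) = 1.
    rewrite -(ld_var H); apply: Ex_eq => w; congr (_ ^+ 2).
    by apply: eq_bigl => j; rewrite inE.
  apply: (@le_trans _ _ (Ex P (fun w => 2 * S [set: J]%SET w ^+ 2 + 2 * S N w ^+ 2))).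
    apply: Ex_le => //; first by apply: L1D; apply: L1Zl => //; exact: L1_S2 H _.
    move=> w; rewrite -psumC (_ : \sum_j x j w = S [set: J]%SET w); last first.
      by apply: eq_bigl => j; rewrite inE.
    have := sqr_ge0 (S [set: J]%SET w + S N w); nra.
  rewrite ExD; [|exact: L1Zl|by apply: L1Zl; exact: L1_S2 H _].
  rewrite (ExZl _ LW2) (ExZl _ (L1_S2 H N)) eW mulr1; lra.
rewrite ler_pM2l//.
apply: (@le_trans _ _ (\sum_(j in ~: N) Ex P g * Ex P (fun w => `|x j w| * `|Y j w| * `|Y j w| `^ q))).
  apply: ler_sum => j; rewrite finset.in_setC => jN.
  rewrite (far_indep H mg g0 gG jN)//.
  have mown : family_meas X (A j) (x j) by exact: (family_meas_own H).
  have mYA : family_meas X (A j) (Y j) by exact: (family_meas_psum H (subxx (A j))).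
  apply: measurable_funM; last exact: measurable_abs_powR.
  by apply: measurable_funM; [exact: (measurableT_comp (@normr_measurable R setT) mown)|exact: (measurableT_comp (@normr_measurable R setT) mYA)].
rewrite -mulr_sumr ler_wpM2l ?Ex_ge0//; apply: le_trans (sum_third H sub_AC sub_AC).
rewrite [leRHS](bigID (mem (~: N)%SET)) /= lerDl.
by apply: sumr_ge0 => j _; apply: Ex_ge0 => w; rewrite !mulr_ge0 ?powR_ge0.
Qed.

End Weight.

End Block.

End ConcentrationInequality.

(** * Concentration: conclusion *)

(** Here e is the window mean at 0, L the bound for all window means, eg the mean of
the weight, and m1, ..., m5 stand for the integrals over t of the mean kernel, of the two
error kernels, of the window mean, and of the kernel expansion. The Cauchy-Schwarz
weight lam is 1/3. *)
Lemma contraction_arithmetic (R : realType) (b al e L eg m1 m2 m3 m4 m5 : R) :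
  0 < al -> 75 * b <= 1 -> 10 * b <= al -> 0 <= e -> 0 <= L -> 0 <= eg ->
  e * m1 - 5 * L / al * m2 - 3^-1 / 2 * m4 - eg * m3 / (2 * 3^-1) <= m5 ->
  2 * m5 <= al / 4 * (eg * (1 + (2 + 2 * (16^-1 + 4 * b)))) + al * (eg * b) ->
  e * ((1 - (16^-1 + 5 * b)) / 2) <= e * m1 ->
  5 * L / al * m2 <= 5 * L / al * (b / 4) ->
  eg * m3 <= eg * (b / 2) -> m4 <= al / 2 * eg ->
  87 / 100 * e <= L / 4 + 57 / 50 * (al * eg).
Proof.
move=> a0 b75 b10 e0 L0 eg0 hh hup h1 h2 h3 h4.
have f1 : 5 * L / al * (b / 4) <= L / 8.
  rewrite mulrAC ler_pdivrMr//; have := ler_wpM2l L0 b10; lra.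
have f2 : e * b <= e * 75^-1 by rewrite ler_wpM2l//; lra.
have f3 : eg * b <= al * eg / 10 by have := ler_wpM2l eg0 b10; lra.
have f4 : al * (eg * b) <= al * eg * 75^-1.
  by rewrite -mulrA ler_pM2l// ler_wpM2l//; lra.
have f5 : eg * m3 / (2 * 3^-1) = 3 / 2 * (eg * m3) by field.
have f6 : al / 4 * (eg * (1 + (2 + 2 * (16^-1 + 4 * b)))) =
   al * eg * (3 + 8^-1) / 4 + 2 * (al * (eg * b)) by field.
have f7 : e * ((1 - (16^-1 + 5 * b)) / 2) = e * (15 / 32) - 5 / 2 * (e * b) by field.
have f8 : eg * (b / 2) = eg * b / 2 by field.
have f9 : al / 2 * eg = al * eg / 2 by field.
have {}h2 := le_trans h2 f1.
rewrite {}f5 in hh; rewrite {}f6 in hup; rewrite {}f7 in h1; rewrite {}f8 in h3; rewrite {}f9 in h4.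
have f0 : 0 <= al * eg by rewrite mulr_ge0// ltW.
clear f1 L0 eg0 b75 b10 a0; move: f0 hh hup h1 h2 h3 h4 f2 f3 f4.
move: (5 * L / al * m2) (e * m1) (eg * m3) (al * (eg * b)) (al * eg) (e * b) (eg * b).
move=> t1 t2 t3 t4 t5 t6 t7; lra.
Qed.

Section Concentrate.
Context d (T : measurableType d) (R : realType) (P : probability T R).
Context (J : finType) (X : J -> {RV P >-> R}).
Context (x : J -> T -> R) (A B C : J -> {set J}) (p k : R).
Hypothesis H : local_dependence X x A B C p k.
Implicit Types (D E : {set J}) (i j l : J).
Local Notation S := (psum x).
Local Notation beta := (moment_bound P x p k).
Local Notation q := (p - 2).
Local Notation W := (fun w => \sum_j x j w).
Local Notation Y j := (S (A j)).
Local Notation Q := (Q11 R).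

Context (i0 : J) (al : R).
Local Notation D := (B i0).
Local Notation N := (neighbourhood B D).
Hypothesis al0 : 0 < al.
Hypothesis beta75 : 75 * beta <= 1.
Hypothesis beta_al : 10 * beta <= al.

Let third_le : \sum_(j in ~: N) Ex P (fun w => `|x j w| * (trunc (Y j w) ^+ 2 / 4)) <= beta / 4.
Proof.
apply: (@le_trans _ _ ((\sum_j Ex P (fun w => `|x j w| * `|Y j w| * `|Y j w| `^ q)) / 4)); last first.
  by rewrite ler_wpM2r// (sum_third H (sub_AC H) (sub_AC H)).
rewrite (bigID (mem (~: N)%SET) predT) /= mulrDl mulr_suml -[leLHS]addr0 lerD//; last first.
  by rewrite divr_ge0// sumr_ge0// => j _; apply: Ex_ge0 => w; rewrite !mulr_ge0 ?powR_ge0.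
apply: ler_sum => j _.
have L3 := L1_third H (sub_AC H j) (sub_AC H j).
rewrite -ExZr//; apply: Ex_le; last first.
- move=> w; rewrite mulrA ler_wpM2r// -mulrA ler_wpM2l//.
  by have [] := trunc_facts H (Y j w).
- exact: L1Zr.
- apply: L1_le (L1_abs (L1_x H j)) _.
    apply: measurable_funM.
      exact: (measurableT_comp (@normr_measurable R setT) (measurable_x H j)).
    apply: measurable_funM => //; apply: measurable_funX; apply: measurable_trunc.
    exact: measurable_psum H (A j).
  move=> w; rewrite normrM normr_id ler_piMr// ger0_norm ?divr_ge0 ?sqr_ge0//.
  have := trunc_le1 (Y j w); rewrite -[_ ^+ 2]real_normK ?num_real//.
  by have := normr_ge0 (trunc (Y j w)); nra.
Qed.

Let quad_le : k * \sum_(j in ~: N) Ex P (fun w => x j w ^+ 2 * (`|trunc (Y j w)| / 2)) <= beta / 2.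
Proof.
have k0 := k_gt0 H.
apply: (@le_trans _ _ ((k * \sum_j Ex P (fun w => x j w ^+ 2 * `|Y j w| `^ q)) / 2)); last first.
  by rewrite ler_wpM2r// (sum_quad H (sub_AC H)).
rewrite -mulrA ler_pM2l//.
rewrite (bigID (mem (~: N)%SET) predT) /= mulrDl mulr_suml -[leLHS]addr0 lerD//; last first.
  by rewrite divr_ge0// sumr_ge0// => j _; apply: Ex_ge0 => w; rewrite mulr_ge0 ?powR_ge0 ?sqr_ge0.
apply: ler_sum => j _.
have L3 := L1_quad H (sub_AC H j).
rewrite -ExZr//; apply: Ex_le; last first.
- move=> w; rewrite mulrA ler_wpM2r// ler_wpM2l ?sqr_ge0//.
  by have [] := trunc_facts H (Y j w).
- exact: L1Zr.
- apply: L1_le (L1_x2 H j) _.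
    apply: measurable_funM; first exact/measurable_funX/(measurable_x H).
    apply: measurable_funM => //.
    apply: (measurableT_comp (@normr_measurable R setT)); apply: measurable_trunc.
    exact: measurable_psum H (A j).
  move=> w; rewrite normrM (ger0_norm (sqr_ge0 _)) ler_piMr ?sqr_ge0// ger0_norm ?divr_ge0//.
  by have := trunc_le1 (Y j w); lra.
Qed.

Section Weight.
Variables (g u : T -> R) (G : R).
Hypothesis mg : family_meas X D g.
Hypothesis mu : family_meas X D u.
Hypothesis g0 : forall w, 0 <= g w.
Hypothesis gG : forall w, g w <= G.

Let Eg0 : 0 <= Ex P g. Proof. exact: Ex_ge0. Qed.

(** Integration over t of the pointwise lower bound, compared with the upper bound for the
kernel expansion. The coefficient 1/4 of L is below 87/100, which makes the inequality
solvable for the supremum. *)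
Lemma window_mean_contraction L : (forall t, window_mean P x g u al t <= L) ->
  87 / 100 * window_mean P x g u al 0 <= L / 4 + 57 / 50 * (al * Ex P g).
Proof.
move=> hL; have lam0 : 0 < 3^-1 :> R by [].
have b0 := moment_bound_ge0 P x p k.
have hlow t := window_kernel_ge H mg mu g0 gG al0 hL t lam0.
have [LM EM] := Ex_kern_mean H i0; have [LA EA] := Ex_kern_abs H i0.
have [LS ES] := Ex_kern_sqr H i0.
have [LW EW] := Ex_window_mean H mg mu g0 gG al0.
have [Lm Em] := Ex_window_kernel H mg mu g0 gG al0.
have e0 := window_mean_ge0 P x u al g0 0.
have L0 : 0 <= L := le_trans e0 (hL 0).
set e := window_mean P x g u al 0 in hlow e0 *.
pose c := 5 * L / al.
have c0 : 0 <= c by rewrite divr_ge0 ?(ltW al0)// mulr_ge0.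
have Ll : L1 Q (fun t => e * kern_mean P x A B i0 t - c * kern_abs P x A B i0 t -
    3^-1 / 2 * window_mean P x g u al t - Ex P g * (k * kern_sqr P x A B i0 t) / (2 * 3^-1)).
  by do ?[apply: L1B|apply: L1Zr|apply: L1Zl].
have := Ex_le Ll Lm hlow.
rewrite ExB; [|by do ?[apply: L1B|apply: L1Zr|apply: L1Zl]|by do ?[apply: L1Zr|apply: L1Zl]].
rewrite ExB; [|by do ?[apply: L1B|apply: L1Zr|apply: L1Zl]|by do ?[apply: L1Zr|apply: L1Zl]].
rewrite ExB; [|by apply: L1Zl|by apply: L1Zl].
rewrite (ExZl e LM) (ExZl c LA) (ExZl _ LW) ExZr; last by do 2 apply: L1Zl.
rewrite (ExZl _ (L1Zl k LS)) (ExZl k LS) EA ES Em.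
have hup := window_kernel_mean_le H al0 mg mu g0 gG.
have hM : (1 - (16^-1 + 5 * beta)) / 2 <= Ex Q (kern_mean P x A B i0).
  rewrite EM; apply: le_trans (ler_wpM2r _ (far_mean_ge H i0)) _ => //.
  rewrite mulr_suml le_eqVlt; apply/orP; left; apply/eqP; apply: eq_bigr => j _.
  rewrite -ExZr; last exact: (L1_xtrunc H j).
  by apply: Ex_eq => w; rewrite mulrA.
have h1 := ler_wpM2l e0 hM.
have h2 := ler_wpM2l c0 third_le.
have h3 := ler_wpM2l Eg0 quad_le.
move=> hh.
exact: (contraction_arithmetic al0 beta75 beta_al e0 L0 Eg0 hh hup h1 h2 h3 EW).
Qed.

End Weight.

Section BoundedWeight.
Variables (g u : T -> R) (G : R).
Hypothesis mg : family_meas X D g.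
Hypothesis mu : family_meas X D u.
Hypothesis g0 : forall w, 0 <= g w.
Hypothesis gG : forall w, g w <= G.

(** The previous inequality holds for every position of the window. With L the supremum of
the window means it becomes a bound for L itself. *)
Lemma concentration_bounded : Ex P (fun w => g w * tent ((W w - u w) / al)) <= 2 * (al * Ex P g).
Proof.
pose E := range (window_mean P x g u al).
have supE : has_sup E.
  split; first by exists (window_mean P x g u al 0); exists 0.
  exists (Ex P g) => _ [t _ <-]; apply: Ex_le; last first.
  - by move=> w; rewrite ler_piMr// tent_le1.
  - exact: L1_g mg g0 gG.
  - exact: (L1_window H al mg mu g0 gG).
have hL t : window_mean P x g u al t <= sup E.
  by apply: ub_le_sup; [case: supE|exists t].
have mut t : family_meas X D (fun w => u w - t).
  by apply: measurable_funB => //; exact: measurable_cst.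
have shift s t : window_mean P x g (fun w => u w - t) al s = window_mean P x g u al (t + s).
  by apply: Ex_eq => w; rewrite /window; congr (_ * tent (_ / _)); ring.
have L0 : window_mean P x g u al 0 = Ex P (fun w => g w * tent ((W w - u w) / al)).
  by apply: Ex_eq => w; rewrite /window addr0.
have h t : 87 / 100 * window_mean P x g u al t <= sup E / 4 + 57 / 50 * (al * Ex P g).
  have := window_mean_contraction mg (mut t) g0 gG (L := sup E); rewrite shift addr0; apply => s.
  by rewrite shift.
have hs : sup E <= (sup E / 4 + 57 / 50 * (al * Ex P g)) / (87 / 100).
  apply: ge_sup; first by case: supE.
  by move=> _ [t _ <-]; rewrite ler_pdivlMr// mulrC h.
have := hL 0; rewrite L0 => /le_trans; apply.
have c0 : 0 <= al * Ex P g by rewrite mulr_ge0 ?(ltW al0)// Ex_ge0.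
by move: hs; rewrite ler_pdivlMr//; lra.
Qed.

End BoundedWeight.

(** Weights are unbounded in the application (g = |x_i Y_i|); monotone convergence along
min(g, n) removes the boundedness. *)
Lemma concentration (g u : T -> R) :
  family_meas X D g -> family_meas X D u -> (forall w, 0 <= g w) -> L1 P g ->
  Ex P (fun w => g w * tent ((W w - u w) / al)) <= 2 * (al * Ex P g).
Proof.
move=> mg mu g0 Lg.
pose gn (n : nat) w := Num.min (g w) n%:R.
have mgn n : family_meas X D (gn n).
  by apply: measurable_minr => //; exact: measurable_cst.
have gn0 n w : 0 <= gn n w by rewrite le_min g0 ler0n.
have gnle n w : gn n w <= g w by rewrite ge_min lexx.
have gnG n w : gn n w <= n%:R by rewrite ge_min lexx orbT.
have mgT := family_meas_meas mg.
have mt : measurable_fun setT (fun w => tent ((W w - u w) / al)).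
  have m1 : measurable_fun setT (fun w => (W w - u w) / al).
    apply: measurable_funM => //; apply: measurable_funB; last exact: family_meas_meas mu.
    by apply: measurable_sum => j; exact: measurable_x H j.
  exact: (measurableT_comp (continuous_measurable_fun (@continuous_tent R)) m1).
have Lgt : L1 P (fun w => g w * tent ((W w - u w) / al)).
  apply: L1_le Lg _; first exact: measurable_funM.
  by move=> w; rewrite ger0_norm ?mulr_ge0 ?tent_ge0// ler_piMr ?tent_le1.
rewrite -lee_fin (ExE Lgt).
pose f (n : nat) w := (gn n w * tent ((W w - u w) / al))%:E.
have := @cvg_monotone_convergence _ _ _ P setT measurableT f _ _ _.
have mf n : measurable_fun setT (f n).
  apply/measurable_EFinP; apply: measurable_funM => //; exact: family_meas_meas (mgn n).
have f0 n w : setT w -> (0 <= f n w)%E.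
  by move=> _; rewrite lee_fin mulr_ge0 ?tent_ge0.
have fh w : setT w -> {homo f^~ w : n m / (n <= m)%N >-> (n <= m)%E}.
  move=> _ n m nm; rewrite lee_fin ler_wpM2r ?tent_ge0// /gn le_min !ge_min lexx /=.
  by rewrite ler_nat nm orbT.
move=> /(_ mf f0 fh) cv.
have lim w : limn (f^~ w) = (g w * tent ((W w - u w) / al))%:E.
  apply: cvg_lim => //; apply: cvg_near_cst; near=> n.
  rewrite /f /gn min_l//; near: n; exact: nbhs_infty_ger.
rewrite (_ : (\int[P]_w _)%E = (\int[P]_w limn (f^~ w))%E); last first.
  by apply: eq_integral => w _; rewrite lim.
rewrite -(cvg_lim _ cv)//; apply: lime_le.
  by apply/cvg_ex; eexists; exact: cv.
near=> n.
have Ln : L1 P (gn n).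
  by apply: L1_le Lg _; [exact: family_meas_meas (mgn n)|move=> w; rewrite ger0_norm].
have Lnt : L1 P (fun w => gn n w * tent ((W w - u w) / al)).
  apply: L1_le Lgt _.
    by apply: measurable_funM => //; exact: family_meas_meas (mgn n).
  by move=> w; rewrite ger0_norm ?mulr_ge0 ?tent_ge0// ler_wpM2r ?tent_ge0.
rewrite /f -(ExE Lnt) lee_fin.
apply: le_trans (concentration_bounded (mgn n) mu (gn0 n) (gnG n)) _.
by rewrite ler_pM2l// ler_pM2l//; exact: Ex_le.
Unshelve. all: by end_near. Qed.

End Concentrate.

(** * The Stein equation of the normal law *)

Section SteinEquation.
Context (R : realType).
Local Notation mu := (@lebesgue_measure R).
Local Notation phi := (normal_pdf 0 1 : R -> R).

Lemma normal_pdf01E (w : R) : phi w = normal_peak 1 * expR (- (w ^+ 2 / 2)).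
Proof.
by rewrite normal_pdfE ?oner_neq0// /normal_fun subr0 expr1n mulNr.
Qed.

Lemma normal_pdf_gt0 (w : R) : 0 < phi w.
Proof. by rewrite normal_pdf01E mulr_gt0 ?expR_gt0// normal_peak_gt0// oner_neq0. Qed.

Lemma is_derive_normal_pdf (w : R) : is_derive w (1 : R) phi (- w * phi w).
Proof.
rewrite (_ : (phi : R -> R) = (fun w => normal_peak 1 * expR (- (w ^+ 2 / 2)))); last first.
  by apply/funext => v; exact: normal_pdf01E.
have d1 : is_derive w (1 : R) (fun v => - (v ^+ 2 / 2)) (- w).
  apply: (@is_derive_quadratic _ _ _ _ 1) => t.
  rewrite (_ : _ - _ - _ = - (t ^+ 2 / 2)); last by field.
  by rewrite normrN ger0_norm ?divr_ge0 ?sqr_ge0//; have := sqr_ge0 t; lra.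
have d2 : is_derive w (1 : R) (fun v => expR (- (v ^+ 2 / 2))) (expR (- (w ^+ 2 / 2)) * - w).
  by apply: (@is_derive1_comp _ expR (fun v => - (v ^+ 2 / 2))).
rewrite /= (_ : - w * _ = normal_peak 1 * (expR (- (w ^+ 2 / 2)) * - w)); last by ring.
apply: (@is_derive1_comp _ (fun u => normal_peak 1 * u)) => //.
apply: (@is_derive_quadratic _ _ _ _ 0) => t.
by rewrite mul0r (_ : _ - _ = 0) ?normr0//; ring.
Qed.

Lemma cvg_normal_pdf : phi w @[w --> +oo%R] --> (0 : R).
Proof.
rewrite (_ : (phi : R -> R) = (fun w => normal_peak 1 * expR (- (w ^+ 2 / 2)))); last first.
  by apply/funext => v; exact: normal_pdf01E.
rewrite -[X in _ --> X](mulr0 (normal_peak 1)); apply: cvgM; first exact: cvg_cst.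
apply: (cvg_comp (fun w : R => w ^+ 2 / 2) (fun w => expR (- w))); last exact: cvgr_expR.
by apply: gt0_cvgMly; [|exact: cvgr_expr2].
Qed.

Lemma integrable_phi (D : set R) : measurable D -> mu.-integrable D (EFin \o phi).
Proof.
move=> mD; apply: (integrableS measurableT) => //; exact: integrable_normal_pdf.
Qed.

Lemma continuous_phi : continuous phi.
Proof. by apply: continuous_normal_pdf; rewrite oner_neq0. Qed.

Definition ncdf (w : R) : R := \int[mu]_(t in `]-oo, w]) phi t.
Definition nccdf (w : R) : R := \int[mu]_(t in `]w, +oo[) phi t.

(** For t >= w > 0 one has w phi(t) <= t phi(t), and the right-hand side integrates to phi(w). *)
Lemma mills_right (w : R) : 0 < w -> w * nccdf w <= phi w.
Proof.
move=> w0.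
have dN t : is_derive t (1 : R) (fun v => - phi v) (t * phi t).
  have d := is_derive_normal_pdf t.
  by rewrite (_ : t * phi t = - (- t * phi t)); [exact: is_deriveN|ring].
have c1 : continuous (fun t : R => t * phi t).
  by move=> t; apply: cvgM; [exact: cvg_id|exact: continuous_phi].
have E : (\int[mu]_(t in `[w, +oo[) (t * phi t)%:E = 0%:E - (- phi w)%:E)%E.
  apply: (@ge0_continuous_FTC2y R _ (fun v => - phi v) w 0) => //.
  - by move=> t wt; rewrite mulr_ge0 ?ltW ?normal_pdf_gt0// (lt_le_trans w0).
  - exact: continuous_subspaceT.
  - by have := cvgN cvg_normal_pdf; rewrite oppr0; exact.
  - apply/cvg_at_right_filter; apply: cvgN; exact: continuous_phi.
  - by move=> t _; rewrite derive1E; have [_ ->] := dN t.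
have mD : measurable (`[w, +oo[ : set R) by [].
have Lp : mu.-integrable `[w, +oo[ (EFin \o phi) by exact: integrable_phi.
have L2 : mu.-integrable `[w, +oo[ (EFin \o (fun t : R => t * phi t)).
  apply/integrableP; split.
    by apply/measurable_EFinP; apply: measurable_funTS; exact: continuous_measurable_fun.
  pose F : R -> R := fun t => t * phi t.
  have -> : (\int[mu]_(t in `[w, +oo[) `|(EFin \o F) t|)%E =
      (\int[mu]_(t in `[w, +oo[) (t * phi t)%:E)%E.
    apply: eq_integral => t; rewrite /F inE /= in_itv/= andbT => wt.
    by rewrite ger0_norm// mulr_ge0 ?normal_pdf_ge0// (le_trans (ltW w0)).
  by rewrite E -EFinB ltry.
have -> : phi w = \int[mu]_(t in `[w, +oo[) (t * phi t).
  by rewrite /Rintegral E /= sub0r opprK.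
rewrite /nccdf Rintegral_itv_obnd_cbnd; last by apply: integrable_phi.
rewrite -RintegralZl//; apply: le_Rintegral => //; first by have := @integrableZl _ _ _ mu _ mD w _ Lp.
by move=> t; rewrite /= in_itv/= andbT => wt; rewrite ler_wpM2r// ltW// normal_pdf_gt0.
Qed.

Lemma ncdfN (w : R) : ncdf (- w) = nccdf w.
Proof.
rewrite /nccdf Rintegral_itv_obnd_cbnd; last by apply: integrable_phi.
rewrite /ncdf /Rintegral ge0_integration_by_substitutionNy.
- by congr fine; apply: eq_integral => t _; rewrite /= !normal_pdf01E sqrrN.
- exact: continuous_subspaceT continuous_phi.
- by move=> t _; exact: normal_pdf_ge0.
Qed.

Lemma mills_left (w : R) : w < 0 -> - w * ncdf w <= phi w.
Proof.
move=> w0; have := @mills_right (- w); rewrite oppr_gt0 => /(_ w0).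
by rewrite -ncdfN opprK !normal_pdf01E sqrrN.
Qed.

Lemma normal_pdf1_ge : 6^-1 <= phi 1.
Proof.
rewrite normal_pdf01E /normal_peak expr1n !mul1r.
have e : 2^-1 <= expR (- 2^-1 : R).
  by apply: le_trans (expR_ge1Dx _); lra.
have s : Num.sqrt (pi *+ 2 : R) <= 3.
  rewrite -[leRHS]ger0_norm// -sqrtr_sqr ler_wsqrtr//.
  by have := pihalf_lt2 R; rewrite ltr_pdivrMr//; lra.
have s0 : 0 < Num.sqrt (pi *+ 2 : R) by rewrite sqrtr_gt0 pmulrn_lgt0// pi_gt0.
apply: (@le_trans _ _ (3^-1 * 2^-1)); first lra.
by apply: ler_pM => //; rewrite lef_pV2 ?posrE.
Qed.

Lemma is_derive_lower_integral (f : R -> R) (w : R) : continuous f ->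
  mu.-integrable setT (EFin \o f) ->
  is_derive w (1 : R) (fun w => \int[mu]_(t in `]-oo, w]) f t) (f w).
Proof.
move=> cf Lf.
have [||||d1 d2] := @continuous_FTC1 R f -oo%O w (w + 1).
- by rewrite ltrDl.
- exact: (integrableS measurableT).
- by rewrite /= ltNyr.
- exact: cf.
by rewrite derive1E in d2; exact: (DeriveDef d1 d2).
Qed.

Section Solution.
Variable h : R -> R.
Hypothesis ch : continuous h.
Hypothesis h0 : forall t, 0 <= h t.
Hypothesis h1 : forall t, h t <= 1.

Definition nint : R := \int[mu]_t (h t * phi t).
Definition hlow (w : R) : R := \int[mu]_(t in `]-oo, w]) (h t * phi t).
Definition hupp (w : R) : R := \int[mu]_(t in `]w, +oo[) (h t * phi t).
(** The bounded solution of f'(w) - w f(w) = h(w) - E h(N), obtained by variation of constants. *)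
Definition stein (w : R) : R := (hlow w - nint * ncdf w) / phi w.

Let chphi : continuous (fun t => h t * phi t).
Proof. by move=> t; apply: cvgM; [exact: ch|exact: continuous_phi]. Qed.

Let hphi_le t : h t * phi t <= phi t.
Proof. by rewrite ler_piMl// ltW// normal_pdf_gt0. Qed.

Let hphi_ge0 t : 0 <= h t * phi t.
Proof. by rewrite mulr_ge0// ltW// normal_pdf_gt0. Qed.

Lemma integrable_hphi (D : set R) : measurable D ->
  mu.-integrable D (EFin \o (fun t => h t * phi t)).
Proof.
move=> mD; apply: (@le_integrable _ _ _ mu _ mD _ (EFin \o phi)); last exact: integrable_phi.
  by apply/measurable_EFinP; apply: measurable_funTS; exact: continuous_measurable_fun.
by move=> t _; rewrite lee_fin ger0_norm// (le_trans (hphi_le t))// ler_norm.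
Qed.

Let split_line (f : R -> R) w : mu.-integrable setT (EFin \o f) ->
  \int[mu]_t f t = \int[mu]_(t in `]-oo, w]) f t + \int[mu]_(t in `]w, +oo[) f t.
Proof.
move=> Lf; have -> : [set: R] = `]-oo, w]%classic `|` `]w, +oo[%classic.
  apply/seteqP; split => // t _ /=; rewrite !in_itv/= andbT.
  by have [tw|wt] := leP t w; [left|right].
rewrite Rintegral_setU//; last first.
  apply/eqP; rewrite -subset0 => t [] /=; rewrite !in_itv/= andbT => tw wt.
  by move: (lt_le_trans wt tw); rewrite ltxx.
by apply: (integrableS measurableT) => //; exact: measurableU.
Qed.

Lemma ncdf_ge0 w : 0 <= ncdf w.
Proof. by apply: Rintegral_ge0 => t _; exact: normal_pdf_ge0. Qed.

Lemma nccdf_ge0 w : 0 <= nccdf w.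
Proof. by apply: Rintegral_ge0 => t _; exact: normal_pdf_ge0. Qed.

Lemma ncdfD w : ncdf w + nccdf w = 1.
Proof.
rewrite -split_line; last exact: integrable_phi.
by rewrite /Rintegral integral_normal_pdf.
Qed.

Lemma hlowD w : hlow w + hupp w = nint.
Proof. by rewrite -split_line//; exact: integrable_hphi. Qed.

Lemma hlow_bnd w : 0 <= hlow w <= ncdf w.
Proof.
rewrite Rintegral_ge0//=; apply: le_Rintegral => //.
- exact: integrable_hphi.
- exact: integrable_phi.
Qed.

Lemma hupp_bnd w : 0 <= hupp w <= nccdf w.
Proof.
rewrite Rintegral_ge0//=; apply: le_Rintegral => //.
- exact: integrable_hphi.
- exact: integrable_phi.
Qed.

Lemma nint_bnd : 0 <= nint <= 1.
Proof.
rewrite -(hlowD 0) -(ncdfD 0).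
by have /andP[? ?] := hlow_bnd 0; have /andP[? ?] := hupp_bnd 0; apply/andP; split; lra.
Qed.

Let num_le_ncdf w : `|hlow w - nint * ncdf w| <= ncdf w.
Proof.
have /andP[a0 a1] := hlow_bnd w; have /andP[n0 n1] := nint_bnd; have b0 := ncdf_ge0 w.
have : nint * ncdf w <= ncdf w by rewrite ler_piMl.
have : 0 <= nint * ncdf w by rewrite mulr_ge0.
by rewrite ler_norml => *; apply/andP; split; lra.
Qed.

Let num_le_nccdf w : `|hlow w - nint * ncdf w| <= nccdf w.
Proof.
have /andP[a0 a1] := hupp_bnd w; have /andP[n0 n1] := nint_bnd; have b0 := nccdf_ge0 w.
have -> : hlow w - nint * ncdf w = nint * nccdf w - hupp w.
  have := hlowD w; have := ncdfD w => e1 e2.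
  have -> : ncdf w = 1 - nccdf w by rewrite -e1 addrK.
  by rewrite -e2; ring.
have : nint * nccdf w <= nccdf w by rewrite ler_piMl.
have : 0 <= nint * nccdf w by rewrite mulr_ge0.
by rewrite ler_norml => *; apply/andP; split; lra.
Qed.

(** The numerator is at most the normal mass on either side of w, so the Mills ratio bound
on the side away from 0 applies. *)
Lemma stein_mul_le1 w : `|w * stein w| <= 1.
Proof.
have p0 := normal_pdf_gt0 w.
rewrite /stein mulrA normrM normfV (gtr0_norm p0) ler_pdivrMr// mul1r normrM.
have [w0|w0|->] := ltrgt0P w; last by rewrite mul0r normal_pdf_ge0.
- apply: le_trans (mills_right w0); rewrite ler_wpM2l ?num_le_nccdf//; exact: ltW.
- apply: le_trans (mills_left w0); rewrite ler_wpM2l ?num_le_ncdf//; lra.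
Qed.

(** For |w| > 1 this follows from the bound on w f(w). For |w| <= 1 the numerator is at most
1/2, being bounded by both tails, and the density is at least 1/6. *)
Lemma stein_le3 w : `|stein w| <= 3.
Proof.
have [w1|w1] := leP `|w| 1; last first.
  have := stein_mul_le1 w; rewrite normrM => ws.
  by have := ler_peMl (normr_ge0 (stein w)) (ltW w1); lra.
have p0 := normal_pdf_gt0 w.
have p6 : 6^-1 <= phi w.
  apply: le_trans normal_pdf1_ge _; rewrite !normal_pdf01E ler_pM2l ?normal_peak_gt0 ?oner_neq0//.
  rewrite ler_expR lerN2 ler_wpM2r// expr1n -[w ^+ 2]real_normK ?num_real//.
  by rewrite expr_le1.
rewrite /stein normrM normfV (gtr0_norm p0) ler_pdivrMr//.
have := num_le_ncdf w; have := num_le_nccdf w; have := ncdfD w; lra.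
Qed.

Definition stein' (w : R) : R := w * stein w + (h w - nint).

Lemma is_derive_stein w : is_derive w (1 : R) stein (stein' w).
Proof.
have p0 := normal_pdf_gt0 w; have pn0 : phi w != 0 by rewrite gt_eqF.
have d1 : is_derive w (1 : R) hlow (h w * phi w).
  apply: (@is_derive_lower_integral (fun t => h t * phi t)); first exact: chphi.
  exact: integrable_hphi.
have d2 : is_derive w (1 : R) ncdf (phi w).
  apply: is_derive_lower_integral; first exact: continuous_phi.
  exact: integrable_phi.
have d3 := is_derive_normal_pdf w.
have d4 : is_derive w (1 : R) (fun t => (phi t)^-1) (- (phi w) ^- 2 *: (- w * phi w)).
  exact: is_deriveV.
have d5 := is_deriveZ nint d2.
have d6 := is_deriveB d1 d5.
have d7 := is_deriveM d6 d4.
apply: is_derive_eq.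
rewrite /stein' /stein /GRing.scale/= !fctE.
rewrite -[(_ \*: _) w]/(nint * ncdf w); by field.
Qed.

Lemma continuous_stein : continuous stein.
Proof.
move=> w; apply: differentiable_continuous; apply/derivable1_diffP.
by have [] := is_derive_stein w.
Qed.

Lemma continuous_stein' : continuous stein'.
Proof.
move=> w; apply: cvgD; first by apply: cvgM; [exact: cvg_id|exact: continuous_stein].
by apply: cvgB; [exact: ch|exact: cvg_cst].
Qed.

Lemma stein'_le2 w : `|stein' w| <= 2.
Proof.
rewrite /stein'; apply: le_trans (ler_normD _ _) _.
have := stein_mul_le1 w; have /andP[a0 a1] := nint_bnd.
have := h0 w; have := h1 w => ? ? ?.
have : `|h w - nint| <= 1 by rewrite ler_norml; apply/andP; split; lra.
lra.
Qed.

End Solution.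

End SteinEquation.

(** * The smoothed indicator *)

Section SmoothStep.
Context (R : realType) (al c : R).
Hypothesis al0 : 0 < al.
Implicit Types (t w v : R).

Definition smooth w : R := 1 - step ((w - c) / al).

Lemma continuous_smooth : continuous smooth.
Proof.
move=> w; apply: cvgB; first exact: cvg_cst.
apply: (@continuous_comp _ _ _ (fun w => (w - c) / al) (@step R)); last exact: continuous_step.
by apply: cvgM; [apply: cvgB; [exact: cvg_id|exact: cvg_cst]|exact: cvg_cst].
Qed.

Lemma smooth_ge0 w : 0 <= smooth w.
Proof. by rewrite subr_ge0 step_le1. Qed.

Lemma smooth_le1 w : smooth w <= 1.
Proof. by rewrite gerBl step_ge0. Qed.

Lemma smooth_diff_le1 w v : `|smooth w - smooth v| <= 1.
Proof.
have := smooth_ge0 w; have := smooth_ge0 v; have := smooth_le1 w; have := smooth_le1 v.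
by rewrite ler_norml => *; apply/andP; split; lra.
Qed.

Lemma smooth1 w : w <= c - al -> smooth w = 1.
Proof. by move=> wc; rewrite /smooth step_leN1 ?subr0// ler_pdivrMr//; lra. Qed.

Lemma smooth0 w : c + al <= w -> smooth w = 0.
Proof. by move=> wc; rewrite /smooth step_ge1 ?subrr// ler_pdivlMr//; lra. Qed.

Lemma smooth_nincr w v : w <= v -> smooth v <= smooth w.
Proof.
rewrite le_eqVlt => /predU1P[->//|wv].
rewrite lerD2l lerN2; set a := (w - c) / al; set b := (v - c) / al.
have ab : a <= b by rewrite ler_wpM2r ?invr_ge0 ?(ltW al0)// lerD2r ltW.
have [e _ E] := MVT_segment ab (fun t _ => is_derive_step t)
  (continuous_subspaceT (@continuous_step R)).
by rewrite -subr_ge0 E mulr_ge0 ?tent_ge0 ?subr_ge0.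
Qed.

Lemma smooth_mid w v r : 0 <= r <= 1 ->
  `|smooth w - smooth (w - r * v)| <= `|smooth w - smooth (w - v)|.
Proof.
move=> /andP[r0 r1]; have [v0|/ltW v0] := leP 0 v.
- have rv : r * v <= v by rewrite ler_piMl.
  have rv0 : 0 <= r * v by rewrite mulr_ge0.
  have s1 : smooth (w - r * v) <= smooth (w - v) by apply: smooth_nincr; lra.
  have s0 : smooth w <= smooth (w - r * v) by apply: smooth_nincr; lra.
  rewrite [leLHS]distrC [leRHS]distrC !ger0_norm; lra.
- have rv : v <= r * v.
    rewrite -subr_ge0 (_ : _ - _ = (1 - r) * - v); last by ring.
    by rewrite mulr_ge0 ?oppr_ge0 ?subr_ge0.
  have rv0 : r * v <= 0 by rewrite mulr_ge0_le0.
  have s1 : smooth (w - v) <= smooth (w - r * v) by apply: smooth_nincr; lra.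
  have s0 : smooth (w - r * v) <= smooth w by apply: smooth_nincr; lra.
  rewrite !ger0_norm; lra.
Qed.

(** The increment is an integral of tents located between w - y and w, which is the form to
which the concentration inequality applies. *)
Lemma smooth_diff_ker w y : `|y| <= 1 -> `|smooth w - smooth (w - y)| =
  2 / al * Ex (Q11 R) (fun t => tent ((w - c + t) / al) * `|ker y t|).
Proof.
move=> y1; rewrite (Ex_abs_ker (@continuous_scaled_tent _ al (w - c))
  (fun t => is_derive_scaled_step (w - c) t al0) (fun t => tent_ge0 _) y1).
rewrite addr0 -mulrBr normrM (gtr0_norm al0) /smooth.
rewrite (_ : w - y - c = w - c - y); last by ring.
rewrite [X in _ = _ * (_ * X / _)]distrC.
have an : al != 0 by rewrite gt_eqF.
rewrite (_ : 1 - _ - _ = step ((w - c - y) / al) - step ((w - c) / al)); last by ring.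
by move: `|_| => z; field.
Qed.

Local Notation f := (stein smooth).
Local Notation f' := (stein' smooth).

(** The mean value theorem, stated so that the intermediate point does not depend on the
sign of y. *)
Lemma stein_MVT w y : exists2 r, 0 <= r <= 1 & f w - f (w - y) = y * f' (w - r * y).
Proof.
have D := is_derive_stein continuous_smooth smooth_ge0 smooth_le1.
have ctf := continuous_stein continuous_smooth smooth_ge0 smooth_le1.
have [->|yn] := eqVneq y 0.
  by exists 0; rewrite ?lexx ?ler01//; rewrite subr0 subrr mul0r.
pose a := Num.min w (w - y); pose b := Num.max w (w - y).
have ab : a <= b by rewrite ge_min le_max lexx.
have [e + E] := MVT_segment ab (fun t _ => D t) (continuous_subspaceT ctf).
rewrite in_itv/= => /andP[ae eb].
have [y0|y0] := leP 0 y.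
- have ea : a = w - y by rewrite /a min_r//; lra.
  have be : b = w by rewrite /b max_l//; lra.
  have yp : 0 < y by rewrite lt_neqAle eq_sym yn.
  rewrite ea in ae E; rewrite be in eb E.
  exists ((w - e) / y).
    by apply/andP; split; rewrite ?ler_pdivlMr ?ler_pdivrMr//; lra.
  rewrite divfK// subKr E; ring.
- have ea : a = w by rewrite /a min_l//; lra.
  have be : b = w - y by rewrite /b max_r//; lra.
  rewrite ea in ae E; rewrite be in eb E.
  exists ((w - e) / y).
    by apply/andP; split; rewrite ?ler_ndivlMr ?ler_ndivrMr//; lra.
  rewrite divfK// subKr; have -> : f w - f (w - y) = - (f (w - y) - f w) by ring.
  by rewrite E; ring.
Qed.

End SmoothStep.

(** * Increments of the Stein solution *)

Section SteinIncrement.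
Context (R : realType) (p al c : R).
Hypothesis p2 : 2 < p.
Hypothesis p3 : p <= 3.
Hypothesis al0 : 0 < al.
Implicit Types (s w v r : R).
Local Notation h := (smooth al c).
Local Notation f := (stein h).
Local Notation f' := (stein' h).
Local Notation q := (p - 2).
Local Notation ch := (@continuous_smooth R al c).
Local Notation h0 := (@smooth_ge0 R al c).
Local Notation h1 := (@smooth_le1 R al c).

Lemma stein_lipschitz w y : `|f w - f (w - y)| <= 2 * `|y|.
Proof.
have [r _ ->] := stein_MVT al c w y.
rewrite normrM mulrC ler_wpM2r//; exact: (stein'_le2 ch h0 h1).
Qed.

(** The increment is at most 2 and at most |v| (5 + 2 |w|) when |v| <= 1. With
|w| <= |w - s| + |s|, the product |v| |s| is only kept when |s| <= 1; every remaining case is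
covered by the bound 2 and a power that is at least 1. *)
Lemma mul_stein_increment w v r s : 0 <= r <= 1 ->
  `|w * f w - (w - r * v) * f (w - r * v)| <=
  `|v| `^ q * (5 + 2 * `|w - s|) + 2 * `|s| `^ q.
Proof.
move=> /andP[r0 r1].
have v0 := normr_ge0 v; have s0 := normr_ge0 s; have ws0 := normr_ge0 (w - s).
have pv0 := powR_ge0 `|v| q; have ps0 := powR_ge0 `|s| q.
have le2 : `|w * f w - (w - r * v) * f (w - r * v)| <= 2.
  have := stein_mul_le1 ch h0 h1 w; have := stein_mul_le1 ch h0 h1 (w - r * v).
  by have := ler_normB (w * f w) ((w - r * v) * f (w - r * v)); lra.
have [v1|/ltW v1] := leP `|v| 1; last first.
  have pv1 := powq_ge1 p2 v1; apply: (le_trans le2).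
  have : `|v| `^ q * 5 <= `|v| `^ q * (5 + 2 * `|w - s|) by rewrite ler_wpM2l//; lra.
  lra.
have pv := powq_gev p3 (introT andP (conj v0 v1)).
have rv : `|r * v| <= `|v| by rewrite normrM (ger0_norm r0) ler_piMl.
have le_v : `|w * f w - (w - r * v) * f (w - r * v)| <= `|v| * (5 + 2 * `|w|).
  rewrite (_ : _ - _ = r * v * f w + (w - r * v) * (f w - f (w - r * v))); last by ring.
  apply: le_trans (ler_normD _ _) _; rewrite (normrM (r * v) (f w)) (normrM (w - r * v)).
  have a1 : `|r * v| * `|f w| <= `|v| * 3.
    by apply: ler_pM => //; exact: stein_le3 ch h0 h1 w.
  have a2 : `|w - r * v| * `|f w - f (w - r * v)| <= (`|w| + 1) * (2 * `|v|).
    apply: ler_pM => //.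
      by apply: le_trans (ler_normB _ _) _; rewrite lerD2l (le_trans rv).
    by apply: le_trans (stein_lipschitz _ _) _; rewrite ler_pM2l.
  lra.
have tri : `|w| <= `|w - s| + `|s| by rewrite -[X in `|X| <= _](subrK s) ler_normD.
have [s1|/ltW s1] := leP `|s| 1.
- have ps := powq_gev p3 (introT andP (conj s0 s1)).
  apply: (le_trans le_v).
  have b1 : `|v| * (5 + 2 * `|w|) <= `|v| * (5 + 2 * `|w - s|) + `|v| * (2 * `|s|).
    by rewrite -mulrDr ler_wpM2l//; lra.
  have b2 : `|v| * (5 + 2 * `|w - s|) <= `|v| `^ q * (5 + 2 * `|w - s|).
    by rewrite ler_wpM2r//; lra.
  have b3 : `|v| * (2 * `|s|) <= 2 * `|s| by rewrite ler_piMl// mulr_ge0.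
  lra.
- have ps := powq_ge1 p2 s1; apply: (le_trans le2).
  have : 0 <= `|v| `^ q * (5 + 2 * `|w - s|) by rewrite mulr_ge0//; lra.
  lra.
Qed.

(** In the application s is the sum over C i, so that w - s is independent of the block B i
of v. *)
Definition increment_bound w v s : R :=
  `|h w - h (w - v)| + (`|v| `^ q * (5 + 2 * `|w - s|) + 2 * `|s| `^ q).

Lemma stein'_increment w v r s : 0 <= r <= 1 ->
  `|f' w - f' (w - r * v)| <= increment_bound w v s.
Proof.
move=> r01; rewrite /stein' (_ : _ - _ =
  (h w - h (w - r * v)) + (w * f w - (w - r * v) * f (w - r * v))); last by ring.
apply: le_trans (ler_normD _ _) _; apply: lerD; first exact: smooth_mid.
exact: mul_stein_increment.
Qed.

(** The increment of the solution is y times its derivative at an intermediate point. *)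
Lemma stein_increment w y s :
  `|y * f' w - (f w - f (w - y))| <= `|y| * increment_bound w y s.
Proof.
have [r r01 ->] := stein_MVT al c w y.
by rewrite -mulrBr normrM ler_wpM2l//; exact: stein'_increment.
Qed.

End SteinIncrement.

Section IncrementMean.
Context d (T : measurableType d) (R : realType) (P : probability T R).
Context (J : finType) (X : J -> {RV P >-> R}).
Context (x : J -> T -> R) (A B C : J -> {set J}) (p k : R).
Hypothesis H : local_dependence X x A B C p k.
Implicit Types (D E : {set J}) (i j l : J).
Local Notation S := (psum x).
Local Notation beta := (moment_bound P x p k).
Local Notation q := (p - 2).
Local Notation W := (fun w => \sum_j x j w).
Local Notation Q := (Q11 R).

Context (al c : R).
Hypothesis al0 : 0 < al.
Hypothesis beta75 : 75 * beta <= 1.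
Hypothesis beta_al : 10 * beta <= al.
Local Notation h := (smooth al c).

Let mW : measurable_fun setT W.
Proof. by apply: measurable_sum => j; exact: measurable_x H j. Qed.

Let measurable_h d' (T' : measurableType d') (u : T' -> R) :
  measurable_fun setT u -> measurable_fun setT (fun w => h (u w)).
Proof.
by apply: measurableT_comp; exact: continuous_measurable_fun (@continuous_smooth R al c).
Qed.

Let measurable_tent d' (T' : measurableType d') (f : T' -> R) :
  measurable_fun setT f -> measurable_fun setT (fun w => tent (f w)).
Proof.
by apply: measurableT_comp; exact: continuous_measurable_fun (@continuous_tent R).
Qed.

Section Weight.
Variables (i0 : J) (g v : T -> R).
Hypothesis mg : family_meas X (B i0) g.
Hypothesis mv : family_meas X (B i0) v.
Hypothesis g0 : forall w, 0 <= g w.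
Hypothesis Lg : L1 P g.
Hypothesis Lgv : L1 P (fun w => g w * `|v w| `^ q).

Let mvT : measurable_fun setT v. Proof. exact: family_meas_meas mv. Qed.
Let y w := trunc (v w).
Let my : family_meas X (B i0) y. Proof. exact: measurable_trunc mv. Qed.
Let myT : measurable_fun setT y. Proof. exact: family_meas_meas my. Qed.

Let ker_tent_le1 w t : `|tent ((W w - c + t) / al) * `|ker (y w) t| | <= 1.
Proof.
by rewrite normrM normr_id mulr_ile1// ?ker_le1// ger0_norm ?tent_ge0 ?tent_le1.
Qed.

Let Lgy : L1 P (fun w => g w * `|y w|).
Proof.
apply: (L1_le _ Lg) => [|w].
  by apply: measurable_funM; [exact: L1_meas Lg|exact: measurableT_comp].
by rewrite ger0_norm ?mulr_ge0// ler_piMr// trunc_le1.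
Qed.

Let weighted_trunc :
  Ex P (fun w => g w * `|h (W w) - h (W w - y w)|) <= 2 * Ex P (fun w => g w * `|y w|).
Proof.
pose Kt w t := tent ((W w - c + t) / al) * `|ker (y w) t|.
have mker : measurable_fun setT (fun z : T * R => ker (y z.1) z.2).
  apply: measurable_ker; last exact: measurable_snd.
  exact: (measurableT_comp myT measurable_fst).
have mK : measurable_fun setT (fun z : T * R => Kt z.1 z.2).
  apply: measurable_funM; last exact: measurableT_comp.
  apply: measurable_tent; apply: measurable_funM => //; apply: measurable_funD => //.
  apply: measurable_funB => //; exact: (measurableT_comp mW measurable_fst).
have mk : measurable_fun setT (fun z : T * R => `|ker (y z.1) z.2|) by exact: measurableT_comp.
have k1 w t : `| `|ker (y w) t| | <= 1 by rewrite normr_id ker_le1.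
have E1 : Ex P (fun w => g w * `|h (W w) - h (W w - y w)|) =
    2 / al * Ex Q (fun t => Ex P (fun w => g w * Kt w t)).
  rewrite (Ex_swapM Lg mK ker_tent_le1) -ExZl; last exact: L1_swapM2 Lg mK ker_tent_le1.
  by apply: Ex_eq => w; rewrite smooth_diff_ker ?trunc_le1// mulrCA.
have E2 : Ex Q (fun t => Ex P (fun w => g w * `|ker (y w) t|)) =
    Ex P (fun w => g w * `|y w|) / 2.
  rewrite (Ex_swapM Lg mk k1) -ExZr//; apply: Ex_eq => w.
  by rewrite Ex_abs_ker1 ?trunc_le1// mulrA.
have le t : Ex P (fun w => g w * Kt w t) <=
    2 * al * Ex P (fun w => g w * `|ker (y w) t|).
  pose gt w := g w * `|ker (y w) t|.
  have mgt : family_meas X (B i0) gt.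
    by apply: measurable_funM => //; apply: measurableT_comp => //; exact: measurable_ker.
  have gt0 w : 0 <= gt w by rewrite mulr_ge0.
  have Lgt : L1 P gt.
    apply: (L1_le (family_meas_meas mgt) Lg) => w.
    by rewrite ger0_norm// ler_piMr// ker_le1.
  have := @concentration _ _ _ _ _ _ _ _ _ _ _ _ H i0 al al0 beta75 beta_al
    gt (fun=> c - t) mgt (measurable_cst _) gt0 Lgt.
  rewrite mulrA; apply: le_trans; rewrite le_eqVlt; apply/orP; left; apply/eqP.
  apply: Ex_eq => w; rewrite /Kt /gt (_ : W w - (c - t) = W w - c + t); last by ring.
  by rewrite mulrAC mulrA.
rewrite E1; apply: (@le_trans _ _ (2 / al * (2 * al * (Ex P (fun w => g w * `|y w|) / 2)))).
  rewrite ler_pM2l ?divr_gt0// -E2 -ExZl; last exact: L1_swapM Lg mk k1.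
  apply: Ex_le => //; first exact: L1_swapM Lg mK ker_tent_le1.
  by apply: L1Zl; exact: L1_swapM Lg mk k1.
have an : al != 0 by rewrite gt_eqF.
by move: (Ex _ _) => z; rewrite (_ : _ / _ * _ = 2 * z)//; field.
Qed.

(** For |v| <= 1 the increment of h is an average over t of tents at W - c + t. The kernel at
t is absorbed into the weight, the concentration inequality is applied for each t, and
integrating the kernel returns |v|. For |v| > 1 the increment is at most 1 <= |v|^(p-2). *)
Lemma weighted_smooth_diff :
  Ex P (fun w => g w * `|h (W w) - h (W w - v w)|) <= 2 * Ex P (fun w => g w * `|v w| `^ q).
Proof.
have Lh (u : T -> R) : measurable_fun setT u ->
    L1 P (fun w => g w * `|h (W w) - h (W w - u w)|).
  move=> mu; apply: (L1_le _ Lg) => [|w].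
    apply: measurable_funM; first exact: L1_meas Lg.
    apply: measurableT_comp => //; apply: measurable_funB; first exact: measurable_h.
    by apply: measurable_h; exact: measurable_funB.
  by rewrite ger0_norm ?mulr_ge0// ler_piMr// smooth_diff_le1.
have le_yv w : `|y w| <= `|v w| `^ q by have [] := trunc_facts H (v w).
have pt w : g w * `|h (W w) - h (W w - v w)| <=
    g w * `|h (W w) - h (W w - y w)| + (g w * `|v w| `^ q - g w * `|y w|).
  rewrite -mulrBr -mulrDr ler_wpM2l//.
  have := le_yv w; rewrite /y /trunc; have [v1|/ltW v1] := leP `|v w| 1; first lra.
  rewrite normr0 => _; have := powq_ge1 (ld_p2 H) v1.
  by have := smooth_diff_le1 al c (W w) (W w - v w); have := normr_ge0 (h (W w) - h (W w - 0)); lra.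
have := Ex_le (Lh v mvT) (L1D (Lh y myT) (L1B Lgv Lgy)) pt.
rewrite (ExD (Lh y myT) (L1B Lgv Lgy)) (ExB Lgv Lgy).
have le2 : Ex P (fun w => g w * `|y w|) <= Ex P (fun w => g w * `|v w| `^ q).
  by apply: Ex_le => // w; rewrite ler_wpM2l.
have := weighted_trunc; move: (Ex _ _) (Ex _ _) (Ex _ _) (Ex _ _) le2 => a b e z; lra.
Qed.

End Weight.
End IncrementMean.

(** * The bound for smoothed indicators *)

(** Three increments for each index, and each costs 97/10 + 2 times the moment bound. *)
Lemma total_arithmetic (R : realType) (s1 s2 s3 s4 s5 b : R) :
  s5 <= b -> s4 <= b -> s3 <= b -> s2 <= b -> s1 <= b ->
  97 / 10 * (s4 + s2 + s1) + 2 * (s5 + 2 * s3) <= 351 / 10 * b.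
Proof. lra. Qed.

Section MainEstimate.
Context d (T : measurableType d) (R : realType) (P : probability T R).
Context (J : finType) (X : J -> {RV P >-> R}).
Context (x : J -> T -> R) (A B C : J -> {set J}) (p k : R).
Hypothesis H : local_dependence X x A B C p k.
Implicit Types (D E : {set J}) (i j l : J).
Local Notation S := (psum x).
Local Notation beta := (moment_bound P x p k).
Local Notation q := (p - 2).
Local Notation W := (fun w => \sum_j x j w).
Local Notation Y i := (S (A i)).
Local Notation V i := (S (B i)).
Local Notation Z i := (S (C i)).

Context (al c : R).
Hypothesis al0 : 0 < al.
Hypothesis beta75 : 75 * beta <= 1.
Hypothesis beta_al : 10 * beta <= al.
Local Notation h := (smooth al c).
Local Notation f := (stein h).
Local Notation f' := (stein' h).
Local Notation ch := (@continuous_smooth R al c).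
Local Notation h0 := (@smooth_ge0 R al c).
Local Notation h1 := (@smooth_le1 R al c).
Local Notation inc i v := (fun w => increment_bound p al c (W w) (v w) (Z i w)).

Let mW : measurable_fun setT W.
Proof. by apply: measurable_sum => j; exact: measurable_x H j. Qed.

Let measurable_cont (F : R -> R) d' (T' : measurableType d') (u : T' -> R) :
  continuous F -> measurable_fun setT u -> measurable_fun setT (fun w => F (u w)).
Proof. by move=> cF; apply: measurableT_comp; exact: continuous_measurable_fun. Qed.

Let LW2 : L1 P (fun w => W w ^+ 2).
Proof. apply: L1_sq_sum => j; [exact: measurable_x H j|exact: L1_x2 H j]. Qed.

(** E|W| <= 1 and E|Z_i| is at most about 0.34, both from second moments. *)
Lemma Ex_abs_complement i : Ex P (fun w => `|S (~: C i)%SET w|) <= 27 / 20.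
Proof.
have LZ2 := L1_S2 H (C i).
have LZ := L1_abs (L1_S H (~: C i)%SET).
have LR : L1 P (fun w => 2^-1 * W w ^+ 2 + (10 / 7) * Z i w ^+ 2).
  by apply: L1D; apply: L1Zl.
have pt w : `|S (~: C i)%SET w| <= 27 / 40 + (2^-1 * W w ^+ 2 + (10 / 7) * Z i w ^+ 2).
  rewrite -psumC; move: (\sum_j x j w) (Z i w) => a b.
  have aa : `|a| <= 2^-1 * a ^+ 2 + 2^-1.
    by rewrite -[a ^+ 2]real_normK ?num_real//; have := sqr_ge0 (`|a| - 1); rewrite sqrrB1; lra.
  have bb : `|b| <= (10 / 7) * b ^+ 2 + 7 / 40.
    rewrite -[b ^+ 2]real_normK ?num_real//; have := sqr_ge0 (`|b| - 7 / 20).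
    by rewrite sqrrB; lra.
  by apply: le_trans (ler_normB _ _) _; lra.
apply: le_trans (Ex_le LZ (L1D (L1_cst P _) LR) pt) _.
rewrite (ExD (L1_cst P _) LR) Ex_cst ExD; [|exact: L1Zl|exact: L1Zl].
rewrite !ExZl// (ld_var H).
have := small_psumC H (fintype.subxx (C i)); have b := beta75; lra.
Qed.

Section Weight.
Variables (i : J) (D : {set J}) (g : T -> R).
Hypothesis DB : D \subset B i.
Hypothesis mg : family_meas X (B i) g.
Hypothesis g0 : forall w, 0 <= g w.
Hypothesis Lg : L1 P g.
Hypothesis LgD : L1 P (fun w => g w * `|S D w| `^ q).
Hypothesis LgZ : L1 P (fun w => g w * `|Z i w| `^ q).

Let mv : family_meas X (B i) (S D). Proof. exact: (family_meas_psum H DB). Qed.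
Let mgv : family_meas X (B i) (fun w => g w * `|S D w| `^ q).
Proof. by apply: measurable_funM => //; exact: measurable_abs_powR. Qed.

Let decouple : L1 P (fun w => g w * `|S D w| `^ q * `|W w - Z i w|) /\
  Ex P (fun w => g w * `|S D w| `^ q * `|W w - Z i w|) <=
  27 / 20 * Ex P (fun w => g w * `|S D w| `^ q).
Proof.
have e w : `|W w - Z i w| = `|S (~: C i)%SET w| by rewrite psumC.
have mZ : family_meas X (~: C i)%SET (fun w => `|S (~: C i)%SET w|).
  by apply: measurableT_comp => //; exact: (family_meas_psum H (fintype.subxx _)).
have [L E] := indep_familiesM (ld_indC H i) mgv mZ LgD (L1_abs (L1_S H _)).
have -> : (fun w => g w * `|S D w| `^ q * `|W w - Z i w|) =
    (fun w => g w * `|S D w| `^ q * `|S (~: C i)%SET w|) by apply/funext => w; rewrite e.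
split => //; rewrite E mulrC ler_wpM2r ?Ex_abs_complement//.
by apply: Ex_ge0 => w; rewrite mulr_ge0 ?powR_ge0.
Qed.

Let Lh : L1 P (fun w => g w * `|h (W w) - h (W w - S D w)|).
Proof.
apply: (L1_le _ Lg) => [|w].
  apply: measurable_funM; first exact: L1_meas Lg.
  apply: measurableT_comp => //; apply: measurable_funB; first exact: measurable_cont ch mW.
  apply: (measurable_cont ch); apply: measurable_funB => //; exact: measurable_psum H D.
by rewrite ger0_norm ?mulr_ge0// ler_piMr// smooth_diff_le1.
Qed.

Let inc_split : (fun w => g w * inc i (S D) w) =
  (fun w => g w * `|h (W w) - h (W w - S D w)| +
   ((5 * (g w * `|S D w| `^ q) + 2 * (g w * `|S D w| `^ q * `|W w - Z i w|)) +
    2 * (g w * `|Z i w| `^ q))).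
Proof. by apply/funext => w; rewrite /increment_bound; ring. Qed.

Lemma L1_weighted_increment : L1 P (fun w => g w * inc i (S D) w).
Proof.
have [L _] := decouple; rewrite inc_split; apply: L1D => //.
by apply: L1D; [apply: L1D|]; apply: L1Zl.
Qed.

(** 97/10 = 2 + 5 + 2 * 27/20: the increment of h, and the increment of w f(w) after
decoupling |W - Z_i| from the block. *)
Lemma weighted_increment : Ex P (fun w => g w * inc i (S D) w) <=
  97 / 10 * Ex P (fun w => g w * `|S D w| `^ q) + 2 * Ex P (fun w => g w * `|Z i w| `^ q).
Proof.
have [L E] := decouple; rewrite inc_split.
have L5 := L1Zl 5 LgD; have L2 := L1Zl 2 L; have LZ := L1Zl 2 LgZ.
rewrite (ExD Lh (L1D (L1D L5 L2) LZ)) (ExD (L1D L5 L2) LZ) (ExD L5 L2) !ExZl//.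
have := weighted_smooth_diff H c al0 beta75 beta_al mg mv g0 Lg LgD.
move: (Ex _ _) (Ex _ _) (Ex _ _) (Ex _ _) E => a b e z; lra.
Qed.

End Weight.

Let xi i w := x i w * Y i w.
Let AB i : A i \subset B i := ld_AB H i.
Let BC i : B i \subset C i := ld_BC H i.
Let Lxi i : L1 P (xi i). Proof. exact: L1_xS H i (A i). Qed.
Let Laxi i : L1 P (fun w => `|x i w| * `|Y i w|). Proof. exact: L1_abs_xS H i (A i). Qed.

Let mx i : family_meas X (A i) (x i). Proof. exact: family_meas_own H i. Qed.
Let mY i : family_meas X (A i) (Y i). Proof. exact: (family_meas_psum H (fintype.subxx _)). Qed.
Let mxi i : family_meas X (A i) (xi i). Proof. by apply: measurable_funM; [exact: mx|exact: mY]. Qed.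
Let maxi i : family_meas X (B i) (fun w => `|x i w| * `|Y i w|).
Proof.
apply: family_measS (AB i) _.
by apply: measurable_funM; apply: measurableT_comp => //; [exact: mx|exact: mY].
Qed.

Let bounded_f' (u : T -> R) : measurable_fun setT u -> L1 P (fun w => f' (u w)).
Proof.
move=> mu; apply: (@L1_bnd _ _ _ _ _ 2).
  exact: measurable_cont (continuous_stein' ch h0 h1) mu.
by move=> w; exact: (stein'_le2 ch h0 h1).
Qed.

Let bounded_M (g u : T -> R) : L1 P g -> measurable_fun setT u ->
  L1 P (fun w => g w * f' (u w)) /\ L1 P (fun w => g w * f (u w)).
Proof.
move=> Lg mu; split.
- have -> : (fun w => g w * f' (u w)) = (fun w => f' (u w) * g w).
    by apply/funext => w; rewrite mulrC.
  apply: (L1_bndM (c := 2)) => //; last by move=> w; exact: (stein'_le2 ch h0 h1).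
  exact: measurable_cont (continuous_stein' ch h0 h1) mu.
- have -> : (fun w => g w * f (u w)) = (fun w => f (u w) * g w).
    by apply/funext => w; rewrite mulrC.
  apply: (L1_bndM (c := 3)) => //; last by move=> w; exact: (stein_le3 ch h0 h1).
  exact: measurable_cont (continuous_stein ch h0 h1) mu.
Qed.

Let mWS D : measurable_fun setT (fun w => W w - S D w).
Proof. by apply: measurable_funB => //; exact: measurable_psum H D. Qed.

Let third i D := Ex P (fun w => `|x i w| * `|Y i w| * `|S D w| `^ q).
Let thirdI i D := Ex P (fun w => `|x i w| * `|Y i w|) * Ex P (fun w => `|S D w| `^ q).

(** The difference of the two expectations is written as
E xi (E f'(W) - E f'(W - V)) + E xi (f'(W - V) - f'(W)) + E (xi f'(W) - x (f(W) - f(W - Y))),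
by the independence of xi and W - V and of x and W - Y. *)
Lemma stein_summand i :
  `|Ex P (xi i) * Ex P (fun w => f' (W w)) - Ex P (fun w => x i w * f (W w))| <=
  97 / 10 * (thirdI i (B i) + third i (B i) + third i (A i)) +
  2 * (thirdI i (C i) + 2 * third i (C i)).
Proof.
have AC := fintype.subset_trans (AB i) (BC i).
have CC := fintype.subxx (C i).
have g0 w : 0 <= `|x i w| * `|Y i w| by rewrite mulr_ge0.
have LfW := bounded_f' mW; have LfV := bounded_f' (mWS (B i)).
have E1 : Ex P (fun w => xi i w * f' (W w - V i w)) =
    Ex P (xi i) * Ex P (fun w => f' (W w - V i w)).
  have mf : family_meas X (~: B i)%SET (fun w => f' (W w - V i w)).
    have -> : (fun w => f' (W w - V i w)) = (fun w => f' (S (~: B i)%SET w)).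
      by apply/funext => w; rewrite -psumC.
    apply: (measurable_cont (continuous_stein' ch h0 h1)).
    exact: (family_meas_psum H (fintype.subxx _)).
  by have [_] := indep_familiesM (ld_indB H i) (mxi (i:=i)) mf (Lxi i) LfV.
have E2 : Ex P (fun w => x i w * f (W w - Y i w)) = 0.
  have e : (fun w => f (W w - Y i w)) = (fun w => f (S (~: A i)%SET w)).
    by apply/funext => w; rewrite -psumC.
  have L : L1 P (fun w => f (W w - Y i w)).
    apply: (@L1_bnd _ _ _ _ _ 3).
      exact: measurable_cont (continuous_stein ch h0 h1) (mWS (A i)).
    by move=> w; exact: (stein_le3 ch h0 h1).
  apply: (Ex_mean0 H) => //; rewrite e.
  apply: (measurable_cont (continuous_stein ch h0 h1)).
  exact: (family_meas_psum H (fintype.subxx _)).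
have [LW' _] := bounded_M (Lxi i) mW.
have [LV' _] := bounded_M (Lxi i) (mWS (B i)).
have [_ LxW] := bounded_M (L1_x H i) mW.
have [_ LxY] := bounded_M (L1_x H i) (mWS (A i)).
(* The factor E xi_i is a constant, so the increment is averaged with weight 1. *)
have T1 : `|Ex P (fun w => f' (W w)) - Ex P (fun w => f' (W w - V i w))| <=
    97 / 10 * Ex P (fun w => `|V i w| `^ q) + 2 * Ex P (fun w => `|Z i w| `^ q).
  have e D : (fun w => 1 * `|S D w| `^ q) = (fun w => `|S D w| `^ q).
    by apply/funext => w; rewrite mul1r.
  have LB := L1_Sq H (BC i); have LC := L1_Sq H CC.
  have m1 : family_meas X (B i) (fun=> 1 : R) by exact: measurable_cst.
  have o01 (w : T) : (0 : R) <= 1 by [].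
  have := weighted_increment (fintype.subxx (B i)) m1 o01 (L1_cst P 1).
  have := L1_weighted_increment (fintype.subxx (B i)) m1 o01 (L1_cst P 1).
  rewrite !e => /(_ LB LC) Li /(_ LB LC); apply: le_trans.
  rewrite -ExB//; apply: Ex_abs_le => //; first exact: L1B.
  move=> w; rewrite mul1r -[V i w in X in `|X| <= _]mul1r.
  by apply: (stein'_increment c (ld_p2 H) (ld_p3 H) al0); rewrite ler01 lexx.
(* In the other two increments |xi_i| is the weight; it depends on the block A_i only. *)
have Lt D : D \subset C i -> L1 P (fun w => `|x i w| * `|Y i w| * `|S D w| `^ q).
  by move=> DC; exact: (L1_third H AC DC).
have T2 : `|Ex P (fun w => xi i w * f' (W w - V i w)) - Ex P (fun w => xi i w * f' (W w))| <=
    97 / 10 * third i (B i) + 2 * third i (C i).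
  apply: le_trans (weighted_increment (fintype.subxx (B i)) (maxi (i:=i)) g0 (Laxi i)
    (Lt _ (BC i)) (Lt _ CC)).
  rewrite -ExB//; apply: Ex_abs_le; first exact: L1B.
    exact: L1_weighted_increment (fintype.subxx (B i)) (maxi (i:=i)) g0 (Laxi i)
      (Lt _ (BC i)) (Lt _ CC).
  move=> w; rewrite -mulrBr normrM distrC normrM ler_wpM2l//.
  rewrite -[V i w in X in `|X| <= _]mul1r.
  by apply: (stein'_increment c (ld_p2 H) (ld_p3 H) al0); rewrite ler01 lexx.
have T3 : `|Ex P (fun w => xi i w * f' (W w)) -
      (Ex P (fun w => x i w * f (W w)) - Ex P (fun w => x i w * f (W w - Y i w)))| <=
    97 / 10 * third i (A i) + 2 * third i (C i).
  apply: le_trans (weighted_increment (AB i) (maxi (i:=i)) g0 (Laxi i)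
    (Lt _ AC) (Lt _ CC)).
  rewrite -ExB// -ExB//; last exact: L1B.
  apply: Ex_abs_le; first by apply: L1B => //; exact: L1B.
    exact: L1_weighted_increment (AB i) (maxi (i:=i)) g0 (Laxi i) (Lt _ AC) (Lt _ CC).
  move=> w; rewrite (_ : _ - _ = x i w * (Y i w * f' (W w) - (f (W w) - f (W w - Y i w)))).
    rewrite normrM -mulrA ler_wpM2l//; exact: (stein_increment c (ld_p2 H) (ld_p3 H) al0).
  by rewrite /xi; ring.
have xE : `|Ex P (xi i)| <= Ex P (fun w => `|x i w| * `|Y i w|).
  by apply: Ex_abs_le => // w; rewrite normrM.
have T1' := ler_pM (normr_ge0 _) (normr_ge0 _) xE T1.
rewrite -normrM in T1'.
rewrite E1 in T2; rewrite E2 subr0 in T3.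
move: T1' T2 T3; rewrite /thirdI.
move: (Ex P (xi i)) (Ex P (fun w => f' (W w))) (Ex P (fun w => f' (W w - V i w)))
  (Ex P (fun w => xi i w * f' (W w))) (Ex P (fun w => x i w * f (W w))) => a b e m n.
move: (third i (B i)) (third i (A i)) (third i (C i)) => tB tA tC.
move: (Ex P _) (Ex P _) (Ex P _) => u v z T1' T2 T3.
rewrite (_ : a * b - n = a * (b - e) + (a * e - m) + (m - n)); last by ring.
apply: le_trans (ler_normD _ _) _; have := ler_normD (a * (b - e)) (a * e - m).
clear E1 E2 T1 xE; lra.
Qed.

Lemma smooth_bound : `|Ex P (fun w => h (W w)) - nint h| <= 351 / 10 * beta.
Proof.
have Lh : L1 P (fun w => h (W w)).
  apply: (@L1_bnd _ _ _ _ _ 1); first exact: measurable_cont ch mW.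
  by move=> w; rewrite ger0_norm ?smooth_ge0 ?smooth_le1.
have LxW i : L1 P (fun w => x i w * f (W w)) by have [_] := bounded_M (L1_x H i) mW.
have LfW := bounded_f' mW.
have E : Ex P (fun w => h (W w)) - nint h = \sum_i
    (Ex P (xi i) * Ex P (fun w => f' (W w)) - Ex P (fun w => x i w * f (W w))).
  rewrite sumrB -mulr_suml (Ex_W2 H) mul1r -Ex_sum// -ExB//; last exact: L1_sum.
  rewrite -[nint h](Ex_cst P) -ExB//; last exact: L1_cst.
  apply: Ex_eq => w; rewrite -mulr_suml /stein'; ring.
rewrite E; apply: le_trans (ler_norm_sum _ _ _) _.
apply: le_trans (ler_sum _ (fun i _ => stein_summand i)) _.
rewrite big_split/= -!mulr_sumr !big_split/= -mulr_sumr.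
have AC i := fintype.subset_trans (AB i) (BC i).
have CC i := fintype.subxx (C i).
exact: total_arithmetic (sum_third_indep H AC CC) (sum_third_indep H AC BC)
  (sum_third H AC CC) (sum_third H AC BC) (sum_third H AC AC).
Qed.

End MainEstimate.

(** * Kolmogorov distance *)

Section NormalWindow.
Context (R : realType).
Local Notation phi := (normal_pdf 0 1 : R -> R).

Lemma normal_pdf_le_half (w : R) : phi w <= 2^-1.
Proof.
rewrite normal_pdf01E -[leRHS]mulr1; apply: ler_pM.
- exact: normal_peak_ge0.
- exact: expR_ge0.
- have s : 2 <= Num.sqrt (pi *+ 2 : R).
    rewrite -[leLHS]ger0_norm// -sqrtr_sqr ler_wsqrtr//.
    by have := pi_ge2 R; lra.
  rewrite /normal_peak expr1n mul1r lef_pV2 ?posrE//.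
  exact: lt_le_trans s.
- by rewrite -expR0 ler_expR oppr_le0 divr_ge0// sqr_ge0.
Qed.

Lemma ncdf_window (a b : R) : a <= b -> ncdf b <= ncdf a + (b - a) / 2.
Proof.
move=> ab.
have D (w : R) : is_derive w (1 : R) (@ncdf R) (phi w).
  apply: is_derive_lower_integral; [exact: continuous_phi|exact: integrable_phi].
have cn : continuous (@ncdf R).
  move=> w; apply: differentiable_continuous; apply/derivable1_diffP.
  by have [] := D w.
have [e _ E] := MVT_segment ab (fun t _ => D t) (continuous_subspaceT cn).
have : phi e * (b - a) <= 2^-1 * (b - a).
  by rewrite ler_wpM2r ?subr_ge0//; exact: normal_pdf_le_half.
lra.
Qed.

Variables (al c : R).
Hypothesis al0 : 0 < al.
Local Notation h := (smooth al c).
Local Notation ch := (@continuous_smooth R al c).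
Local Notation h0 := (@smooth_ge0 R al c).
Local Notation h1 := (@smooth_le1 R al c).

Lemma nint_smooth_le : nint h <= ncdf (c + al).
Proof.
rewrite -(hlowD ch h0 h1 (c + al)).
have -> : hupp h (c + al) = 0.
  rewrite /hupp /Rintegral integral0_eq// => t; rewrite /= in_itv/= andbT => ct.
  by rewrite smooth0 ?mul0r// ltW.
by rewrite addr0; have /andP[] := hlow_bnd ch h0 h1 (c + al).
Qed.

Lemma nint_smooth_ge : ncdf (c - al) <= nint h.
Proof.
rewrite -(hlowD ch h0 h1 (c - al)).
have -> : hlow h (c - al) = ncdf (c - al).
  apply: eq_Rintegral => t; rewrite inE/= in_itv/= => ct.
  by rewrite smooth1 ?mul1r.
by have /andP[? _] := hupp_bnd ch h0 h1 (c - al); rewrite lerDl.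
Qed.

End NormalWindow.

Section KolmogorovDistance.
Context d (T : measurableType d) (R : realType) (P : probability T R).
Context (J : finType) (X : J -> {RV P >-> R}).
Context (x : J -> T -> R) (A B C : J -> {set J}) (p k : R).
Hypothesis H : local_dependence X x A B C p k.
Local Notation beta := (moment_bound P x p k).
Local Notation W := (fun w => \sum_j x j w).
Hypothesis beta75 : 75 * beta <= 1.

(** The indicator of w <= z lies between the smoothed indicators centred at z - al and z + al.
Their normal means differ from the normal distribution function at z by at most al. As al
must be positive, it is taken to be 10 beta + e with e arbitrarily small. *)
Lemma kolmogorov_distance (z : R) :
  `|Ex P (fun w => (W w <= z)%R%:R) - ncdf z| <= 75 * beta.
Proof.
have mW : measurable_fun setT W by apply: measurable_sum => j; exact: measurable_x H j.
have LI : L1 P (fun w => (W w <= z)%R%:R).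
  apply: (@L1_bnd _ _ _ _ _ 1).
    by apply: measurable_b2r; apply: measurable_fun_ler => //; exact: mW.
  by move=> w; rewrite ger0_norm// lern1 leq_b1.
have b0 := moment_bound_ge0 P x p k.
apply/ler_addgt0Pr => e e0; pose al := 10 * beta + e.
have al0 : 0 < al by rewrite /al; lra.
have bal : 10 * beta <= al by rewrite /al; lra.
have Lh c : L1 P (fun w => smooth al c (W w)).
  apply: (@L1_bnd _ _ _ _ _ 1) => [|w]; last by rewrite ger0_norm ?smooth_ge0 ?smooth_le1.
  by apply: measurableT_comp mW; exact: continuous_measurable_fun (@continuous_smooth R al c).
have up : Ex P (fun w => (W w <= z)%R%:R) <= Ex P (fun w => smooth al (z + al) (W w)).
  apply: Ex_le => // w; have [wz|_] := leP (W w) z; last exact: smooth_ge0.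
  by rewrite smooth1 ?addrK.
have lo : Ex P (fun w => smooth al (z - al) (W w)) <= Ex P (fun w => (W w <= z)%R%:R).
  apply: Ex_le => // w; have [_|zw] := leP (W w) z; first exact: smooth_le1.
  by rewrite smooth0// subrK ltW.
have := smooth_bound H (z + al) al0 beta75 bal; have := smooth_bound H (z - al) al0 beta75 bal.
have := nint_smooth_le (z + al) al0; have := nint_smooth_ge (z - al) al0.
have w1 : z <= z + al + al by lra.
have w2 : z - al - al <= z by lra.
have := ncdf_window w1; have := ncdf_window w2.
rewrite !ler_norml; move: up lo.
rewrite (_ : z + al + al - z = 20 * beta + 2 * e); last by rewrite /al; ring.
rewrite (_ : z - (z - al - al) = 20 * beta + 2 * e); last by rewrite /al; ring.
move: (ncdf z) (ncdf (z + al + al)) (ncdf (z - al - al)) => n0 n1 n2.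
move: (nint (smooth al (z + al))) (nint (smooth al (z - al))) => m1 m2.
move: (Ex _ _) (Ex _ _) (Ex _ _) b0 => E0 E1 E2; move: beta => b *.
apply/andP; split; lra.
Qed.

End KolmogorovDistance.

(** * From random variables to real expectations *)

Section Reduction.
Context d (T : measurableType d) (R : realType) (P : probability T R).
Implicit Types (f g : T -> R).

Lemma variance_centered (X : {RV P >-> R}) : fine 'E_P[X] = 0 ->
  ('V_P[X] = \int[P]_w (X w ^+ 2)%:E)%E.
Proof.
move=> X0; rewrite /variance unlock X0 unlock; apply: eq_integral => w _ /=.
by rewrite expr2 -[X w in RHS]subr0.
Qed.

Lemma centered_sqr_L1 (X : {RV P >-> R}) : ('E_P[X] = 0)%E -> ('V_P[X] < +oo)%E ->
  L1 P (fun w => X w ^+ 2).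
Proof.
move=> X0 VX; apply/integrableP; split.
  by apply/measurable_EFinP; exact: measurable_funX.
move: VX; rewrite variance_centered ?X0//; congr (_ < _)%E.
by apply: eq_integral => w _ /=; rewrite ger0_norm ?sqr_ge0.
Qed.

Lemma Ex_ae f g : measurable_fun setT f -> measurable_fun setT g ->
  {ae P, forall w, f w = g w} -> Ex P f = Ex P g.
Proof.
move=> mf mg fg; congr fine; apply: ae_eq_integral => //.
- exact/measurable_EFinP.
- exact/measurable_EFinP.
- by apply: filterS fg => w /= -> _.
Qed.

Lemma ae_eq0_sqr f : L1 P (fun w => f w ^+ 2) -> measurable_fun setT f ->
  Ex P (fun w => f w ^+ 2) = 0 -> {ae P, forall w, f w = 0}.
Proof.
move=> Lf mf E0.
have := ExE Lf; rewrite E0 => /esym E.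
have mf2 : measurable_fun setT (fun w => (f w ^+ 2)%:E).
  by apply/measurable_EFinP; exact: measurable_funX.
have : (\int[P]_w `|(f w ^+ 2)%:E| = 0)%E.
  by rewrite -[RHS]E; apply: eq_integral => w _ /=; rewrite ger0_norm ?sqr_ge0.
move/(ae_eq_integral_abs P measurableT mf2); apply: filterS => w /= /(_ I) [].
by move/eqP; rewrite sqrf_eq0 => /eqP.
Qed.

Lemma cdfE (W : {RV P >-> R}) (z : R) : cdf W z = (Ex P (fun w => (W w <= z)%R%:R))%:E.
Proof.
rewrite ExE; last first.
  apply: (@L1_bnd _ _ _ _ _ 1); first by apply: measurable_b2r; exact: measurable_fun_ler.
  by move=> w; rewrite ger0_norm// lern1 leq_b1.
rewrite /cdf /distribution /pushforward.
have mW : measurable (W @^-1` `]-oo, z]) by rewrite -[X in measurable X]setTI; exact: measurable_funP.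
have := @integral_indic _ _ R P setT measurableT _ mW.
rewrite setIT => E; apply: (etrans (esym E)); apply: eq_integral => w _; rewrite indicE; congr ((nat_of_bool _)%:R%:E).
by apply/idP/idP; rewrite inE /= in_itv.
Qed.

Lemma std_normal_cdfE (z : R) : std_normal_cdf z = (ncdf z)%:E.
Proof.
rewrite /std_normal_cdf /normal_prob /ncdf /Rintegral fineK//.
by apply: integrable_fin_num => //; exact: integrable_phi.
Qed.

Context (J : finType) (X : J -> {RV P >-> R}).
Hypothesis meanX : forall i, ('E_P[X i] = 0)%E.
Hypothesis varX : forall i, ('V_P[X i] < +oo)%E.

Lemma L1_X2 i : L1 P (fun w => X i w ^+ 2).
Proof. exact: centered_sqr_L1 (meanX i) (varX i). Qed.

Lemma L1_X i : L1 P (X i).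
Proof. by apply: L1_sqrt (L1_X2 i). Qed.

Lemma Ex_X i : Ex P (X i) = 0.
Proof. by have := meanX i; rewrite unlock /Ex /Rintegral => ->. Qed.

(** E X_i^2 = (E X_i)^2 = 0 when X_i is independent of itself. *)
Lemma self_indep_degenerate i (D : {set J}) : indep_rv_family X i D -> i \in D ->
  {ae P, forall w, X i w = 0}.
Proof.
move=> /indep_rv_familyE ind iD; apply: ae_eq0_sqr (L1_X2 i) _ _ => //.
have mi : family_meas X [set i]%SET (X i) by exact: (@family_meas_X _ _ _ _ _ X i).
have mD : family_meas X D (X i).
  have sD : [set i]%SET \subset D by rewrite finset.sub1set.
  exact: (family_measS sD mi).
have [_] := indep_familiesM ind mi mD (L1_X i) (L1_X i).
by rewrite Ex_X mul0r => <-; apply: Ex_eq => w; rewrite expr2.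
Qed.

End Reduction.

(** * Removing degenerate variables *)

Section EssentialFamily.
Context (R : realType) (d : measure_display) (T : measurableType d).
Context (P : probability T R) (J : finType) (X : J -> {RV P >-> R}).
Context (A B C : J -> {set J}) (p kappa : R).
Hypothesis meanX : forall i : J, ('E_P[X i] = 0)%E.
Hypothesis varX : forall i : J, ('V_P[X i] < +oo)%E.
Context (W : {RV P >-> R}).
Hypothesis defW : forall w : T, W w = \sum_(i : J) X i w.
Hypothesis varW : ('V_P[W] = 1)%E.
Hypothesis p_gt2 : 2 < p.
Hypothesis p_le3 : p <= 3.
Hypothesis subAB : forall i : J, A i \subset B i.
Hypothesis subBC : forall i : J, B i \subset C i.
Hypothesis indepA : forall i : J, indep_rv_family X i (~: A i)%SET.
Hypothesis indepB : forall i : J, indep_families X (A i) (~: B i)%SET.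
Hypothesis indepC : forall i : J, indep_families X (B i) (~: C i)%SET.
Hypothesis le_kappa : forall i : J,
  (maxn #|neighbourhood B (C i)| #|[set j : J | i \in C j]%SET|)%:R <= kappa.

(** An index outside its own A i carries a variable that vanishes almost surely; it is replaced
by zero so that the cardinality conditions count the nonzero terms. *)
Definition essential (i : J) (w : T) : R := if i \in A i then X i w else 0.
Local Notation x := essential.

Lemma family_meas_essential i : family_meas X [set i]%SET (x i).
Proof.
rewrite /essential; case: (i \in A i); last exact: measurable_cst.
exact: (@family_meas_X _ _ _ _ _ X i).
Qed.

Let mx i : measurable_fun setT (x i).
Proof. exact: family_meas_meas (@family_meas_essential i). Qed.

Let msx : measurable_fun setT (fun w => \sum_i x i w).
Proof. by apply: measurable_sum => i; exact: mx. Qed.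

Lemma essential_ae : {ae P, forall w, forall i, x i w = X i w}.
Proof.
apply: filter_forall => i; rewrite /x.
case iA : (i \in A i); first by apply: filterE.
have iC : i \in (~: A i)%SET by rewrite finset.in_setC iA.
by apply: filterS (self_indep_degenerate meanX varX (indepA (i := i)) iC) => w ->.
Qed.

Lemma essential_sum_ae : {ae P, forall w, \sum_i x i w = W w}.
Proof. by apply: filterS essential_ae => w e; rewrite defW; apply: eq_bigr => i _. Qed.

Lemma essential_var : Ex P (fun w => (\sum_i x i w) ^+ 2) = 1.
Proof.
have EW : fine 'E_P[W] = 0.
  have -> : fine 'E_P[W] = Ex P W by rewrite unlock.
  have -> : Ex P W = Ex P (fun w => \sum_i X i w) by apply: Ex_eq.
  rewrite Ex_sum; last by move=> i _; exact: L1_X meanX varX i.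
  by apply: big1 => i _; exact: Ex_X meanX i.
rewrite (@Ex_ae _ _ _ _ _ (fun w => W w ^+ 2)).
- by have := varW; rewrite variance_centered// /Ex /Rintegral => ->.
- exact: measurable_funX.
- exact: measurable_funX.
- by apply: filterS essential_sum_ae => w ->.
Qed.

(** Some index lies in its own A i, for otherwise W would vanish almost surely; this index
belongs to N(C_i). *)
Lemma kappa_ge1 : 1 <= kappa.
Proof.
have [i iA|noA] := pickP (fun i => i \in A i).
  have iB := fintype.subsetP (subAB i) _ iA.
  have iC := fintype.subsetP (subBC i) _ iB.
  apply: le_trans (le_kappa i); rewrite ler1n leq_max; apply/orP; left.
  rewrite card_gt0; apply/finset.set0Pn; exists i; rewrite inE.
  by apply/finset.set0Pn; exists i; rewrite inE iC.
have := essential_var; rewrite (@Ex_eq _ _ _ _ _ (fun=> 0)) ?Ex_cst => [e|w].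
  by have := @ltr01 R; rewrite -e ltxx.
by rewrite big1 ?expr0n// => i _; rewrite /essential noA.
Qed.

Hypothesis momX : forall i, L1 P (fun w => `|X i w| `^ p).

Let p0 : 0 < p. Proof. by have := p_gt2; lra. Qed.

Lemma essential_pow_le i w : `|x i w| `^ p <= `|X i w| `^ p.
Proof.
rewrite /essential; case: ifP => // _; rewrite normr0 powR0 ?powR_ge0//.
by rewrite gt_eqF// p0.
Qed.

Let momx i : L1 P (fun w => `|x i w| `^ p).
Proof.
apply: (L1_le _ (momX i)) => [|w]; first exact: measurable_abs_powR.
by rewrite ger0_norm ?powR_ge0// essential_pow_le.
Qed.

Lemma essential_local_dependence : local_dependence X x A B C p kappa.
Proof.
split => //.
- exact: family_meas_essential.
- by move=> j /negPf jA w; rewrite /essential jA.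
- move=> j; rewrite /essential; case: (j \in A j); first exact: Ex_X meanX j.
  exact: Ex_cst.
- by move=> i; apply: indep_rv_familyE; exact: indepA.
- exact: kappa_ge1.
- by move=> i; apply: le_trans (le_kappa i); rewrite ler_nat leq_maxl.
- by move=> i; apply: le_trans (le_kappa i); rewrite ler_nat leq_maxr.
- exact: essential_var.
Qed.

Lemma essential_moment_bound : moment_bound P x p kappa <=
  kappa `^ (p - 1) * \sum_i Ex P (fun w => `|X i w| `^ p).
Proof.
rewrite ler_wpM2l ?powR_ge0//; apply: ler_sum => i _.
by apply: Ex_le => // w; exact: essential_pow_le.
Qed.

Lemma essential_cdf z : Ex P (fun w => (W w <= z)%R%:R) =
  Ex P (fun w => (\sum_i x i w <= z)%R%:R) :> R.
Proof.
apply: Ex_ae.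
- by apply: measurable_b2r; exact: measurable_fun_ler.
- by apply: measurable_b2r; apply: measurable_fun_ler => //; exact: msx.
- by apply: filterS essential_sum_ae => w ->.
Qed.

Lemma kolmogorov_bound z : `|Ex P (fun w => (W w <= z)%R%:R) - ncdf z| <=
  75 * kappa `^ (p - 1) * \sum_i Ex P (fun w => `|X i w| `^ p).
Proof.
have mb := essential_moment_bound; rewrite -mulrA.
set m := kappa `^ (p - 1) * _ in mb *.
have [small|large] := leP (75 * moment_bound P x p kappa) 1.
  rewrite essential_cdf.
  by apply: le_trans (kolmogorov_distance essential_local_dependence small z) _; rewrite ler_pM2l.
have E0 : 0 <= Ex P (fun w => (W w <= z)%R%:R) by apply: Ex_ge0 => w.
have E1 : Ex P (fun w => (W w <= z)%R%:R) <= 1.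
  have i01 w : ((W w <= z)%R%:R : R) <= 1 by rewrite lern1 leq_b1.
  rewrite -[leRHS](Ex_cst P); apply: Ex_le => //; last exact: L1_cst.
  apply: (@L1_bnd _ _ _ _ _ 1) => [|w]; last by rewrite ger0_norm.
  by apply: measurable_b2r; exact: measurable_fun_ler.
have := ncdf_ge0 z; have := nccdf_ge0 z; have := ncdfD z => N1 N2 N3.
apply: (@le_trans _ _ 1); first by rewrite ler_norml; apply/andP; split; lra.
lra.
Qed.

End EssentialFamily.

Local Open Scope ereal_scope.

Theorem theorem2p4 (R : realType) (d : measure_display) (T : measurableType d)
    (P : probability T R) (J : finType) (X : J -> {RV P >-> R})
    (meanX : forall i : J, 'E_P[X i] = 0)
    (varX : forall i : J, 'V_P[X i] < +oo)
    (W : {RV P >-> R}) (defW : forall w : T, W w = (\sum_(i : J) X i w)%R)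
    (varW : 'V_P[W] = 1)
    (p : R) (p_gt2 : (2 < p)%R) (p_le3 : (p <= 3)%R)
    (A B C : J -> {set J})
    (subAB : forall i : J, A i \subset B i)
    (subBC : forall i : J, B i \subset C i)
    (indepA : forall i : J, indep_rv_family X i (~: A i)%SET)
    (indepB : forall i : J, indep_families X (A i) (~: B i)%SET)
    (indepC : forall i : J, indep_families X (B i) (~: C i)%SET)
    (kappa : R)
    (le_kappa : forall i : J,
      ((maxn #|neighbourhood B (C i)| #|[set j : J | i \in C j]%SET|)%:R
         <= kappa)%R) :
  ereal_sup [set `|cdf W z - std_normal_cdf z| | z in [set: R]]
  <= (75 * kappa `^ (p - 1))%:E
     * \sum_(i : J) 'E_P[fun w => (`|X i w| `^ p)%R].
Proof.
have k1 : (1 <= kappa)%R.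
  exact: (kappa_ge1 meanX varX defW varW subAB subBC indepA le_kappa).
have K0 : (0 < 75 * kappa `^ (p - 1))%R.
  by rewrite mulr_gt0// powR_gt0//; exact: lt_le_trans k1.
have E0 i : 0 <= 'E_P[fun w => (`|X i w| `^ p)%R].
  by rewrite unlock; apply: integral_ge0 => w _; rewrite lee_fin powR_ge0.
apply: ge_ereal_sup => _ [z _ <-].
have [inf|fin] := eqVneq (\sum_(i : J) 'E_P[fun w => (`|X i w| `^ p)%R]) +oo.
  by rewrite inf gt0_muley ?lte_fin// leey.
have momX i : L1 P (fun w => `|X i w| `^ p)%R.
  apply/integrableP; split.
    by apply/measurable_EFinP; exact: measurable_abs_powR.
  rewrite ltey; apply: contra fin => /eqP Ei; rewrite -leye_eq.
  rewrite (bigD1 i)//= [X in X + _](_ : _ = +oo).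
    by rewrite addye// gt_eqF// (lt_le_trans (ltNye 0))// sume_ge0.
  rewrite unlock -[RHS]Ei; apply: eq_integral => w _ /=.
  by rewrite [X in _ = X%:E]ger0_norm ?powR_ge0.
have -> : \sum_(i : J) 'E_P[fun w => (`|X i w| `^ p)%R] =
    (\sum_(i : J) Ex P (fun w => `|X i w| `^ p))%R%:E.
  rewrite -sumEFin; apply: eq_bigr => i _.
  by rewrite (ExE (momX i)) unlock.
rewrite cdfE std_normal_cdfE -EFinB abse_EFin -EFinM lee_fin.
exact: (kolmogorov_bound meanX varX defW varW p_gt2 p_le3 subAB subBC indepA
  indepB indepC le_kappa momX z).
Qed.
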